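(* In each of the two cases (radial: $I=I_{\mathbb D;1,0}$ and $\mathfrak R_n^N=\mathcal R_n^N$; chordal: $I=I_{\mathbb H;0,\infty}$ and $\mathfrak R_n^N=\mathscr R_n^N$), the following holds. For each $M\in[0,\infty)$ and $n\in\mathbb N$ there exists an integer $N=N_n(M)>n$ such that $$\inf_{\gamma\in\mathfrak R_n^N}I(\gamma)\ge M.$$
   Context: $\mathbb H$ is the upper half-plane, $\mathbb D$ the unit disk, $\mathbb N=\{1,2,\dots\}$, $\mathbb D_m=e^{-m}\mathbb D$, $\inf\emptyset=+\infty$. **Curves and energy.** Radial case: let $\mathcal X_\infty$ denote the set of injective continuous $\gamma:[0,\infty)\to\overline{\mathbb D}$ with $\gamma(0)=1$, $\gamma(0,\infty)\subset\mathbb D$, $\gamma(t)\to0$ as $t\to\infty$, parameterized so that the conformal map $g_t:\mathbb D\setminus\gamma[0,t]\to\mathbb D$ with $g_t(0)=0$, $g_t'(0)>0$ has $g_t'(0)=e^t$. The driving function of $\gamma\in\mathcal X_\infty$ is the unique continuous $W:[0,\infty)\to\mathbb R$, $W_0=0$, with $\partial_tg_t(z)=g_t(z)\frac{e^{\mathrm iW_t}+g_t(z)}{e^{\mathrm iW_t}-g_t(z)}$. Chordal case: let $\mathscr X_\infty$ denote the set of injective continuous $\gamma:[0,\infty)\to\overline{\mathbb H}$ with $\gamma(0)=0$, $\gamma(0,\infty)\subset\mathbb H$, $\gamma(t)\to\infty$ as $t\to\infty$, parameterized so that the conformal map $g_t:\mathbb H\setminus\gamma[0,t]\to\mathbb H$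 with $g_t(z)-z\to0$ as $z\to\infty$ satisfies $\lim_{z\to\infty}z(g_t(z)-z)=2t$. The driving function of $\gamma\in\mathscr X_\infty$ is the unique continuous $W:[0,\infty)\to\mathbb R$, $W_0=0$, with $\partial_tg_t(z)=\frac2{g_t(z)-W_t}$. In both cases the Loewner energy ($I_{\mathbb D;1,0}$ on $\mathcal X_\infty$, respectively $I_{\mathbb H;0,\infty}$ on $\mathscr X_\infty$) is $I(\gamma)=\frac12\int_0^\infty(\frac{\mathrm d}{\mathrm dt}W_t)^2\mathrm dt$ if $W$ is absolutely continuous and $+\infty$ otherwise. **Escape events.** For integers $N>n>0$: $\mathcal R_n^N$ is the set of curves $\gamma\in\mathcal X_\infty$ with $\gamma[\rho_N,\infty)\not\subset\overline{\mathbb D}_n$, where $\rho_N=\inf\{t\ge0:|\gamma(t)|<e^{-N}\}$. $\mathscr R_n^N$ is the set of curves $\gamma\in\mathscr X_\infty$ with $\gamma[\tau_N,\infty)\cap n\mathbb D\neq\emptyset$, where $\tau_N=\inf\{t\ge0:|\gamma(t)|>N\}$. *)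

(* Defs.v *)
From HB Require Import structures.
From mathcomp Require Import all_boot all_order all_algebra.
From mathcomp Require Import all_classical all_reals all_analysis.
From mathcomp Require Import complex.
Set Implicit Arguments.
Unset Strict Implicit.
Unset Printing Implicit Defensive.
Import Order.TTheory GRing.Theory Num.Theory.
Import numFieldNormedType.Exports.
Local Open Scope classical_set_scope.
Local Open Scope ring_scope.

(* The topology of the complex plane is the one of [R[i]^o], the normed module *)
(* R[i] over itself. The library norm `|z| takes values in R[i]; [cmod] is the *)
(* same modulus with values in R.                                              *)

Section Plane.
Variable R : realType.
Local Notation C := (R[i]^o).

Definition cmod (z : C) : R := Num.sqrt (complex.Re z ^+ 2 + complex.Im z ^+ 2).

Lemma cmodE (z : C) : `|z| = ((cmod z)%:C)%C.
Proof. by case: z. Qed.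

(* e^{i x} for real x *)
Definition cis (x : R) : C := (cos x +i* sin x)%C.

Definition odisk (r : R) : set C := [set z | cmod z < r].
Definition cdisk (r : R) : set C := [set z | cmod z <= r].
Definition upper_half_plane : set C := [set z | 0 < complex.Im z].

(* [derivable f z 1] over the base field R[i] is complex differentiability. *)
Definition conformal_map (A B : set C) (f : C -> C) : Prop :=
  set_bij A B f /\ forall z, A z -> derivable f z 1.

(* z -> oo inside A *)
Definition infty_within (A : set C) : set_system C :=
  filter_from [set: R] (fun K => A `&` [set z | K < cmod z]).

Global Instance infty_within_filter (A : set C) : Filter (infty_within A).
Proof.
apply: filter_from_filter; first by exists 0.
move=> K L _ _; exists (Num.max K L) => // z [Az] /=.
by rewrite gt_max => /andP[Kz Lz].
Qed.

(* Time derivative of a complex-valued function on [0, +oo[, one-sided at 0. *)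
Definition is_time_derive (f : R -> C) (t : R) (v : C) : Prop :=
  ((h%:C)%C^-1 * (f (t + h) - f t)) @[h --> within [set h | 0 <= t + h] 0^'] --> v.

End Plane.

Section Energy.
Variable R : realType.
Local Notation C := (R[i]^o).
Local Notation mu := (@lebesgue_measure R).

Definition abs_continuous_on (a b : R) (f : R -> R) : Prop :=
  forall e : R, 0 < e -> exists2 d : R, 0 < d &
    forall (k : nat) (u v : 'I_k -> R),
      (forall i, a <= u i /\ u i <= v i /\ v i <= b) ->
      trivIset [set: 'I_k] (fun i => `]u i, v i[%classic) ->
      \sum_(i < k) (v i - u i) < d ->
      \sum_(i < k) `|f (v i) - f (u i)| < e.

(* Absolute continuity on [0, +oo[ is meant on every [0, T]; under a finite    *)
(* Dirichlet integral this agrees, by Cauchy-Schwarz, with the uniform         *)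
(* epsilon-delta condition on [0, +oo[.                                        *)
Definition dirichlet_energy (W : R -> R) : \bar R :=
  if `[< forall T : R, 0 <= T -> abs_continuous_on 0 T W >]
  then ((2^-1)%:E * \int[mu]_(t in `[0%R, +oo[) ((derive1 W t) ^+ 2)%:E)%E
  else +oo%E.

(* Curves and driving functions are functions on R of which only the values    *)
(* on [0, +oo[ matter. A driving function exists by Loewner's theorem and is   *)
(* unique up to its values on negative times, which do not affect              *)
(* [dirichlet_energy]: the infimum below is over a one-point set.              *)
Definition energy_of (driving : set (R -> R)) : \bar R :=
  ereal_inf (dirichlet_energy @` driving).

(* f[s, +oo[, for a time s that may be infinite *)
Definition image_from (f : R -> C) (s : \bar R) : set C :=
  f @` [set t | (s <= t%:E)%E].

(* inf {t >= 0 | P t}, with inf of the empty set equal to +oo *)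
Definition hitting_time (P : set R) : \bar R :=
  ereal_inf (EFin @` (`[0, +oo[ `&` P)).

End Energy.

Section Radial.
Variable R : realType.
Local Notation C := (R[i]^o).
Local Notation D := (@odisk R 1).

(* The time-t mapping-out function D \ gamma[0,t] -> D. *)
Definition radial_map (gamma : R -> C) (t : R) (g : C -> C) : Prop :=
  let A := D `\` gamma @` `[0, t] in
  [/\ conformal_map A D g, A 0, g 0 = 0 & 0 < derive1 g 0].

Definition radial_curve (gamma : R -> C) : Prop :=
  [/\ {within `[0, +oo[, continuous gamma},
      set_inj `[0, +oo[ gamma,
      gamma 0 = 1,
      (forall t : R, 0 < t -> D (gamma t)) &
      gamma t @[t --> +oo] --> (0 : C)]
  /\ forall t : R, 0 <= t ->
       exists2 g, radial_map gamma t g & derive1 g 0 = ((expR t)%:C)%C.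

Definition radial_driving (gamma : R -> C) : set (R -> R) :=
  [set W : R -> R | [/\ {within `[0, +oo[, continuous W}, W 0 = 0 &
    exists2 g : R -> C -> C,
      (forall t : R, 0 <= t -> radial_map gamma t (g t)) &
      forall (t : R) (z : C), 0 <= t -> (D `\` gamma @` `[0, t]) z ->
        is_time_derive (g ^~ z) t
          (g t z * ((cis (W t) + g t z) / (cis (W t) - g t z)))]].

Definition radial_energy (gamma : R -> C) : \bar R :=
  energy_of (radial_driving gamma).

Definition radial_rho (gamma : R -> C) (N : nat) : \bar R :=
  hitting_time [set t | cmod (gamma t) < expR (- N%:R)].

Definition radial_escape (n N : nat) : set (R -> C) :=
  [set gamma : R -> C | radial_curve gamma /\
     ~ (image_from gamma (radial_rho gamma N) `<=` cdisk (expR (- n%:R)))].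

End Radial.

Section Chordal.
Variable R : realType.
Local Notation C := (R[i]^o).
Local Notation H := (@upper_half_plane R).

(* The time-t mapping-out function H \ gamma[0,t] -> H. *)
Definition chordal_map (gamma : R -> C) (t : R) (g : C -> C) : Prop :=
  let A := H `\` gamma @` `[0, t] in
  conformal_map A H g /\ (g z - z @[z --> infty_within A] --> (0 : C)).

Definition chordal_curve (gamma : R -> C) : Prop :=
  [/\ {within `[0, +oo[, continuous gamma},
      set_inj `[0, +oo[ gamma,
      gamma 0 = 0,
      (forall t : R, 0 < t -> H (gamma t)) &
      cmod (gamma t) @[t --> +oo] --> +oo]
  /\ forall t : R, 0 <= t ->
       exists2 g, chordal_map gamma t g &
         z * (g z - z) @[z --> infty_within (H `\` gamma @` `[0, t])]
           --> (((2 * t)%:C)%C : C).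

Definition chordal_driving (gamma : R -> C) : set (R -> R) :=
  [set W : R -> R | [/\ {within `[0, +oo[, continuous W}, W 0 = 0 &
    exists2 g : R -> C -> C,
      (forall t : R, 0 <= t -> chordal_map gamma t (g t)) &
      forall (t : R) (z : C), 0 <= t -> (H `\` gamma @` `[0, t]) z ->
        is_time_derive (g ^~ z) t (2 / (g t z - ((W t)%:C)%C))]].

Definition chordal_energy (gamma : R -> C) : \bar R :=
  energy_of (chordal_driving gamma).

Definition chordal_tau (gamma : R -> C) (N : nat) : \bar R :=
  hitting_time [set t | N%:R < cmod (gamma t)].

Definition chordal_escape (n N : nat) : set (R -> C) :=
  [set gamma : R -> C | chordal_curve gamma /\
     image_from gamma (chordal_tau gamma N) `&` odisk n%:R !=set0].

End Chordal.

(* Main.v *)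
(* Let z = gamma(T). Under the Loewner flow the image g_t(z), t < T, must come      *)
(* arbitrarily close to the driving point before time T: otherwise it converges to *)
(* an interior point, which is also the image under g_T of a point off the curve,  *)
(* and two trajectories of a Lipschitz field would meet. In the frame of the       *)
(* driving function, with X + iY = g_t(z) - W_t in the half-plane, the functions   *)
(* |X + iY|^2 / Y^2, X^2 and |X + iY|^2 + 8 t decrease at a logarithmic rate of at *)
(* most a multiple of W'^2 (for X^2 as long as the first one stays away from 1),   *)
(* by completing a square. If E bounds the integral of W'^2, the first ratio thus  *)
(* stays below exp(E/8) up to time T, so that T <= exp(E/8) Im(z)^2 / 4, while     *)
(* |z|^2 <= 8 T exp(E/4). In the disk, with r = |g_t(z)| and D the squared distance *)
(* to the driving point, D / (1 - r)^2 and 1 - cos(angle) play the same roles,     *)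
(* giving T <= - exp(E/8) log |z| and |z| >= exp(-T)/4. Hence bounded energy bounds *)
(* the time of any visit to a region away from the target, and before a bounded    *)
(* time the curve cannot have come too close to the target.                        *)
(* The map g_0 is a conformal automorphism; that it is the identity (half-plane)   *)
(* or preserves the modulus (disk) follows from the maximum principle on           *)
(* rectangles, itself obtained from Goursat's theorem by Landau's power trick.     *)

(* Suppose the energy of an escaping curve is below [M], so that E = 2M bounds the integral of W'^2.
   The curve provides a time s at which it is back in the region away from the target, and a time t
   < s + 1 at which it has already come close to the target; the unit of slack is there because a
   hitting time need not be attained. For a point z = gamma(T) two estimates hold, with constants
   depending at most on E. First, T is bounded in terms of the position of z ([chordal_time_le],
   [radial_time_le]): this bounds s, hence t, by a function of n and E. Second, z cannot be too
   close to the target if T is bounded ([chordal_start_le], [radial_start_ge]): this contradicts the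
   depth reached at time t once N is large.

   Both estimates follow g_t(z) for t < T. Its starting value is known, since g_0 is the identity of
   the half-plane or preserves the modulus in the disk ([conformal_half_plane_id],
   [conformal_disk_modulus]), and it comes arbitrarily close to the driving singularity before time
   T ([chordal_swallow], [radial_swallow]). The core is [ratio_bound]: an orbit whose ratio once
   exceeds exp(E/8) approaches the singularity so tangentially that, with energy E, it cannot be
   absorbed in finite time. The differential inequalities behind it have defects that are squares,
   or squares plus nonnegative terms, divided by positive quantities.

   Since W is only absolutely continuous, these inequalities hold at almost every time. They are
   integrated by [AC_gronwall], which rests on the fundamental theorem of calculus for absolutely
   continuous functions ([AC_derivable_ae]). Every function to which it is applied is Lipschitz in
   time and W jointly ([adapted]); this class is stable under sums, products, inverses and
   logarithms and inherits absolute continuity from W.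

   The rigidity of g_0 and the continuity of inverse conformal maps come from [maximum_rect], the
   maximum principle on rectangles, which is deduced from [Goursat]. *)
Require Import Defs.
From HB Require Import structures.
From mathcomp Require Import all_boot all_order all_algebra.
From mathcomp Require Import all_classical all_reals all_analysis.
From mathcomp Require Import measurable_realfun.
From mathcomp Require Import complex.
From mathcomp Require Import ring lra.
Import Order.TTheory GRing.Theory Num.Theory.
Import numFieldNormedType.Exports.
Set Implicit Arguments.
Unset Strict Implicit.
Unset Printing Implicit Defensive.
Local Open Scope classical_set_scope.
Local Open Scope ring_scope.

(** * Absolutely continuous functions *)

Section AbsoluteContinuity.
Variable R : realType.
Implicit Types (a b c d e : R) (f g : R -> R) (p q : R * R) (s : seq (R * R)).
Local Notation mu := (@lebesgue_measure R).
Local Notation TV := (@total_variation R).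

Definition in_segment a b p := (a <= p.1) && (p.1 <= p.2) && (p.2 <= b).
(** For segments: the intersection, whose ends are this maximum and this minimum, has no interior.
    Degenerate segments are compatible with every segment. *)
Definition nonoverlap p q := Num.min p.2 q.2 <= Num.max p.1 q.1.
Definition total_length s := \sum_(p <- s) (p.2 - p.1).
Definition total_jump f s := \sum_(p <- s) `|f p.2 - f p.1|.

Lemma nonoverlap_sym : symmetric nonoverlap.
Proof. by move=> p q; rewrite /nonoverlap minC maxC. Qed.

Lemma nonoverlap_sub p q p' : p.1 <= p'.1 -> p'.2 <= p.2 ->
  nonoverlap p q -> nonoverlap p' q.
Proof.
move=> h1 h2; rewrite /nonoverlap !ge_min !le_max => /orP[] /orP[] h;
  apply/orP; [left|left|right|right]; apply/orP; [left|right|left|right]; lra.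
Qed.

Lemma nonoverlap_setI p q x : nonoverlap p q ->
  `]p.1, p.2[%classic x -> `]q.1, q.2[%classic x -> False.
Proof.
rewrite /nonoverlap /= !in_itv/= ge_min !le_max => /orP[] /orP[] h
  /andP[h1 h2] /andP[h3 h4]; lra.
Qed.

(** Lists, unlike families indexed by an ordinal, can be concatenated and refined by induction. *)
Lemma abs_continuous_onP a b f : abs_continuous_on a b f ->
  forall e, 0 < e -> exists2 d, 0 < d & forall s, all (in_segment a b) s ->
    pairwise nonoverlap s -> total_length s < d -> total_jump f s < e.
Proof.
move=> acf e e0; have [d d0 H] := acf e e0; exists d => // s sab ns lts.
pose z : R * R := (a, a).
have := H (size s) (fun i => (nth z s i).1) (fun i => (nth z s i).2).
rewrite /total_jump (big_nth z) big_mkord; apply.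
- move=> i; have := allP sab (nth z s i); rewrite mem_nth// => /(_ isT).
  by rewrite /in_segment => /andP[/andP[-> ->] ->].
- apply/trivIsetP => i j _ _ ij; apply/seteqP; split => // x [xi xj].
  wlog: i j ij xi xj / (i < j)%N.
    by move=> W; move: (ij); rewrite neq_ltn => /orP[] /W; apply => //; rewrite eq_sym.
  move=> {}ij; have nij : nonoverlap (nth z s i) (nth z s j).
    by move/(pairwiseP z) : ns; apply => //; rewrite inE.
  exact: (nonoverlap_setI nij xi xj).
- by move: lts; rewrite /total_length (big_nth z) big_mkord.
Qed.

Fixpoint gaps x (l : seq R) : seq (R * R) :=
  if l is y :: l' then (x, y) :: gaps y l' else [::].

Lemma total_length_gaps x l : total_length (gaps x l) = last x l - x.
Proof.
rewrite /total_length; elim: l x => [|y l ih] x /=; first by rewrite big_nil subrr.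
by rewrite big_cons ih/=; lra.
Qed.

Lemma variation_gaps a b f l : itv_partition a b l ->
  variation a b f l = total_jump f (gaps a l).
Proof.
move=> abl; rewrite variation_zip// /total_jump.
elim: l a b abl => [|y l ih] x b abl /=; first by rewrite !big_nil.
by rewrite !big_cons/= (ih _ _ (itv_partition_cons abl)).
Qed.

Lemma in_segment_gaps x l : path <%O x l -> all (in_segment x (last x l)) (gaps x l).
Proof.
elim: l x => // y l ih x /= /andP[xy yl].
have yle : y <= last y l.
  by have /itv_partition_le := (conj yl (eqxx _) : itv_partition y (last y l) l).
rewrite {1}/in_segment/= lexx (ltW xy) yle/=.
apply: sub_all (ih _ yl) => p /andP[/andP[h1 h2] h3]; rewrite /in_segment h2 h3 !andbT.
exact: le_trans (ltW xy) h1.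
Qed.

Lemma pairwise_gaps x l : path <%O x l -> pairwise nonoverlap (gaps x l).
Proof.
elim: l x => // y l ih x /= /andP[xy yl]; rewrite (ih _ yl) andbT.
apply: sub_all (in_segment_gaps yl) => p /andP[/andP[h1 h2] h3].
by rewrite /nonoverlap/= ge_min !le_max h1 orbT.
Qed.

Section fixed_AC.
Variables (a b : R) (f : R -> R).
Hypothesis acf : abs_continuous_on a b f.

(** The gaps of any partition of a short segment form an admissible list in the definition of
    absolute continuity. *)
Lemma short_total_variation e : 0 < e -> exists2 d, 0 < d &
  forall u v, a <= u -> u <= v -> v <= b -> v - u < d -> (TV u v f <= e%:E)%E.
Proof.
move=> e0; have [d d0 H] := abs_continuous_onP acf e0; exists d => // u v au uv vb uvd.
apply: ge_ereal_sup => _ /= [_ [l uvl <-] <-].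
rewrite variation_gaps// lee_fin; case: (uvl) => pl /eqP lv; apply/ltW/H.
- apply: sub_all (in_segment_gaps pl) => p; rewrite lv => /andP[/andP[h1 h2] h3].
  by rewrite /in_segment h2 (le_trans au h1) (le_trans h3 vb).
- exact: pairwise_gaps.
- by rewrite total_length_gaps lv.
Qed.

(** Cutting off pieces of length [d / 2] one at a time exhausts the segment in finitely many
    steps. *)
Lemma TV_fin u v : a <= u -> u <= v -> v <= b -> TV u v f \is a fin_num.
Proof.
have [d d0 H] := short_total_variation ltr01.
have [n] : exists n, v - u < n%:R * (d / 2).
  exists (Num.bound `|(v - u) / (d / 2)|); rewrite -ltr_pdivrMr; last by lra.
  by rewrite (le_lt_trans (ler_norm _))// archi_boundP.
elim: n u v => [|n ih] u v huv au uv vb; first by rewrite mul0r in huv; lra.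
have short x y : a <= x -> x <= y -> y <= b -> y - x < d -> TV x y f \is a fin_num.
  move=> ax xy yb xyd; rewrite ge0_fin_numE ?total_variation_ge0//.
  by rewrite (le_lt_trans (H _ _ _ _ _ _)) ?ltry.
have [uvd|uvd] := ltP (v - u) d; first exact: short.
have uw : u <= u + d / 2 by lra.
have wv : u + d / 2 <= v by lra.
rewrite (total_variationD f uw wv) fin_numD; apply/andP; split.
  by apply: short; lra.
by apply: ih => //; [rewrite -natr1 in huv|]; lra.
Qed.

(* Each interval of [s2] is replaced by an arbitrary partition of it, one interval at a time. *)
Lemma total_variation_small e : 0 < e -> exists2 d, 0 < d & forall s,
  all (in_segment a b) s -> pairwise nonoverlap s -> total_length s < d ->
  \sum_(p <- s) fine (TV p.1 p.2 f) <= e.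
Proof.
move=> e0; have [d d0 H] := abs_continuous_onP acf e0; exists d => // s2.
(* [s1] collects the pieces of the intervals already partitioned; taking the supremum over the
   partitions of the next interval turns its jumps into its variation. *)
suff G s1 : all (in_segment a b) (s1 ++ s2) -> pairwise nonoverlap (s1 ++ s2) ->
    total_length (s1 ++ s2) < d ->
    total_jump f s1 + \sum_(p <- s2) fine (TV p.1 p.2 f) <= e.
  by move=> h1 h2 h3; have := G [::] h1 h2 h3; rewrite /total_jump big_nil add0r.
elim: s2 s1 => [|p s2 ih] s1 h1 h2 h3.
  by rewrite big_nil addr0 ltW//; apply: H; rewrite cats0 in h1 h2 h3.
rewrite big_cons; have /and3P[as1 ap as2] : [&& all (in_segment a b) s1,
  in_segment a b p & all (in_segment a b) s2] by rewrite all_cat/= in h1.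
have /andP[/andP[pa pp] pb] := ap.
suff : (TV p.1 p.2 f <= (e - total_jump f s1 - \sum_(p <- s2) fine (TV p.1 p.2 f))%:E)%E.
  rewrite -{1}(fineK (TV_fin pa pp pb)) lee_fin; lra.
apply: ge_ereal_sup => _ /= [_ [l pl <-] <-]; rewrite variation_gaps// lee_fin.
case: (pl) => hl /eqP ll.
have := ih (s1 ++ gaps p.1 l).
have gsub : all (in_segment p.1 p.2) (gaps p.1 l) by have := in_segment_gaps hl; rewrite ll.
rewrite /total_jump !big_cat/= -catA => /(_ _ _ _)/le_trans W.
suff : \sum_(p0 <- s1) `|f p0.2 - f p0.1| + \sum_(p0 <- gaps p.1 l) `|f p0.2 - f p0.1|
   + \sum_(p0 <- s2) fine (TV p0.1 p0.2 f) <= e by lra.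
apply: W (lexx _).
- rewrite !all_cat as1 as2 andbT/=; apply: sub_all gsub => q /andP[/andP[q1 q2] q3].
  by rewrite /in_segment q2 (le_trans pa q1) (le_trans q3 pb).
- move: h2; rewrite !pairwise_cat/= (pairwise_gaps hl) => /and3P[].
  rewrite allrel_consr => /andP[n1 n2] -> /andP[n3 ->]; rewrite allrel_catr n2 !andbT/=.
  apply/andP; split.
    apply/allrelP => x y xs /(allP gsub)/andP[/andP[q1 q2] q3].
    rewrite nonoverlap_sym; apply: nonoverlap_sub q1 q3 _; rewrite nonoverlap_sym.
    exact: (allP n1).
  apply/allrelP => x y /(allP gsub)/andP[/andP[q1 q2] q3] ys.
  by apply: nonoverlap_sub q1 q3 _; exact: (allP n3).
- move: h3; rewrite /total_length !big_cat big_cons/=.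
  have := total_length_gaps p.1 l; rewrite /total_length ll => ->.
  by rewrite addrA.
Qed.

End fixed_AC.
End AbsoluteContinuity.

(** * Densities of monotone absolutely continuous functions *)

Section s.
Variable R : realType.
Implicit Types (a b c d e : R) (f g : R -> R) (p q : R * R) (s : seq (R * R)).
Local Notation mu := (@lebesgue_measure R).
Local Notation TV := (@total_variation R).

(** The retraction of the line onto [a, b]; composing with it extends a function by constants, so
    that a Stieltjes measure on the whole line becomes available. *)
Definition clip a b x : R := Num.max a (Num.min x b).

Lemma clip_le a b x y : x <= y -> clip a b x <= clip a b y.
Proof.
move=> xy; rewrite /clip ge_max !le_max lexx/= le_min !ge_min lexx xy/=.
by rewrite !orbT.
Qed.

Lemma clip_itv a b x : a <= b -> a <= clip a b x <= b.
Proof. by move=> ab; rewrite /clip le_max lexx/= ge_max ab ge_min lexx orbT. Qed.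

Lemma clip_id a b x : a <= x <= b -> clip a b x = x.
Proof. by move=> /andP[ax xb]; rewrite /clip (min_l xb) (max_r ax). Qed.

Lemma clipP a b x : a <= b ->
  [\/ clip a b x = a /\ x <= a, clip a b x = x /\ a <= x <= b | clip a b x = b /\ b <= x].
Proof.
move=> ab; rewrite /clip; have [ax|xa] := leP a x; last first.
  by apply: Or31; rewrite min_l ?max_l ?(ltW xa)// (le_trans (ltW xa)).
have [xb|bx] := leP x b; first by apply: Or32; rewrite max_r// ax.
by apply: Or33; rewrite max_r// ltW.
Qed.

Lemma clip_dist a b x y : a <= b -> x <= y -> clip a b y - clip a b x <= y - x.
Proof. by move=> ab xy; case: (clipP x ab) => -[-> ?]; case: (clipP y ab) => -[-> ?]; lra. Qed.

Lemma nonoverlapE p q :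
  nonoverlap p q = [|| p.2 <= p.1, p.2 <= q.1, q.2 <= p.1 | q.2 <= q.1].
Proof. by rewrite /nonoverlap ge_min !le_max -orbA. Qed.

Lemma nonoverlap_clip a b p q : nonoverlap p q ->
  nonoverlap (clip a b p.1, clip a b p.2) (clip a b q.1, clip a b q.2).
Proof.
rewrite !nonoverlapE => /or4P H; case: H => /(clip_le a b) /= H; rewrite H ?orbT//.
Qed.

Lemma nonoverlap_set0 p q : p.1 <= p.2 -> q.1 <= q.2 ->
  `]p.1, p.2[%classic `&` `]q.1, q.2[%classic = set0 -> nonoverlap p q.
Proof.
move=> p12 q12 pq0; rewrite /nonoverlap leNgt; apply/negP => lt.
have : set0 ((Num.max p.1 q.1 + Num.min p.2 q.2) / 2).
  rewrite -pq0 /= !in_itv/=; move: lt.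
  rewrite gt_max !lt_min => /andP[/andP[h1 h2] /andP[h3 h4]].
  by have [?|?] := leP p.1 q.1; have [?|?] := leP p.2 q.2; split; apply/andP; split; lra.
by [].
Qed.

(** An unbounded interval contains intervals of every length, against the finiteness of its
    measure. *)
Lemma open_interval_bounded (I : set R) : open I -> is_interval I -> (mu I < +oo)%E ->
  exists p, p.1 <= p.2 /\ I = `]p.1, p.2[%classic.
Proof.
move=> oI iI finI; have [->|/set0P[x Ix]] := eqVneq I set0.
  by exists (0, 0); rewrite /= set_itvoo0.
have big (J : R -> set R) : (forall e, measurable (J e) /\ (0 < e -> mu (J e) = e%:E)) ->
    (forall e, 0 < e -> J e `<=` I) -> False.
  move=> mJ JI; have mI : measurable I by exact: open_measurable.
  have fI : mu I \is a fin_num by rewrite ge0_fin_numE.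
  have [r r0 Ir] : exists2 r, 0 <= r & mu I = r%:E.
    by exists (fine (mu I)); rewrite ?fine_ge0// fineK.
  have r10 : 0 < r + 1 by lra.
  have : (mu (J (r + 1)%R) <= mu I)%E.
    by apply: le_measure; rewrite ?inE//; [exact: (mJ _).1|exact: JI].
  by rewrite (mJ _).2// Ir lee_fin; lra.
have hub : has_ubound I.
  apply: contrapT => nub; apply: (big (fun e => `]x, x + e[%classic)) => [e|e e0 y].
    split; first exact: measurable_itv.
    by move=> e0; rewrite lebesgue_measure_itv/= lte_fin ltrDl e0 -EFinD addrAC subrr add0r.
  rewrite /= in_itv/= => /andP[xy ye].
  have [z Iz yz] : exists2 z, I z & y < z.
    apply: contrapT => h; apply: nub; exists y => z Iz; rewrite leNgt; apply/negP => yz.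
    by apply: h; exists z.
  by apply: (iI x z) => //; rewrite (ltW xy) (ltW yz).
have hlb : has_lbound I.
  apply: contrapT => nlb; apply: (big (fun e => `]x - e, x[%classic)) => [e|e e0 y].
    split; first exact: measurable_itv.
    move=> e0; rewrite lebesgue_measure_itv/= lte_fin ltrBlDr ltrDl e0 -EFinB.
    by rewrite opprB addrC subrK.
  rewrite /= in_itv/= => /andP[xy ye].
  have [z Iz yz] : exists2 z, I z & z < y.
    apply: contrapT => h; apply: nlb; exists y => z Iz; rewrite leNgt; apply/negP => yz.
    by apply: h; exists z.
  by apply: (iI z x) => //; rewrite (ltW ye) (ltW yz).
exists (inf I, sup I); split => /=.
  by rewrite (@le_trans _ _ x)//; [exact: ge_inf|exact: ub_le_sup].
rewrite -[LHS](interior_id _).1// interval_bounded_interior//.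
Qed.

(** The Stieltjes measure of [F] extended by constants is finite and dominated by Lebesgue measure,
    so Radon-Nikodym provides the density. Right continuity, required to define that measure, is
    itself a case of absolute continuity. *)
Lemma monotone_AC_density a b (F : R -> R) : a <= b ->
  {in `[a, b] &, {homo F : x y / x <= y}} ->
  (forall e, 0 < e -> exists2 d, 0 < d & forall s, all (in_segment a b) s ->
    pairwise (@nonoverlap R) s -> total_length s < d -> total_jump F s <= e) ->
  exists f, mu.-integrable setT (EFin \o f) /\
    forall x y, a <= x -> x <= y -> y <= b ->
      ((F y - F x)%:E = \int[mu]_(t in `]x, y]) (f t)%:E)%E.
Proof.
move=> ab Fnd acF; pose G x := F (clip a b x).
have clab x : clip a b x \in `[a, b] by rewrite in_itv/= clip_itv.
have Gnd : {homo G : x y / x <= y}.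
  by move=> x y xy; apply: Fnd => //; exact: clip_le.
have Grc : right_continuous G.
  move=> x; apply/cvgrPdist_le => e e0; have [d d0 H] := acF e e0.
  near=> y; have xy : x < y by near: y; exact: nbhs_right_gt.
  have yx : y < x + d by near: y; apply: nbhs_right_lt; lra.
  have := H [:: (clip a b x, clip a b y)].
  rewrite /total_length /total_jump !big_seq1/= distrC; apply => //.
    have /andP[h1 _] := clip_itv x ab; have /andP[_ h2] := clip_itv y ab.
    by rewrite /in_segment/= h1 h2 clip_le// ltW.
  by rewrite (le_lt_trans (clip_dist ab (ltW xy)))//; lra.
pose Gc : cumulative R R := HB.pack G (@isCumulative.Build R _ R G Gnd Grc).
pose nu := lebesgue_stieltjes_measure Gc.
have nuoc x y : x <= y -> nu `]x, y]%classic = (G y - G x)%:E.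
  move=> xy; rewrite -[RHS](@wlength_itv_bnd R Gc x y false false xy).
  exact: (measurable_mu_extE (wlength Gc) (is_ocitv x y)).
have nufin : nu setT \is a fin_num.
  rewrite ge0_fin_numE//; apply: (@le_lt_trans _ _ (F b - F a)%:E); last exact: ltry.
  have UT : \bigcup_n `](- n%:R : R), n%:R]%classic = setT.
    apply/seteqP; split => // x _; exists (Num.bound `|x|) => //=.
    have : `|x| < (Num.bound `|x|)%:R by rewrite archi_boundP.
    by rewrite ltr_norml in_itv/= => /andP[-> /ltW ->].
  have cv : (nu \o (fun n => `](- n%:R : R), n%:R]%classic)) n @[n --> \oo] -->
      nu (\bigcup_n `](- n%:R : R), n%:R]%classic).
    apply: nondecreasing_cvg_mu.
    - by move=> n; exact: measurable_itv.
    - by apply: bigcup_measurable => n _; exact: measurable_itv.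
    - move=> m n mn; apply/subsetPset => x /=; rewrite !in_itv/= => /andP[h1 h2].
      have mn' : m%:R <= n%:R :> R by rewrite ler_nat.
      by apply/andP; split; lra.
  rewrite UT in cv; rewrite -(cvg_lim _ cv)//; apply: lime_le.
    by apply/cvg_ex; eexists; exact: cv.
  apply: nearW => n /=; rewrite nuoc; last by have := ler0n R n; lra.
  rewrite lee_fin lerB//; apply: Fnd => //; rewrite ?in_itv/= ?lexx ?ab//.
    by have /andP[] := clip_itv n%:R ab.
  by have /andP[] := clip_itv (- n%:R) ab.
have fnu : fin_num_fun nu.
  move=> A mA; rewrite ge0_fin_numE//.
  rewrite (le_lt_trans (_ : _ <= nu setT)%E) ?ltey_eq ?nufin//.
  by apply: le_measure => //; rewrite inE.
pose nuf : {finite_measure set (measurableTypeR R) -> \bar R} :=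
  HB.pack nu (@Measure_isFinite.Build _ _ _ nu fnu).
(* A null set lies in an open set of measure below [d], a countable union of disjoint intervals.
   Finitely many of these, clipped to [a, b], have total length below [d], so they carry mass at
   most [e]. *)
have dom : nuf `<< mu.
  apply/null_content_dominatesP => A mA A0; apply/eqP; rewrite -measure_le0.
  apply/lee_addgt0Pr => e e0; rewrite add0e.
  have [d d0 H] := acF e e0.
  have [|U [oU AU mUA]] := lebesgue_regularity_outer mA _ d0.
    by rewrite [X in (X < _)%E]A0.
  have mU : measurable U by exact: open_measurable.
  have muU : (mu U < d%:E)%E.
    rewrite -(setDUK AU) measureU//; last 2 first.
      exact: measurableD.
      by rewrite setDIK.
    by rewrite [X in (X + _)%E]A0 add0e.
  pose I := open_disjoint_itv oU.
  have mI k : measurable (I k) by apply: open_measurable; exact: open_disjoint_itv_open.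
  have IU k : I k `<=` U by rewrite [U](open_disjoint_itv_bigcup oU); exact: bigcup_sup.
  have /choice[p Hp] : forall k, exists p, p.1 <= p.2 /\ I k = `]p.1, p.2[%classic.
    move=> k; apply: open_interval_bounded.
    - exact: open_disjoint_itv_open.
    - exact: open_disjoint_itv_is_interval.
    - rewrite (le_lt_trans _ (lt_trans muU (ltry _)))//.
      by apply: le_measure; rewrite ?inE//; exact: mI.
  pose s n := [seq (clip a b (p k).1, clip a b (p k).2) | k <- iota 0 n].
  have lens n : total_length (s n) < d.
    rewrite -lte_fin; apply: le_lt_trans muU.
    have -> : (total_length (s n))%:E =
        (\sum_(k <- iota 0 n) (clip a b (p k).2 - clip a b (p k).1)%:E)%E.
      by rewrite sumEFin /total_length /s big_map.
    apply: (@le_trans _ _ (\sum_(k <- iota 0 n) mu (I k))%E).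
      apply: lee_sum => k _; have [p12 ->] := Hp k.
      rewrite lebesgue_measure_itv/= lte_fin; case: ifPn => [_|].
        by rewrite -EFinB lee_fin clip_dist.
      by rewrite -leNgt => p21; rewrite lee_fin subr_le0 clip_le.
    have -> : (\sum_(k <- iota 0 n) mu (I k) = mu (\big[setU/set0]_(k < n) I k))%E.
      transitivity (\sum_(k < n) mu (I k))%E.
        by rewrite -(big_mkord xpredT (fun k => mu (I k))) /index_iota subn0.
      apply/esym; apply: measure_semi_additive => //.
        exact: open_disjoint_itv_trivIset.
      by apply: bigsetU_measurable => k _; exact: mI.
    apply: le_measure; rewrite ?inE//; first by apply: bigsetU_measurable => k _; exact: mI.
    by rewrite -bigcup_mkord => x [k _ /IU].
  apply: (le_trans (_ : _ <= nu U)%E); first by apply: le_measure; rewrite ?inE.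
  rewrite [U](open_disjoint_itv_bigcup oU).
  apply: (le_trans (_ : _ <= \sum_(0 <= k <oo) nu (I k))%E).
    apply: measure_sigma_subadditive => //.
    by apply: bigcup_measurable => k _; exact: mI.
  apply: lime_le; first exact: is_cvg_nneseries.
  apply: nearW => n.
  apply: (@le_trans _ _ (total_jump F (s n))%:E).
    rewrite /total_jump /s big_map -sumEFin /index_iota subn0.
    apply: lee_sum => k _ /=; have [p12 Ik] := Hp k.
    apply: (@le_trans _ _ (G (p k).2 - G (p k).1)%:E); last by rewrite lee_fin ler_norm.
    rewrite -nuoc//; apply: le_measure; rewrite ?inE//.
      exact: mI.
    by rewrite Ik => x /=; rewrite !in_itv/= => /andP[-> /ltW ->].
  rewrite lee_fin; apply: H => //.
    apply/allP => _ /mapP[k _ ->]; have [p12 _] := Hp k.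
    have /andP[h1 _] := clip_itv (p k).1 ab; have /andP[_ h2] := clip_itv (p k).2 ab.
    by rewrite /in_segment/= h1 h2 clip_le.
  rewrite /s pairwise_map; apply/(pairwiseP 0%N) => i j; rewrite !inE size_iota => ii jj ij /=.
  rewrite !nth_iota// !add0n; apply: nonoverlap_clip.
  have [pi Ii] := Hp i; have [pj Ij] := Hp j.
  apply: nonoverlap_set0 => //; rewrite -Ii -Ij.
  have /trivIsetP := @open_disjoint_itv_trivIset R U oU; apply => //.
  by rewrite ltn_eqF.
have [f [f0 ffin intf fE]] := radon_nikodym_sigma_finite dom.
exists (fine \o f); split.
  apply: eq_integrable intf => // x _ /=; by rewrite fineK.
move=> x y ax xy yb.
transitivity (nuf `]x, y]%classic).
  by rewrite /= [RHS]nuoc// /G !clip_id// ?ax ?yb ?(le_trans ax xy) ?(le_trans xy yb).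
rewrite fE; last exact: measurable_itv.
by apply: eq_integral => t _; rewrite fineK.
Unshelve. all: by end_near. Qed.
End s.

(** * The fundamental theorem of calculus for absolutely continuous functions *)

Section LebesgueFTC.
Variable R : realType.
Implicit Types (a b c d e x y : R) (f g h : R -> R).
Local Notation mu := (@lebesgue_measure R).
Local Notation TV := (@total_variation R).

(** Jordan decomposition: with [G] the variation function, [G] and [G - f] are nondecreasing and
    absolutely continuous, and [f] is their difference. *)
Lemma AC_density a b f : a <= b -> abs_continuous_on a b f ->
  exists h, mu.-integrable setT (EFin \o h) /\
    forall x y, a <= x -> x <= y -> y <= b ->
      f y - f x = \int[mu]_(t in `]x, y]) h t.
Proof.
move=> ab acf; pose G x := fine (TV a x f).
have GB x y : a <= x -> x <= y -> y <= b -> G y - G x = fine (TV x y f).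
  move=> ax xy yb; rewrite /G (total_variationD f ax xy) fineD ?(TV_fin acf)//.
    by rewrite addrC addKr.
  exact: le_trans yb.
have jumpTV x y : a <= x -> x <= y -> y <= b -> `|f y - f x| <= fine (TV x y f).
  move=> ax xy yb; rewrite -lee_fin fineK ?(TV_fin acf)//.
  exact: total_variation_ge.
have GH : {in `[a, b] &, {homo G : x y / x <= y}} /\
    {in `[a, b] &, {homo (fun x => G x - f x) : x y / x <= y}}.
  split=> x y; rewrite !in_itv/= => /andP[ax xb] /andP[ay yb] xy;
    have := GB _ _ ax xy yb; have := jumpTV _ _ ax xy yb;
    rewrite ler_norml => /andP[h1 h2] h3; have := normr_ge0 (f y - f x);
    have := jumpTV _ _ ax xy yb; lra.
have intdens (F : R -> R) : (exists h, mu.-integrable setT (EFin \o h) /\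
    forall x y, a <= x -> x <= y -> y <= b ->
      ((F y - F x)%:E = \int[mu]_(t in `]x, y]) (h t)%:E)%E) ->
    exists h, mu.-integrable setT (EFin \o h) /\
    forall x y, a <= x -> x <= y -> y <= b -> F y - F x = \int[mu]_(t in `]x, y]) h t.
  by move=> [h [ih hh]]; exists h; split => // x y ax xy yb; rewrite /Rintegral -hh.
have [hG [iG HG]] : exists h, mu.-integrable setT (EFin \o h) /\
    forall x y, a <= x -> x <= y -> y <= b -> G y - G x = \int[mu]_(t in `]x, y]) h t.
  apply: intdens; apply: monotone_AC_density => //; first exact: GH.1.
  move=> e e0; have [d d0 H] := total_variation_small acf e0; exists d => // s hs ns ls.
  apply: le_trans (H s hs ns ls); rewrite /total_jump big_seq [leRHS]big_seq.
  apply: ler_sum => p ps; have /andP[/andP[h1 h2] h3] := allP hs _ ps.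
  by rewrite GB// ger0_norm// (le_trans _ (jumpTV _ _ h1 h2 h3)).
have [hH [iH HH]] : exists h, mu.-integrable setT (EFin \o h) /\
    forall x y, a <= x -> x <= y -> y <= b ->
    (G y - f y) - (G x - f x) = \int[mu]_(t in `]x, y]) h t.
  apply: (intdens (fun x => G x - f x)).
  apply: (@monotone_AC_density R a b (fun x => G x - f x)) => //; first exact: GH.2.
  move=> e e0; have e20 : 0 < e / 2 by lra.
  have [d d0 H] := total_variation_small acf e20; exists d => // s hs ns ls.
  have {}H := H s hs ns ls.
  (* A jump of [G - f] is at most the variation plus a jump of [f], hence at most twice the
     variation; this is why [e / 2] was taken. *)
  apply: (@le_trans _ _ (2 * \sum_(p <- s) fine (TV p.1 p.2 f))); last by lra.
  rewrite /total_jump mulr_sumr big_seq [leRHS]big_seq.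
  apply: ler_sum => p ps; have /andP[/andP[h1 h2] h3] := allP hs _ ps.
  have := jumpTV _ _ h1 h2 h3; have := GB _ _ h1 h2 h3; set v := fine _.
  rewrite !ler_norml => h4 /andP[h5 h6]; apply/andP; split; lra.
exists (fun x => hG x - hH x); split.
  by apply: (@integrableB _ _ _ mu setT measurableT (EFin \o hG) (EFin \o hH)).
move=> x y ax xy yb; rewrite RintegralB//.
- by rewrite -HG// -HH//; lra.
- exact: integrableS iG.
- exact: integrableS iH.
Qed.

(** Lebesgue differentiation identifies the density with the derivative almost everywhere. *)
Lemma AC_derivable_ae a b f : a <= b -> abs_continuous_on a b f ->
  exists h, [/\ mu.-integrable setT (EFin \o h),
    forall x y, a <= x -> x <= y -> y <= b -> f y - f x = \int[mu]_(t in `]x, y]) h t &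
    {ae mu, forall x, a < x < b -> is_derive x 1 f (h x)}].
Proof.
move=> ab acf; have [h [ih hE]] := AC_density ab acf; exists h; split => //.
have loc : locally_integrable setT h by apply: open_integrable_locally => //; exact: openT.
have iy y : mu.-integrable [set` Interval (BRight a) (BRight y)] (EFin \o h).
  exact: integrableS ih.
have := FTC1 iy loc.
apply: filterS; first exact: (ae_filter_ringOfSetsType mu).
move=> x /= H /andP[ax xb]; have [] := H; first by rewrite lte_fin.
set F := fun x => _; move=> dF F'.
have nF : \forall y \near x, f a + F y = f y.
  near=> y; have ay : a <= y by apply: ltW; near: y; exact: lt_nbhsr.
  have yb : y <= b by apply: ltW; near: y; exact: lt_nbhsl.
  by have := hE a y (lexx a) ay yb; rewrite -/(F y); lra.
have dF' : is_derive x 1 F (h x) := DeriveDef dF (etrans (esym (derive1E F x)) F').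
clearbody F; have dG : is_derive x 1 (fun y => f a + F y) (h x).
  by have := is_deriveD (is_derive_cst (f a) x 1) dF'; rewrite add0r.
exact: (near_eq_is_derive nF dG).
Unshelve. all: by end_near. Qed.

(** The integral of a nonnegative function is a supremum over simple functions below it, so
    comparison holds without measurability. It serves for [derive1 W], whose measurability is never
    established. *)
Lemma ge0_le_integralT (f1 f2 : R -> \bar R) : (forall x, 0 <= f1 x)%E ->
  (forall x, f1 x <= f2 x)%E -> (\int[mu]_x f1 x <= \int[mu]_x f2 x)%E.
Proof.
move=> f10 f12; have f20 x : (0 <= f2 x)%E by exact: le_trans (f12 x).
rewrite !ge0_integralTE//; apply: ereal_sup_le => _ [g gf <-]; exists g => // x.
exact: le_trans (f12 x).
Qed.

End LebesgueFTC.

(** * Gronwall's inequality with the energy density as rate *)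

Section Gronwall.
Variable R : realType.
Implicit Types (a b c d e x y s t K E : R) (f g h W : R -> R).
Local Notation mu := (@lebesgue_measure R).

(* [g] is a Lipschitz function of time and of [W]. *)
Definition adapted W a b g := exists2 K : R, 0 <= K & forall u v,
  a <= u <= b -> a <= v <= b -> `|g v - g u| <= K * (`|v - u| + `|W v - W u|).

Lemma adapted_AC W a b g : abs_continuous_on a b W -> adapted W a b g ->
  abs_continuous_on a b g.
Proof.
move=> acW [K K0 HK] e e0; have K1 : 0 < 2 * (K + 1) by lra.
have e1 : 0 < e / (2 * (K + 1)) by rewrite divr_gt0.
have [d d0 Hd] := acW _ e1.
exists (Num.min d (e / (2 * (K + 1)))); first by rewrite lt_min d0.
move=> k u v uv tr; rewrite lt_min => /andP[sd se].
have := Hd k u v uv tr sd; move: se.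
rewrite !ltr_pdivlMr// => se sW.
apply: (@le_lt_trans _ _ (K * (\sum_(i < k) (v i - u i) + \sum_(i < k) `|W (v i) - W (u i)|))).
  rewrite -big_split/= mulr_sumr; apply: ler_sum => i _.
  have [h1 [h2 h3]] := uv i; rewrite -(@ger0_norm _ (v i - u i)) ?subr_ge0//.
  by apply: HK; rewrite ?h1 ?h3 ?(le_trans h2 h3) ?(le_trans h1 h2).
have u0 : 0 <= \sum_(i < k) (v i - u i).
  by apply: sumr_ge0 => i _; rewrite subr_ge0; case: (uv i) => _ [].
have w0 : 0 <= \sum_(i < k) `|W (v i) - W (u i)| by apply: sumr_ge0.
lra.
Qed.

Lemma adapted_cont W a b g : {within `[a, b], continuous W} -> adapted W a b g ->
  {within `[a, b], continuous g}.
Proof.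
move=> cW [K K0 HK]; apply/subspace_continuousP => x xab.
move/subspace_continuousP : cW => /(_ x xab) cW.
apply/cvgrPdist_lt => e e0; have K1 : 0 < 2 * (K + 1) by lra.
have e1 : 0 < e / (2 * (K + 1)) by rewrite divr_gt0.
near=> y.
have yab : `[a, b]%classic y by near: y; exact: withinT.
have h1 : `|W x - W y| < e / (2 * (K + 1)).
  by near: y; move/cvgrPdist_lt : cW; exact.
have h2 : `|x - y| < e / (2 * (K + 1)).
  near: y; apply: (@cvgr_dist_lt _ _ _ (within `[a, b] (nbhs x))) => //.
  exact: cvg_within.
rewrite /= !in_itv/= in xab yab.
apply: le_lt_trans (HK _ _ yab xab) _; move: h1 h2; rewrite !ltr_pdivlMr// => h1 h2.
have := normr_ge0 (W x - W y); have := normr_ge0 (x - y).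
lra.
Unshelve. all: by end_near. Qed.

Lemma within_cont_bounded a b g : {within `[a, b], continuous g} ->
  exists2 B, 0 <= B & forall x, a <= x <= b -> `|g x| <= B.
Proof.
move=> cg; have [ab|ba] := leP a b; last by exists 0 => // x; lra.
have cn : {within `[a, b], continuous (fun x => `|g x|)}.
  by move=> x; apply: continuous_comp (cg x) _; exact: norm_continuous.
have [c cab Hc] := EVT_max ab cn; exists `|g c|; first exact: normr_ge0.
by move=> x xab; apply: Hc; rewrite in_itv.
Qed.

Section closure.
Variables (W : R -> R) (a b : R).
Hypothesis cW : {within `[a, b], continuous W}.
Local Notation adapted := (adapted W a b).

Lemma adapted_bounded g : adapted g -> exists2 B, 0 <= B & forall x, a <= x <= b -> `|g x| <= B.
Proof. by move=> /(adapted_cont cW); exact: within_cont_bounded. Qed.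

Lemma adapted_driving : adapted W.
Proof. by exists 1 => // u v _ _; rewrite mul1r lerDr. Qed.

Lemma adapted_lipschitz K g : 0 <= K ->
  (forall u v, a <= u <= b -> a <= v <= b -> `|g v - g u| <= K * `|v - u|) -> adapted g.
Proof.
move=> K0 H; exists K => // u v uab vab; apply: le_trans (H u v uab vab) _.
by rewrite ler_wpM2l// lerDl.
Qed.

Lemma adapted_cst k : adapted (fun=> k).
Proof. by exists 0 => // u v _ _; rewrite subrr normr0 mul0r. Qed.

Lemma adapted_id : adapted id.
Proof. by apply: (@adapted_lipschitz 1) => // u v _ _; rewrite mul1r. Qed.

Lemma adaptedD f g : adapted f -> adapted g -> adapted (fun x => f x + g x).
Proof.
move=> [K K0 HK] [L L0 HL]; exists (K + L); first exact: addr_ge0.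
move=> u v uab vab; have := HK u v uab vab; have := HL u v uab vab.
have := ler_normD (f v - f u) (g v - g u).
have -> : f v + g v - (f u + g u) = f v - f u + (g v - g u) by lra.
lra.
Qed.

Lemma adapted_comp K f g : 0 <= K -> adapted f ->
  (forall u v, a <= u <= b -> a <= v <= b -> `|g v - g u| <= K * `|f v - f u|) -> adapted g.
Proof.
move=> K0 [L L0 HL] H; exists (K * L); first exact: mulr_ge0.
move=> u v uab vab; apply: le_trans (H u v uab vab) _.
by rewrite -mulrA ler_wpM2l// HL.
Qed.

Lemma adaptedN f : adapted f -> adapted (fun x => - f x).
Proof.
by move=> af; apply: (@adapted_comp 1 f) => // u v _ _; rewrite mul1r -opprD normrN.
Qed.

Lemma adaptedB f g : adapted f -> adapted g -> adapted (fun x => f x - g x).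
Proof. by move=> af ag; apply: adaptedD => //; exact: adaptedN. Qed.

Lemma adaptedM f g : adapted f -> adapted g -> adapted (fun x => f x * g x).
Proof.
move=> af ag; have [B B0 HB] := adapted_bounded af; have [D D0 HD] := adapted_bounded ag.
case: af ag => [K K0 HK] [L L0 HL]; exists (D * K + B * L); first by rewrite addr_ge0// mulr_ge0.
move=> u v uab vab; have h1 := HK u v uab vab; have h2 := HL u v uab vab.
have -> : f v * g v - f u * g u = (f v - f u) * g v + f u * (g v - g u) by ring.
apply: le_trans (ler_normD _ _) _; rewrite !normrM mulrDl; apply: lerD.
  by rewrite [leLHS]mulrC -[leRHS]mulrA; apply: ler_pM => //; exact: HD.
by rewrite -[leRHS]mulrA; apply: ler_pM => //; exact: HB.
Qed.

Lemma adaptedV m f : 0 < m -> (forall x, a <= x <= b -> m <= f x) -> adapted f ->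
  adapted (fun x => (f x)^-1).
Proof.
move=> m0 fm af; apply: (@adapted_comp (m^-1 ^+ 2) f) => //; first exact: sqr_ge0.
move=> u v uab vab; have fu := fm _ uab; have fv := fm _ vab.
have fu0 : 0 < f u by exact: lt_le_trans fu. have fv0 : 0 < f v by exact: lt_le_trans fv.
have -> : (f v)^-1 - (f u)^-1 = - ((f v)^-1 * (f u)^-1 * (f v - f u)) by field; rewrite !lt0r_neq0.
rewrite normrN normrM; apply: ler_wpM2r => //.
have p0 : 0 <= (f v)^-1 * (f u)^-1 by rewrite mulr_ge0// invr_ge0 ltW.
rewrite (ger0_norm p0) expr2.
by apply: ler_pM; rewrite ?invr_ge0 ?(ltW fu0) ?(ltW fv0)// lef_pV2.
Qed.

Lemma adapted_ln m f : 0 < m -> (forall x, a <= x <= b -> m <= f x) -> adapted f ->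
  adapted (fun x => ln (f x)).
Proof.
move=> m0 fm af; have mi : 0 <= m^-1 by rewrite invr_ge0 ltW.
apply: (@adapted_comp m^-1 f) => // u v uab vab.
have ln1 x y : m <= x -> x <= y -> `|ln y - ln x| <= m^-1 * (y - x).
  move=> mx xy; have x0 : 0 < x by exact: lt_le_trans mx.
  have y0 : 0 < y by exact: lt_le_trans xy.
  rewrite -ln_div ?posrE// ger0_norm; last by rewrite ln_ge0// ler_pdivlMr// mul1r.
  have -> : y / x = 1 + (y - x) / x by field; rewrite lt0r_neq0.
  apply: le_trans (le_ln1Dx _) _; first by rewrite (@lt_le_trans _ _ 0)// divr_ge0 ?subr_ge0// ltW.
  by rewrite mulrC ler_wpM2r ?subr_ge0// lef_pV2.
have [h|/ltW h] := leP (f u) (f v).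
  by apply: le_trans (ln1 _ _ (fm _ uab) h) _; rewrite ler_wpM2l// ler_norm.
rewrite distrC; apply: le_trans (ln1 _ _ (fm _ vab) h) _; rewrite ler_wpM2l//.
by rewrite distrC ler_norm.
Qed.

End closure.

Definition energy_le W E := (\int[mu]_(t in `[0%R, +oo[) ((derive1 W t) ^+ 2)%:E <= E%:E)%E.

(** The logarithm of [f] is absolutely continuous, and at almost every time its derivative is at
    least - c W'^2; integrating loses at most [c * E]. *)
Lemma AC_gronwall W f c s t E : 0 <= c -> 0 <= E -> 0 <= s -> s <= t ->
  abs_continuous_on s t W -> {within `[s, t], continuous W} -> energy_le W E ->
  adapted W s t f -> (forall x, s <= x <= t -> 0 < f x) ->
  (forall x, s < x < t -> derivable W x 1 ->
     exists2 df : R, is_derive x 1 f df & - (c * (derive1 W x) ^+ 2 * f x) <= df) ->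
  f s * expR (- (c * E)) <= f t.
Proof.
move=> c0 E0 s0 st acW cW enE af f0 Hf.
have [m m0 fm] : exists2 m, 0 < m & forall x, s <= x <= t -> m <= f x.
  have [z zst Hz] := EVT_min st (adapted_cont cW af).
  by exists (f z) => [|x xst]; [apply: f0; rewrite in_itv in zst|apply: Hz; rewrite in_itv].
have acL := adapted_AC acW (adapted_ln m0 fm af).
have [h [ih hE hae]] := AC_derivable_ae st acL.
(* [w] is an integrable, hence measurable, function equal to [derive1 W] off the exceptional set
   removed from [D] below. *)
have [w [iw wE wae]] := AC_derivable_ae st acW.
have [N [mN N0 HN]] : mu.-negligible (~` [set x |
    s < x < t -> is_derive x 1 (fun x => ln (f x)) (h x) /\ is_derive x 1 W (w x)]).
  have : {ae mu, forall x, s < x < t -> is_derive x 1 (fun x => ln (f x)) (h x) /\ is_derive x 1 W (w x)}.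
    have aeF := ae_filter_ringOfSetsType mu.
    apply: (filterS2 _ _ hae wae) => x h1 h2 xst; split; [exact: h1|exact: h2].
  by [].
pose D := `]s, t[%classic `\` N.
have mD : measurable D by apply: measurableD.
have key x : D x -> - (c * w x ^+ 2) <= h x /\ derive1 W x = w x.
  move=> [xst nNx]; rewrite /= in_itv/= in xst.
  have [h1 h2] : is_derive x 1 (fun x => ln (f x)) (h x) /\ is_derive x 1 W (w x).
    by apply: contrapT => K; apply: nNx; apply: HN => /= K'; apply: K; exact: K'.
  have W' : derive1 W x = w x by rewrite derive1E derive_val.
  have [df dfx ineq] := Hf x xst (@ex_derive _ _ _ _ _ _ _ h2).
  have fx0 : 0 < f x by apply: f0; lra.
  have dln : is_derive x 1 (fun x => ln (f x)) (df * (f x)^-1).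
    have := @is_derive1_comp _ (@ln R) f x _ _ (is_derive1_ln fx0) dfx.
    by rewrite mulrC.
  have <- : df * (f x)^-1 = h x.
    have := @derive_val _ _ _ _ _ _ _ dln.
    by rewrite (@derive_val _ _ _ _ _ _ _ h1) => ->.
  split=> //; rewrite ler_pdivlMr//; rewrite W' in ineq; lra.
have w2 : (\int[mu]_(x in D) (w x ^+ 2)%:E <= E%:E)%E.
  apply: le_trans enE; rewrite integral_mkcond [leRHS]integral_mkcond.
  apply: ge0_le_integralT => x.
    by apply: erestrict_ge0 => y _; rewrite lee_fin sqr_ge0.
  rewrite !patchE; case: ifPn => [|_]; last first.
    by case: ifPn => // _; rewrite lee_fin sqr_ge0.
  rewrite inE => Dx; have [_ <-] := key x Dx; rewrite mem_set//=.
  by move: Dx => [] /=; rewrite !in_itv/= andbT => /andP[sx _] _; rewrite ltW// (le_lt_trans s0).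
have mw : measurable_fun D (fun x => w x ^+ 2).
  apply: measurable_funX; apply/measurable_EFinP.
  by apply: measurable_funS (measurable_int _ iw).
have iw2 : mu.-integrable D (EFin \o (fun x => w x ^+ 2)).
  apply/integrableP; split; first exact/measurable_EFinP.
  under eq_integral => x _ do rewrite /= ger0_norm ?sqr_ge0//.
  by apply: le_lt_trans w2 _; exact: ltry.
have Iw2 : \int[mu]_(x in D) (w x ^+ 2) <= E.
  by rewrite /Rintegral -lee_fin fineK//; exact: integrable_fin_num.
have Ih : ln (f t) - ln (f s) = \int[mu]_(x in D) h x.
  rewrite (hE s t)// /Rintegral; congr fine.
  rewrite -integral_itv_bndo_bndc; last first.
    by apply: measurable_funS (measurable_int _ ih).
  by rewrite [LHS](negligible_integral mN)//; exact: integrableS ih.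
have ihD : mu.-integrable D (EFin \o h) by exact: integrableS ih.
have : - c * \int[mu]_(x in D) (w x ^+ 2) <= \int[mu]_(x in D) h x.
  rewrite -RintegralZl//; apply: le_Rintegral => //.
    exact: (@integrableZl _ _ _ mu D mD (- c) _ iw2).
  by move=> x Dx; have [] := key x Dx; lra.
rewrite -Ih => ineq.
have fs0 : 0 < f s by apply: f0; rewrite lexx st.
have ft0 : 0 < f t by apply: f0; rewrite lexx st.
rewrite -[X in X * _](lnK fs0) -[leRHS](lnK ft0) -expRD ler_expR.
rewrite -[leRHS](subrK (ln (f s))) [leRHS]addrC lerD2l; apply: le_trans ineq.
by rewrite mulNr lerN2 ler_wpM2l.
Qed.

End Gronwall.

(** * Complex analysis on rectangles *)

Section ComplexModulus.
Variable R : realType.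
Local Notation C := (R[i]^o).
Local Notation Re := (@complex.Re R).
Local Notation Im := (@complex.Im R).
Implicit Types (z w : C) (r : R) (f g : C -> C).

Lemma cmod_ge0 z : 0 <= cmod z. Proof. exact: sqrtr_ge0. Qed.

Lemma cmodM z w : cmod (z * w) = cmod z * cmod w.
Proof. by apply: (@complexI R); rewrite rmorphM/= -!cmodE normrM. Qed.

Lemma cmodV z : cmod (z^-1) = (cmod z)^-1.
Proof. by apply: (@complexI R); rewrite fmorphV/= -!cmodE normfV. Qed.

Lemma cmodX z n : cmod (z ^+ n) = cmod z ^+ n.
Proof. by apply: (@complexI R); rewrite rmorphXn/= -!cmodE normrX. Qed.

Lemma cmodN z : cmod (- z) = cmod z.
Proof. by apply: (@complexI R); rewrite -!cmodE normrN. Qed.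

Lemma cmodB z w : cmod (z - w) = cmod (w - z).
Proof. by rewrite -cmodN opprB. Qed.

Lemma cmod0 : cmod (0 : C) = 0.
Proof. by apply: (@complexI R); rewrite -!cmodE normr0. Qed.

Lemma cmod1 : cmod (1 : C) = 1.
Proof. by apply: (@complexI R); rewrite -!cmodE normr1. Qed.

Lemma cmod_eq0 z : (cmod z == 0) = (z == 0).
Proof. by rewrite -(inj_eq (@complexI R)) -cmodE normr_eq0. Qed.

Lemma cmod_gt0 z : (0 < cmod z) = (z != 0).
Proof. by rewrite lt0r cmod_eq0 cmod_ge0 andbT. Qed.

Lemma cmodD z w : cmod (z + w) <= cmod z + cmod w.
Proof. by rewrite -lecR rmorphD/= -!cmodE ler_normD. Qed.

Lemma cmodBD z w : cmod (z - w) <= cmod z + cmod w.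
Proof. by rewrite -(cmodN w) cmodD. Qed.

Lemma cmod_rev z w : cmod z - cmod w <= cmod (z - w).
Proof. by rewrite lerBlDr -{1}(subrK w z) cmodD. Qed.

Lemma cmod_real r : cmod (r%:C)%C = `|r|.
Proof. by rewrite /cmod/= expr0n/= addr0 sqrtr_sqr. Qed.

Lemma cmod_i : cmod ('i%C : C) = 1.
Proof. by rewrite /cmod/= expr0n expr1n add0r sqrtr1. Qed.

Lemma cmod_sqr z : cmod z ^+ 2 = Re z ^+ 2 + Im z ^+ 2.
Proof. by rewrite sqr_sqrtr// addr_ge0// sqr_ge0. Qed.

Lemma normRe_le z : `|Re z| <= cmod z.
Proof. by rewrite -sqrtr_sqr ler_wsqrtr// lerDl sqr_ge0. Qed.

Lemma normIm_le z : `|Im z| <= cmod z.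
Proof. by rewrite -sqrtr_sqr ler_wsqrtr// lerDr sqr_ge0. Qed.

Lemma Im_le_cmod z : Im z <= cmod z.
Proof. exact: le_trans (ler_norm _) (normIm_le z). Qed.

Lemma cmod_le z : cmod z <= `|Re z| + `|Im z|.
Proof.
rewrite -ler_sqr ?nnegrE ?cmod_ge0 ?addr_ge0// cmod_sqr.
rewrite -(real_normK (num_real (Re z))) -(real_normK (num_real (Im z))) sqrrD.
by rewrite addrAC lerDl mulrn_wge0// mulr_ge0.
Qed.

Lemma nbhs_cmodP z (P : set C) :
  nbhs z P <-> exists2 d : R, 0 < d & forall w, cmod (w - z) < d -> P w.
Proof.
split.
  move=> /nbhs_ballP[e /= e0 eP]; have [r re] : exists r : R, e = (r%:C)%C.
    exists (Re e); apply/eqP; rewrite eq_complex/= eqxx/=.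
    by move: e0; rewrite ltcE/= => /andP[].
  move: e0 eP; rewrite re ltcR => r0 rP; exists r => // w wz; apply: rP.
  by rewrite /ball/= cmodE ltcR cmodB.
move=> [d d0 dP]; apply/nbhs_ballP; exists (d%:C)%C; first by rewrite /= ltcR.
by move=> w; rewrite /ball/= cmodE ltcR cmodB => /dP.
Qed.

Lemma continuous_cmodP f z : {for z, continuous f} <->
  forall e : R, 0 < e -> exists2 d : R, 0 < d &
    forall w, cmod (w - z) < d -> cmod (f w - f z) < e.
Proof.
split.
  move=> cf e e0; have /nbhs_cmodP[d d0 dP] : nbhs z (f @^-1` [set w | cmod (w - f z) < e]).
    by apply: cf; apply/nbhs_cmodP; exists e.
  by exists d.
move=> H P /nbhs_cmodP[e e0 eP]; have [d d0 dP] := H e e0.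
by apply/nbhs_cmodP; exists d => // w /dP; exact: eP.
Qed.

Lemma derivable_cmod f z : derivable f z 1 ->
  forall e : R, 0 < e -> exists2 d : R, 0 < d &
    forall w, cmod (w - z) < d -> cmod (f w - f z - 'D_1 f z * (w - z)) <= e * cmod (w - z).
Proof.
move=> df e e0.
have /(_ [set w : C | cmod (w - 'D_1 f z) < e]) := df.
case.
  by apply/nbhs_cmodP; exists e.
move=> e' /= e'0 H.
have : nbhs (0 : C) (ball (0 : C) e') by apply: nbhsx_ballx.
move=> /nbhs_cmodP[d d0 dP]; exists d => // w wz.
have [->|wz0] := eqVneq w z; first by rewrite !subrr mulr0 subr0 cmod0 mulr0.
have wz1 : w - z != 0 by rewrite subr_eq0.
have := H (w - z) (dP _ _) wz1; rewrite subr0 => /(_ wz).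
have -> : (w - z) *: (1 : C) = w - z by rewrite /GRing.scale/= mulr1.
rewrite /= subrK => hw.
have -> : f w - f z - 'D_1 f z * (w - z) =
    ((w - z)^-1 *: (f w - f z) - 'D_1 f z) * (w - z).
  by rewrite mulrBl /GRing.scale/= mulrAC mulVf// mul1r.
by rewrite cmodM ler_wpM2r ?cmod_ge0// ltW.
Qed.

(* Differentiability with the real-valued modulus in place of the [R[i]]-valued norm. *)
Lemma derivable_cmodP f z : derivable f z 1 <-> exists l : C,
  forall e : R, 0 < e -> exists2 d : R, 0 < d &
    forall w, cmod (w - z) < d -> cmod (f w - f z - l * (w - z)) <= e * cmod (w - z).
Proof.
split; first by move=> /derivable_cmod; exists ('D_1 f z).
move=> [l H]; apply/cvg_ex; exists l => P /nbhs_cmodP[e e0 eP].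
have e20 : 0 < e / 2 by rewrite divr_gt0.
have [d d0 dP] := H _ e20.
have /nbhs_ballP[d' /= d'0 d'P] : nbhs (0 : C) [set w | cmod (w - 0) < d].
  by apply/nbhs_cmodP; exists d.
exists d' => // h /= hd h0; apply: eP => /=.
have := dP (h + z); rewrite addrK => /(_ _) hh.
have {hh} := hh _; have := d'P _ hd; rewrite /= subr0 => hd1 /(_ hd1) hh.
have -> : h *: (1 : C) = h by rewrite /GRing.scale/= mulr1.
have -> : h^-1 *: (f (h + z) - f z) - l = h^-1 * (f (h + z) - f z - l * h).
  by rewrite mulrBr /GRing.scale/= [l * h]mulrC mulKf.
rewrite cmodM cmodV ltr_pdivrMl ?cmod_gt0// (le_lt_trans hh)// mulrC.
by rewrite ltr_pM2l ?cmod_gt0//; lra.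
Qed.

Lemma continuous_cst_fun (k : C) z : {for z, continuous (fun=> k)}.
Proof. by apply/continuous_cmodP => e e0; exists 1 => // w _; rewrite subrr cmod0. Qed.

Lemma continuous_id_fun z : {for z, continuous (fun w : C => w)}.
Proof. by apply/continuous_cmodP => e e0; exists e. Qed.

Lemma continuous_add_fun f g z : {for z, continuous f} -> {for z, continuous g} ->
  {for z, continuous (fun w => f w + g w)}.
Proof.
move=> /continuous_cmodP cf /continuous_cmodP cg; apply/continuous_cmodP => e e0.
have [|d d0 Hd] := cf (e / 2); first by lra.
have [|d' d'0 Hd'] := cg (e / 2); first by lra.
exists (Num.min d d'); first by rewrite lt_min d0.
move=> w; rewrite lt_min => /andP[/Hd h1 /Hd' h2].
have -> : f w + g w - (f z + g z) = (f w - f z) + (g w - g z) by ring.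
by have := cmodD (f w - f z) (g w - g z); lra.
Qed.

Lemma continuous_mul_fun f g z : {for z, continuous f} -> {for z, continuous g} ->
  {for z, continuous (fun w => f w * g w)}.
Proof.
move=> /continuous_cmodP cf /continuous_cmodP cg; apply/continuous_cmodP => e e0.
pose K := 1 + cmod (f z) + cmod (g z).
have [f0 g0] := (cmod_ge0 (f z), cmod_ge0 (g z)).
have K0 : 0 < K by rewrite /K; lra.
pose t := Num.min 1 (e / (2 * K)).
have t0 : 0 < t by rewrite lt_min ltr01 divr_gt0// mulr_gt0.
have tK : 2 * K * t <= e by rewrite mulrC -ler_pdivlMr ?mulr_gt0// ge_min lexx orbT.
have t1 : t <= 1 by rewrite ge_min lexx.
have [d d0 Hd] := cf t t0; have [d' d'0 Hd'] := cg t t0.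
exists (Num.min d d'); first by rewrite lt_min d0.
move=> w; rewrite lt_min => /andP[/Hd h1 /Hd' h2].
have -> : f w * g w - f z * g z = (f w - f z) * (g w - g z) + (f w - f z) * g z + f z * (g w - g z).
  by ring.
have := cmodD ((f w - f z) * (g w - g z) + (f w - f z) * g z) (f z * (g w - g z)).
have := cmodD ((f w - f z) * (g w - g z)) ((f w - f z) * g z).
rewrite !cmodM => k1 k2.
have p1 : cmod (f w - f z) * cmod (g w - g z) <= t * 1.
  by apply: ler_pM; rewrite ?cmod_ge0//; lra.
have p2 : cmod (f w - f z) * cmod (g z) <= t * cmod (g z) by apply: ler_wpM2r => //; lra.
have p3 : cmod (f z) * cmod (g w - g z) <= cmod (f z) * t by apply: ler_wpM2l => //; lra.
have : t * K < 2 * K * t by have := mulr_gt0 t0 K0; lra.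
rewrite /K in tK *; lra.
Qed.

Lemma continuous_inv_fun f z : f z != 0 -> {for z, continuous f} ->
  {for z, continuous (fun w => (f w)^-1)}.
Proof.
move=> fz /continuous_cmodP cf; apply/continuous_cmodP => e e0.
have f0 : 0 < cmod (f z) by rewrite cmod_gt0.
pose t := Num.min (cmod (f z) / 2) (e * cmod (f z) ^+ 2 / 2).
have t0 : 0 < t by rewrite lt_min !divr_gt0// mulr_gt0// exprn_gt0.
have t1 : t <= cmod (f z) / 2 by rewrite ge_min lexx.
have t2 : t <= e * cmod (f z) ^+ 2 / 2 by rewrite ge_min lexx orbT.
have [d d0 Hd] := cf t t0; exists d => // w /Hd h.
have fw : cmod (f z) / 2 < cmod (f w).
  by have := cmod_rev (f z) (f w); rewrite cmodB; lra.
have fw0 : f w != 0 by rewrite -cmod_gt0; lra.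
have -> : (f w)^-1 - (f z)^-1 = - (f w - f z) / (f w * f z) by field; rewrite ?fw0 ?fz.
rewrite cmodM cmodV cmodN cmodM ltr_pdivrMr; last by rewrite mulr_gt0//; lra.
apply: lt_le_trans h _; apply: le_trans t2 _; rewrite expr2 !mulrA.
have : (e * cmod (f z)) * (cmod (f z) / 2) <= (e * cmod (f z)) * cmod (f w).
  by rewrite ler_pM2l ?mulr_gt0// ltW.
lra.
Qed.

Lemma cmod_near_continuous f g z r : 0 < r -> (forall w, cmod (w - z) < r -> f w = g w) ->
  {for z, continuous f} -> {for z, continuous g}.
Proof.
move=> r0 fg /continuous_cmodP H; apply/continuous_cmodP => e e0.
have [d d0 Hd] := H e e0; exists (Num.min d r); first by rewrite lt_min d0.
move=> w; rewrite lt_min => /andP[wd wr]; rewrite -!fg ?subrr ?cmod0//; exact: Hd.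
Qed.

Lemma continuous_exp_fun f n z : {for z, continuous f} -> {for z, continuous (fun w => f w ^+ n : C)}.
Proof.
move=> cf; elim: n => [|n ih].
  have E w : cmod (w - z) < 1 -> 1 = f w ^+ 0 by rewrite expr0.
  exact: (cmod_near_continuous ltr01 E (@continuous_cst_fun 1 z)).
have E w : cmod (w - z) < 1 -> f w * f w ^+ n = f w ^+ n.+1 by rewrite exprS.
exact: (cmod_near_continuous ltr01 E (continuous_mul_fun cf ih)).
Qed.

Lemma continuous_sub_fun f g z : {for z, continuous f} -> {for z, continuous g} ->
  {for z, continuous (fun w => f w - g w)}.
Proof.
move=> cf cg; have cN := continuous_mul_fun (@continuous_cst_fun (-1) z) cg.
have E w : cmod (w - z) < 1 -> f w + -1 * g w = f w - g w by rewrite mulN1r.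
exact: (cmod_near_continuous ltr01 E (continuous_add_fun cf cN)).
Qed.

Lemma continuous_comp_fun f g z : {for z, continuous f} -> {for f z, continuous g} ->
  {for z, continuous (fun w => g (f w))}.
Proof.
move=> /continuous_cmodP cf /continuous_cmodP cg; apply/continuous_cmodP => e /cg[d d0 Hd].
by have [d' d'0 Hd'] := cf d d0; exists d' => // w /Hd'/Hd.
Qed.

(** The difference quotient, completed at [z] by the derivative, is continuous there (Caratheodory).
    The rules of differentiation thereby reduce to those of continuity, and g(z) / z gets a value at
    0. *)
Lemma derivable_slope f z : derivable f z 1 -> exists phi : C -> C,
  [/\ {for z, continuous phi}, phi z = 'D_1 f z & forall w, f w - f z = phi w * (w - z)].
Proof.
move=> /derivable_cmod Hl.
exists (fun w => if w == z then 'D_1 f z else (f w - f z) / (w - z)); split; last first.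
- move=> w; case: eqVneq => [->|wz]; first by rewrite !subrr mulr0.
  by rewrite divfK// subr_eq0.
- by rewrite eqxx.
apply/continuous_cmodP => e e0; have [|d d0 Hd] := Hl (e / 2); first by lra.
exists d => // w wd; rewrite eqxx; case: eqVneq => [_|wz]; first by rewrite subrr cmod0.
have wz1 : w - z != 0 by rewrite subr_eq0.
have -> : (f w - f z) / (w - z) - 'D_1 f z = (f w - f z - 'D_1 f z * (w - z)) / (w - z) by field.
rewrite cmodM cmodV ltr_pdivrMr ?cmod_gt0//; apply: le_lt_trans (Hd w wd) _.
by rewrite ltr_pM2r ?cmod_gt0//; lra.
Qed.

Lemma derivable_caratheodory f z : derivable f z 1 <-> exists2 phi : C -> C,
  {for z, continuous phi} & forall w, f w - f z = phi w * (w - z).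
Proof.
split=> [/derivable_slope[phi [cphi _ fphi]]|[phi /continuous_cmodP cphi fphi]].
  by exists phi.
apply/derivable_cmodP; exists (phi z) => e e0; have [d d0 Hd] := cphi e e0.
exists d => // w /Hd h; rewrite fphi -mulrBl cmodM.
by rewrite ler_wpM2r ?cmod_ge0// ltW.
Qed.

Lemma derivable_continuous f z : derivable f z 1 -> {for z, continuous f}.
Proof.
move=> /derivable_caratheodory[phi cphi fphi].
have cl := continuous_sub_fun (@continuous_id_fun z) (@continuous_cst_fun z z).
have H := continuous_add_fun (@continuous_cst_fun (f z) z) (continuous_mul_fun cphi cl).
have E w : cmod (w - z) < 1 -> f z + phi w * (w - z) = f w by rewrite -fphi subrKC.
exact: (cmod_near_continuous ltr01 E H).
Qed.

Lemma cmod_near_derivable f g z r : 0 < r -> (forall w, cmod (w - z) < r -> f w = g w) ->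
  derivable f z 1 -> derivable g z 1.
Proof.
move=> r0 fg /derivable_cmodP[l H]; apply/derivable_cmodP; exists l => e e0.
have [d d0 Hd] := H e e0; exists (Num.min d r); first by rewrite lt_min d0.
move=> w; rewrite lt_min => /andP[wd wr]; rewrite -!fg ?subrr ?cmod0//; exact: Hd.
Qed.

Lemma derivable_cst_fun (k : C) z : derivable (fun=> k) z 1.
Proof. exact: derivable_cst. Qed.

Lemma derivable_id_fun z : derivable (fun w : C => w) z 1.
Proof. exact: derivable_id. Qed.

Lemma derivable_add_fun f g z : derivable f z 1 -> derivable g z 1 ->
  derivable (fun w => f w + g w) z 1.
Proof.
move=> /derivable_caratheodory[p cp fp] /derivable_caratheodory[q cq fq].
apply/derivable_caratheodory; exists (fun w => p w + q w); first exact: continuous_add_fun.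
by move=> w; rewrite mulrDl -(fp w) -(fq w); ring.
Qed.

Lemma derivable_mul_fun f g z : derivable f z 1 -> derivable g z 1 ->
  derivable (fun w => f w * g w) z 1.
Proof.
move=> df dg; have cg := derivable_continuous dg.
move: df dg => /derivable_caratheodory[p cp fp] /derivable_caratheodory[q cq fq].
apply/derivable_caratheodory; exists (fun w => p w * g w + f z * q w).
  exact: (continuous_add_fun (continuous_mul_fun cp cg)
    (continuous_mul_fun (@continuous_cst_fun (f z) z) cq)).
move=> w; have -> : (p w * g w + f z * q w) * (w - z) =
  (p w * (w - z)) * g w + f z * (q w * (w - z)) by ring.
by rewrite -(fp w) -(fq w); ring.
Qed.

Lemma derivable_sub_fun f g z : derivable f z 1 -> derivable g z 1 ->
  derivable (fun w => f w - g w) z 1.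
Proof.
move=> df dg; have dN := derivable_mul_fun (@derivable_cst_fun (-1) z) dg.
apply: (@cmod_near_derivable _ (fun w => f w - g w) z 1 ltr01 _ (derivable_add_fun df dN)) => w _.
by rewrite mulN1r.
Qed.

Lemma derivable_exp_fun f n z : derivable f z 1 -> derivable (fun w => f w ^+ n : C) z 1.
Proof.
move=> df; elim: n => [|n ih].
  apply: (@cmod_near_derivable (fun=> 1) (fun w => f w ^+ 0) z 1 ltr01 _ (@derivable_cst_fun 1 z)) => w _.
  by rewrite expr0.
apply: (@cmod_near_derivable (fun w => f w * f w ^+ n) (fun w => f w ^+ n.+1) z 1 ltr01 _ (derivable_mul_fun df ih)) => w _.
by rewrite exprS.
Qed.

Lemma derivable_comp_fun f g z : derivable f z 1 -> derivable g (f z) 1 ->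
  derivable (fun w => g (f w)) z 1.
Proof.
move=> df dg; have cf := derivable_continuous df.
move: df dg => /derivable_caratheodory[p cp fp] /derivable_caratheodory[q cq fq].
apply/derivable_caratheodory; exists (fun w => q (f w) * p w); last first.
  by move=> w; rewrite (fq (f w)) (fp w) mulrA.
exact: (continuous_mul_fun (continuous_comp_fun cf cq) cp).
Qed.

Lemma derivable_inv_fun f z : f z != 0 -> derivable f z 1 ->
  derivable (fun w => (f w)^-1) z 1.
Proof.
move=> fz df; have cf := derivable_continuous df.
have /continuous_cmodP cif := continuous_inv_fun fz cf.
have f0 : 0 < cmod (f z) by rewrite cmod_gt0.
have [r r0 Hr] := (continuous_cmodP _ _).1 cf _ f0.
have fw0 w : cmod (w - z) < r -> f w != 0.
  move=> /Hr h; rewrite -cmod_gt0; have := cmod_rev (f z) (f w); rewrite cmodB; lra.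
move: df => /derivable_caratheodory[p cp fp].
apply/derivable_caratheodory.
(* Inverses are total, so the identity is also required where [f] vanishes; there the bare quotient
   is used, and this does not happen near [z]. *)
exists (fun w => if f w == 0 then ((f w)^-1 - (f z)^-1) / (w - z)
                 else - (p w * ((f w)^-1 * (f z)^-1))).
  have c1 := continuous_mul_fun (continuous_inv_fun fz cf) (@continuous_cst_fun (f z)^-1 z).
  have c2 := continuous_mul_fun (@continuous_cst_fun (-1) z) (continuous_mul_fun cp c1).
  apply: (cmod_near_continuous r0 _ c2) => w /fw0/negPf ->; exact: mulN1r.
move=> w; case: eqVneq => [fw|fw].
  have wz : w - z != 0.
    by rewrite subr_eq0; apply: contra_neq fz => <-.
  by rewrite divfK.
have -> : - (p w * ((f w)^-1 * (f z)^-1)) * (w - z) = - ((f w)^-1 * (f z)^-1) * (p w * (w - z)).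
  by ring.
by rewrite -(fp w); field; rewrite ?fw ?fz.
Qed.

End ComplexModulus.

(** * Integrals of continuous functions over segments *)

Section SegmentIntegral.
Variable R : realType.
Local Notation mu := (@lebesgue_measure R).
Implicit Types (a b m M : R) (g h : R -> R).

Definition segint a b g : R := \int[mu]_(x in `[a, b]) g x.
Definition cont_on a b g := forall x, a <= x <= b -> {for x, continuous g}.

Lemma cont_on_integrable a b g : cont_on a b g -> mu.-integrable `[a, b] (EFin \o g).
Proof.
move=> cg; apply: continuous_compact_integrable; first exact: segment_compact.
by apply: continuous_in_subspaceT => x; rewrite inE/= in_itv/=; exact: cg.
Qed.

Lemma segint_split m a b g : a <= m -> m <= b -> cont_on a b g ->
  segint a b g = segint a m g + segint m b g.
Proof.
move=> am mb cg; have ig := cont_on_integrable cg.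
have im : mu.-integrable `]m, b] (EFin \o g).
  apply: integrableS ig => // x /=; rewrite !in_itv/= => /andP[h1 ->].
  by rewrite (le_trans am)// ltW.
rewrite {1}/segint (@itv_bndbnd_setU _ _ _ (BRight m)) ?bnd_simp//.
rewrite Rintegral_setU//=.
- congr (_ + _); rewrite /segint -Rintegral_itv_obnd_cbnd//.
- by rewrite -itv_bndbnd_setU ?bnd_simp.
- apply/disj_setPS => x [/=]; rewrite !in_itv/= => /andP[_ h1] /andP[h2 _]; lra.
Qed.

Lemma segintD a b g h : cont_on a b g -> cont_on a b h ->
  segint a b (fun x => g x + h x) = segint a b g + segint a b h.
Proof. by move=> cg ch; rewrite /segint RintegralD//; exact: cont_on_integrable. Qed.

Lemma eq_segint a b g h : (forall x, a <= x <= b -> g x = h x) ->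
  segint a b g = segint a b h.
Proof.
by move=> gh; apply: eq_Rintegral => x; rewrite inE/= in_itv/=; exact: gh.
Qed.

Lemma segint_cst a b m : a <= b -> segint a b (fun=> m) = m * (b - a).
Proof.
move=> ab; rewrite /segint Rintegral_cst//= lebesgue_measure_itv/= lte_fin.
by case: ltP => [_|ba]; rewrite -?EFinB//=; congr (_ * _); lra.
Qed.

Lemma segint_le a b g h : cont_on a b g -> cont_on a b h ->
  (forall x, a <= x <= b -> g x <= h x) -> segint a b g <= segint a b h.
Proof.
move=> cg ch gh; apply: le_Rintegral => //; try exact: cont_on_integrable.
Qed.

Lemma cont_on_cst a b m : cont_on a b (fun=> m).
Proof. by move=> x _; exact: cvg_cst. Qed.

Lemma segint_ge_cst a b g m : a <= b -> cont_on a b g ->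
  (forall x, a <= x <= b -> m <= g x) -> m * (b - a) <= segint a b g.
Proof.
by move=> ab cg gm; rewrite -segint_cst//; apply: segint_le => //; exact: cont_on_cst.
Qed.

Lemma segint_le_cst a b g m : a <= b -> cont_on a b g ->
  (forall x, a <= x <= b -> g x <= m) -> segint a b g <= m * (b - a).
Proof.
by move=> ab cg gm; rewrite -segint_cst//; apply: segint_le => //; exact: cont_on_cst.
Qed.

End SegmentIntegral.

(** * Induction by bisection of rectangles *)

Section RectangleInduction.
Variable R : realType.
Implicit Types (a b c d h w x y : R) (P : R -> R -> R -> Prop).

(** Every left end lies below every right end, so the supremum of the left ends lies in all the
    segments. *)
Lemma nested_segments (u s : nat -> R) w : 0 <= w -> (forall n, 0 <= s n) ->
  (forall n, u n <= u n.+1 /\ u n.+1 + w * s n.+1 <= u n + w * s n) ->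
  exists x, forall n, u n <= x <= u n + w * s n.
Proof.
move=> w0 s0 H.
have um n m : u n <= u (n + m)%N.
  by elim: m => [|m ih]; rewrite ?addn0// addnS (le_trans ih)//; case: (H (n + m)%N).
have vm n m : u (n + m)%N + w * s (n + m)%N <= u n + w * s n.
  elim: m => [|m ih]; rewrite ?addn0// addnS; apply: le_trans ih.
  by case: (H (n + m)%N).
have bd n m : u m <= u n + w * s n.
  have [nm|/ltnW mn] := leqP n m.
    have := vm n (m - n)%N; rewrite subnKC// => h.
    by have := mulr_ge0 w0 (s0 m); lra.
  have := um m (n - m)%N; rewrite subnKC// => h.
  by have := mulr_ge0 w0 (s0 n); lra.
exists (sup (range u)) => n; apply/andP; split.
  apply: ub_le_sup; last by exists n.
  by exists (u 0%N + w * s 0%N) => _ [m _ <-].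
apply: ge_sup; first by exists (u 0%N), 0%N.
by move=> _ [m _ <-].
Qed.

(* A property of the sub-rectangles with corner [(a', c')] and sides [w s], [h s]. *)
Lemma rectangle_bisection P a c w h : 0 <= w -> 0 <= h ->
  (forall a' c' s, 0 < s -> P a' c' (s / 2) -> P (a' + w * (s / 2)) c' (s / 2) ->
     P a' (c' + h * (s / 2)) (s / 2) -> P (a' + w * (s / 2)) (c' + h * (s / 2)) (s / 2) ->
     P a' c' s) ->
  (forall x y, a <= x <= a + w -> c <= y <= c + h -> exists2 d, 0 < d &
     forall a' c' s, 0 < s < d -> a' <= x <= a' + w * s -> c' <= y <= c' + h * s ->
       P a' c' s) ->
  P a c 1.
Proof.
move=> w0 h0 bis loc; apply: contrapT => nP.
pose s n : R := 2^-1 ^+ n.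
have s_gt0 n : 0 < s n by rewrite exprn_gt0// invr_gt0.
have sS n : s n.+1 = s n / 2 by rewrite /s exprS mulrC.
(* [F] passes from a rectangle without the property to one of its quarters without it. *)
have /choice[F HF] : forall q : (R * R) * nat, exists q' : R * R,
    ~ P q.1.1 q.1.2 (s q.2) -> ~ P q'.1 q'.2 (s q.2.+1) /\
    (q'.1 = q.1.1 \/ q'.1 = q.1.1 + w * s q.2.+1) /\
    (q'.2 = q.1.2 \/ q'.2 = q.1.2 + h * s q.2.+1).
  move=> [[u v] n] /=; have [Pu|nPu] := pselect (P u v (s n)); first by exists (u, v).
  apply: contrapT => /forallNP Hq; apply: nPu; apply: bis => //; rewrite -sS;
    apply: contrapT => nP'.
  - by apply: (Hq (u, v)) => /= _; do !split => //; left.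
  - by apply: (Hq (u + w * s n.+1, v)) => /= _; do !split => //; [right|left].
  - by apply: (Hq (u, v + h * s n.+1)) => /= _; do !split => //; [left|right].
  - by apply: (Hq (u + w * s n.+1, v + h * s n.+1)) => /= _; do !split => //; right.
pose q := fix q n := if n is m.+1 then F (q m, m) else (a, c).
have nPq n : ~ P (q n).1 (q n).2 (s n).
  by elim: n => [|n /(HF (q n, n))[]//]; rewrite /s expr0.
have step n := (HF (q n, n) (nPq n)).2.
have mw n (k : R) : 0 <= k -> 0 <= k * s n by move=> k0; rewrite mulr_ge0// ltW.
have [x Hx] : exists x, forall n, (q n).1 <= x <= (q n).1 + w * s n.
  apply: nested_segments => // n; first exact: ltW.
  have [/= H _] := step n; have := mw n.+1 w w0; rewrite sS => hw.
  by move: H; rewrite -/(q n.+1) sS => -[->|->]; split; lra.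
have [y Hy] : exists y, forall n, (q n).2 <= y <= (q n).2 + h * s n.
  apply: nested_segments => // n; first exact: ltW.
  have [/= _ H] := step n; have := mw n.+1 h h0; rewrite sS => hw.
  by move: H; rewrite -/(q n.+1) sS => -[->|->]; split; lra.
have [|| d d0 Hd] := loc x y.
- by have := Hx 0%N; rewrite /s expr0 mulr1.
- by have := Hy 0%N; rewrite /s expr0 mulr1.
have : s @ \oo --> (0 : R).
  by apply: cvg_expr; rewrite ger0_norm ?invr_ge0// invf_lt1// ltr1n.
move=> /cvgrPdist_lt /(_ d d0)[n _ /(_ n (leqnn n))].
rewrite sub0r normrN gtr0_norm// => snd.
by apply: (nPq n); apply: Hd => //; rewrite s_gt0.
Qed.

End RectangleInduction.

(** * Goursat's theorem on rectangles *)

Section Goursat.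
Variable R : realType.
Local Notation C := (R[i]^o).
Local Notation Re := (@complex.Re R).
Local Notation Im := (@complex.Im R).
Implicit Types (a b c d e m x y : R) (z w : C) (f g : C -> C).

Definition rect a b c d : set C := [set z | a <= Re z <= b /\ c <= Im z <= d].
Definition cont_rect a b c d f := forall z, rect a b c d z -> {for z, continuous f}.

(* The real part of the integral of [f dz] along the positively oriented boundary *)
(* of [rect a b c d].                                                             *)
Definition boundary_int f a b c d : R :=
  segint a b (fun x => Re (f (x +i* c)%C) - Re (f (x +i* d)%C)) -
  segint c d (fun y => Im (f (b +i* y)%C) - Im (f (a +i* y)%C)).

Lemma rectS a b c d a' b' c' d' : a <= a' -> b' <= b -> c <= c' -> d' <= d ->
  rect a' b' c' d' `<=` rect a b c d.
Proof. by move=> h1 h2 h3 h4 z [/andP[? ?] /andP[? ?]]; split; apply/andP; split; lra. Qed.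

Lemma cmod_horiz x x' y : cmod ((x +i* y)%C - (x' +i* y)%C : C) = `|x - x'|.
Proof. by rewrite -[LHS]/(Num.sqrt _)/= subrr expr0n/= addr0 sqrtr_sqr. Qed.

Lemma cmod_vert x y y' : cmod ((x +i* y)%C - (x +i* y')%C : C) = `|y - y'|.
Proof. by rewrite -[LHS]/(Num.sqrt _)/= subrr expr0n/= add0r sqrtr_sqr. Qed.

Lemma continuous_slice f (p : R -> C) (L : C -> R) x :
  (forall x', cmod (p x' - p x) = `|x' - x|) -> (forall z w, `|L z - L w| <= cmod (z - w)) ->
  {for p x, continuous f} -> {for x, continuous (fun x => L (f (p x)))}.
Proof.
move=> pL LL /continuous_cmodP cf; apply/cvgrPdist_lt => e e0.
have [d d0 H] := cf e e0; near=> x'.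
apply: le_lt_trans (LL _ _) _; rewrite cmodB; apply: H; rewrite pL distrC.
by near: x'; apply: cvgr_dist_lt => //; exact: cvg_id.
Unshelve. all: by end_near. Qed.

Lemma RelipB z w : `|Re z - Re w| <= cmod (z - w).
Proof. by have := normRe_le (z - w); case: z w => ? ? []. Qed.

Lemma ImlipB z w : `|Im z - Im w| <= cmod (z - w).
Proof. by have := normIm_le (z - w); case: z w => ? ? []. Qed.

Lemma cont_horiz (L : C -> R) f a b c d y : (forall z w, `|L z - L w| <= cmod (z - w)) ->
  c <= y <= d -> cont_rect a b c d f -> cont_on a b (fun x => L (f (x +i* y)%C)).
Proof.
move=> LL cy cf x ax; apply: (@continuous_slice f (fun x => (x +i* y)%C)) => //.
- by move=> x'; exact: cmod_horiz.
- by apply: cf; split.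
Qed.

Lemma cont_vert (L : C -> R) f a b c d x : (forall z w, `|L z - L w| <= cmod (z - w)) ->
  a <= x <= b -> cont_rect a b c d f -> cont_on c d (fun y => L (f (x +i* y)%C)).
Proof.
move=> LL ax cf y cy; apply: (@continuous_slice f (fun y => (x +i* y)%C)) => //.
- by move=> y'; exact: cmod_vert.
- by apply: cf; split.
Qed.

Lemma cont_horizB f a b c d : a <= b -> c <= d -> cont_rect a b c d f ->
  cont_on a b (fun x => Re (f (x +i* c)%C) - Re (f (x +i* d)%C)).
Proof.
move=> ab cd cf x ax; apply: continuousB;
  apply: (@cont_horiz Re f a b c d) => //; rewrite ?lexx ?cd//; exact: RelipB.
Qed.

Lemma cont_vertB f a b c d : a <= b -> c <= d -> cont_rect a b c d f ->
  cont_on c d (fun y => Im (f (b +i* y)%C) - Im (f (a +i* y)%C)).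
Proof.
move=> ab cd cf x ax; apply: continuousB;
  apply: (@cont_vert Im f a b c d) => //; rewrite ?lexx ?ab//; exact: ImlipB.
Qed.

Lemma boundary_int_splitl m f a b c d : a <= m -> m <= b -> c <= d ->
  cont_rect a b c d f ->
  boundary_int f a b c d = boundary_int f a m c d + boundary_int f m b c d.
Proof.
move=> am mb cd cf; have ab := le_trans am mb; rewrite /boundary_int.
rewrite (segint_split am mb (cont_horizB ab cd cf)).
have c1 : cont_on c d (fun y => Im (f (b +i* y)%C) - Im (f (m +i* y)%C)).
  by apply: cont_vertB => // z /(rectS am (lexx b) (lexx c) (lexx d)); exact: cf.
have c2 : cont_on c d (fun y => Im (f (m +i* y)%C) - Im (f (a +i* y)%C)).
  by apply: cont_vertB => // z /(rectS (lexx a) mb (lexx c) (lexx d)); exact: cf.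
have -> : segint c d (fun y => Im (f (b +i* y)%C) - Im (f (a +i* y)%C)) =
   segint c d (fun y => Im (f (b +i* y)%C) - Im (f (m +i* y)%C)) +
   segint c d (fun y => Im (f (m +i* y)%C) - Im (f (a +i* y)%C)).
  by rewrite -segintD//; apply: eq_segint => y _; lra.
lra.
Qed.

Lemma boundary_int_splitb m f a b c d : a <= b -> c <= m -> m <= d ->
  cont_rect a b c d f ->
  boundary_int f a b c d = boundary_int f a b c m + boundary_int f a b m d.
Proof.
move=> ab cm md cf; have cd := le_trans cm md; rewrite /boundary_int.
rewrite (segint_split cm md (cont_vertB ab cd cf)).
have c1 : cont_on a b (fun x => Re (f (x +i* c)%C) - Re (f (x +i* m)%C)).
  by apply: cont_horizB => // z /(rectS (lexx a) (lexx b) (lexx c) md); exact: cf.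
have c2 : cont_on a b (fun x => Re (f (x +i* m)%C) - Re (f (x +i* d)%C)).
  by apply: cont_horizB => // z /(rectS (lexx a) (lexx b) cm (lexx d)); exact: cf.
have -> : segint a b (fun x => Re (f (x +i* c)%C) - Re (f (x +i* d)%C)) =
   segint a b (fun x => Re (f (x +i* c)%C) - Re (f (x +i* m)%C)) +
   segint a b (fun x => Re (f (x +i* m)%C) - Re (f (x +i* d)%C)).
  by rewrite -segintD//; apply: eq_segint => y _; lra.
lra.
Qed.

Lemma boundary_int_bounds f a b c d m1 M1 m2 M2 : a <= b -> c <= d ->
  cont_rect a b c d f ->
  (forall x, a <= x <= b -> m1 <= Re (f (x +i* c)%C) - Re (f (x +i* d)%C) <= M1) ->
  (forall y, c <= y <= d -> m2 <= Im (f (b +i* y)%C) - Im (f (a +i* y)%C) <= M2) ->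
  m1 * (b - a) - M2 * (d - c) <= boundary_int f a b c d /\
  boundary_int f a b c d <= M1 * (b - a) - m2 * (d - c).
Proof.
move=> ab cd cf H1 H2; have ch := cont_horizB ab cd cf; have cv := cont_vertB ab cd cf.
have := segint_ge_cst ab ch (fun x h => proj1 (andP (H1 x h))).
have := segint_le_cst ab ch (fun x h => proj2 (andP (H1 x h))).
have := segint_ge_cst cd cv (fun x h => proj1 (andP (H2 x h))).
have := segint_le_cst cd cv (fun x h => proj2 (andP (H2 x h))).
by rewrite /boundary_int => ? ? ? ?; split; lra.
Qed.

Definition holo_rect a b c d f := forall z, rect a b c d z -> derivable f z 1.

Lemma holo_cont_rect a b c d f : holo_rect a b c d f -> cont_rect a b c d f.
Proof. by move=> hf z /hf; exact: derivable_continuous. Qed.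

(* Near [z] the form [f dz] differs by [o(|w - z|)] from an affine closed form, whose boundary integral vanishes. *)
Lemma boundary_int_local f z e : derivable f z 1 -> 0 < e -> exists2 r, 0 < r &
  forall a b c d, a <= b -> c <= d -> rect a b c d z -> (b - a) + (d - c) < r ->
    cont_rect a b c d f -> `|boundary_int f a b c d| <= e * ((b - a) + (d - c)) ^+ 2.
Proof.
move=> /derivable_cmodP[[A B] H] e0; have [|r r0 Hr] := H (e / 2); first by lra.
exists r => // a b c d ab cd zab bd cf; set D := (b - a) + (d - c) in bd *.
have D0 : 0 <= D by rewrite /D; lra.
case: z H Hr zab => x0 y0 H Hr [/= /andP[ax xb] /andP[cy yd]].
have est x y : a <= x <= b -> c <= y <= d ->
   `|Re (f (x +i* y)%C) - Re (f (x0 +i* y0)%C) - (A * (x - x0) - B * (y - y0))| <= e / 2 * D /\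
   `|Im (f (x +i* y)%C) - Im (f (x0 +i* y0)%C) - (B * (x - x0) + A * (y - y0))| <= e / 2 * D.
  move=> /andP[h1 h2] /andP[h3 h4].
  have cD : cmod ((x +i* y)%C - (x0 +i* y0)%C : C) <= D.
    apply: le_trans (cmod_le _) _ => /=.
    have : `|x - x0| <= b - a by rewrite ler_norml; apply/andP; split; lra.
    have : `|y - y0| <= d - c by rewrite ler_norml; apply/andP; split; lra.
    by rewrite /D; lra.
  have := Hr (x +i* y)%C (le_lt_trans cD bd).
  set E := (X in cmod X <= _) => hE.
  have hE' : cmod E <= e / 2 * D by rewrite (le_trans hE)// ler_wpM2l//; lra.
  split; [apply: le_trans hE'; apply: le_trans (normRe_le E)
         |apply: le_trans hE'; apply: le_trans (normIm_le E)];
    rewrite /E; case: (f (x +i* y)%C) (f (x0 +i* y0)%C) => [u v] [u0 v0] /=;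
    rewrite le_eqVlt; apply/orP; left; apply/eqP; congr `|_|; lra.
have he : 0 <= e * D by rewrite mulr_ge0// ltW.
(* The affine part contributes B (d - c) (b - a) through the horizontal sides and the same through
   the vertical ones, and these cancel; only the errors remain. *)
have [||h1 h2] := @boundary_int_bounds f a b c d (B * (d - c) - e * D) (B * (d - c) + e * D)
  (B * (b - a) - e * D) (B * (b - a) + e * D) ab cd cf.
- move=> x xab; have [|h1 _] := est x c xab; first by rewrite lexx cd.
  have [|h2 _] := est x d xab; first by rewrite lexx cd.
  move: h1 h2; rewrite !ler_norml => /andP[? ?] /andP[? ?]; apply/andP; split; lra.
- move=> y ycd; have [|_ h1] := est a y _ ycd; first by rewrite lexx ab.
  have [|_ h2] := est b y _ ycd; first by rewrite lexx ab.
  move: h1 h2; rewrite !ler_norml => /andP[? ?] /andP[? ?]; apply/andP; split; lra.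
rewrite ler_norml expr2 /D; rewrite /D in h1 h2.
apply/andP; split; lra.
Qed.

Lemma norm_sum4_le (x1 x2 x3 x4 : R) e : `|x1| <= e / 4 -> `|x2| <= e / 4 ->
  `|x3| <= e / 4 -> `|x4| <= e / 4 -> `|x1 + x2 + (x3 + x4)| <= e.
Proof.
rewrite !ler_norml => /andP[? ?] /andP[? ?] /andP[? ?] /andP[? ?].
by apply/andP; split; lra.
Qed.

(** The bound e s^2 on sub-rectangles of scale s passes from the four quarters to the whole, since
    four times e (s/2)^2 is e s^2, and it holds at small scales around each point by
    [boundary_int_local]. *)
Theorem Goursat f a b c d : a <= b -> c <= d -> holo_rect a b c d f ->
  boundary_int f a b c d = 0.
Proof.
move=> ab cd hf; have cf := holo_cont_rect hf.
set w := b - a; set h := d - c.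
have w0 : 0 <= w by rewrite subr_ge0.
have h0 : 0 <= h by rewrite subr_ge0.
apply/eqP; rewrite -normr_le0; apply/ler_addgt0Pr => e e0; rewrite add0r.
pose P a' c' s := a <= a' -> a' + w * s <= b -> c <= c' -> c' + h * s <= d ->
  `|boundary_int f a' (a' + w * s) c' (c' + h * s)| <= e * s ^+ 2.
suff : P a c 1.
  rewrite /P !mulr1 expr1n mulr1 /w /h !subrKC !lexx; exact.
apply: (@rectangle_bisection R P a c w h) => //.
- move=> a' c' s s0 P1 P2 P3 P4 aa bb cc dd.
  have ws : 0 <= w * (s / 2) by rewrite mulr_ge0//; lra.
  have hs : 0 <= h * (s / 2) by rewrite mulr_ge0//; lra.
  have ew : w * s = w * (s / 2) + w * (s / 2) by lra.
  have eh : h * s = h * (s / 2) + h * (s / 2) by lra.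
  have cf' : cont_rect a' (a' + w * s) c' (c' + h * s) f.
    by move=> z /(rectS aa bb cc dd); exact: cf.
  rewrite (@boundary_int_splitl (a' + w * (s / 2))) //; [|lra..].
  rewrite (@boundary_int_splitb (c' + h * (s / 2)) _ a'); [|lra..|]; last first.
    by move=> z /(@rectS a' (a' + w * s) c' (c' + h * s)) K; apply: cf'; apply: K; lra.
  rewrite (@boundary_int_splitb (c' + h * (s / 2)) _ (a' + _)); [|lra..|]; last first.
    by move=> z /(@rectS a' (a' + w * s) c' (c' + h * s)) K; apply: cf'; apply: K; lra.
  have ex x : x + w * s = x + w * (s / 2) + w * (s / 2) by lra.
  have ey x : x + h * s = x + h * (s / 2) + h * (s / 2) by lra.
  rewrite ex ey in bb dd *.
  move: P1 P2 P3 P4 ws hs; set u := w * (s / 2); set v := h * (s / 2).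
  move=> P1 P2 P3 P4 u0 v0; rewrite -/u -/v in bb dd *.
  have fa : a <= a' + u by rewrite (le_trans aa)// lerDl.
  have fb : a' + u <= b by rewrite (le_trans _ bb)// lerDl.
  have fc : c <= c' + v by rewrite (le_trans cc)// lerDl.
  have fd : c' + v <= d by rewrite (le_trans _ dd)// lerDl.
  have e4 : e * (s / 2) ^+ 2 = (e * s ^+ 2) / 4 by field.
  rewrite /P e4 -/u -/v in P1 P2 P3 P4.
  exact: (norm_sum4_le (P1 aa fb cc fd) (P3 aa fb fc dd) (P2 fa bb cc fd) (P4 fa bb fc dd)).
- move=> x y xab ycd.
  have zr : rect a b c d (x +i* y)%C.
    by split => /=; [move: xab|move: ycd]; rewrite /w /h !subrKC.
  pose K := (w + h) ^+ 2 + 1.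
  have K0 : 0 < K by rewrite ltr_wpDl// sqr_ge0.
  have eK : 0 < e / K by rewrite divr_gt0.
  have [r r0 Hr] := boundary_int_local (hf _ zr) eK.
  exists (r / (w + h + 1)); first by rewrite divr_gt0//; lra.
  move=> a' c' s /andP[s0 sr] xa yc aa bb cc dd.
  have ws : 0 <= w * s by rewrite mulr_ge0//; lra.
  have hs : 0 <= h * s by rewrite mulr_ge0//; lra.
  have := Hr a' (a' + w * s) c' (c' + h * s).
  have -> : a' + w * s - a' + (c' + h * s - c') = (w + h) * s by lra.
  move=> /(_ _ _ _ _ _)/le_trans; apply; rewrite ?lerDl//.
    move: sr; rewrite ltr_pdivlMr; last by lra.
    by rewrite mulrDr mulr1 [s * _]mulrC; lra.
  - by move=> z /(rectS aa bb cc dd); exact: cf.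
  - rewrite exprMn mulrA ler_wpM2r ?sqr_ge0// -mulrA ler_piMr ?ltW//.
    by rewrite mulrC ltr_pdivrMr// mul1r /K ltrDl.
Qed.

End Goursat.

(** * Goursat's theorem with exceptional points *)

Section MaximumPrinciple.
Variable R : realType.
Local Notation C := (R[i]^o).
Local Notation Re := (@complex.Re R).
Local Notation Im := (@complex.Im R).
Implicit Types (a b c d e m x y r : R) (z w p : C) (f g : C -> C).

Lemma continuous_bounded_near f z : {for z, continuous f} ->
  exists2 r, 0 < r & forall w, cmod (w - z) < r -> cmod (f w) <= cmod (f z) + 1.
Proof.
move=> /continuous_cmodP/(_ 1 ltr01)[r r0 H]; exists r => // w /H h.
by have := cmod_rev (f w) (f z); lra.
Qed.

Lemma max_near a x e : a <= x -> 0 < e -> [/\ a <= Num.max a (x - e),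
  Num.max a (x - e) <= x, x - e <= Num.max a (x - e) &
  Num.max a (x - e) = a \/ Num.max a (x - e) < x].
Proof. by move=> ax e0; case: (leP a (x - e)) => ?; split; lra. Qed.

Lemma min_near b x e : x <= b -> 0 < e -> [/\ Num.min b (x + e) <= b,
  x <= Num.min b (x + e), Num.min b (x + e) <= x + e &
  Num.min b (x + e) = b \/ x < Num.min b (x + e)].
Proof. by move=> ax e0; case: (leP b (x + e)) => ?; split; lra. Qed.

(* The part of the rectangle away from [p] contributes nothing, and the integral over a
   small square around [p] (cut by the rectangle) tends to 0. *)
Lemma boundary_int_shrink f a b c d p e : a <= b -> c <= d -> rect a b c d p ->
  cont_rect a b c d f ->
  (forall z, rect a b c d z -> z != p -> derivable f z 1) -> 0 < e ->
  boundary_int f a b c d = boundary_int f (Num.max a (Re p - e)) (Num.min b (Re p + e))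
    (Num.max c (Im p - e)) (Num.min d (Im p + e)).
Proof.
move=> ab cd [/andP[h1 h2] /andP[h3 h4]] cf hf e0.
set a' := Num.max _ _; set b' := Num.min _ _; set c' := Num.max _ _; set d' := Num.min _ _.
have [a1 a2 _ a3] := max_near h1 e0; rewrite -/a' in a1 a2 a3.
have [b1 b2 _ b3] := min_near h2 e0; rewrite -/b' in b1 b2 b3.
have [c1 c2 _ c3] := max_near h3 e0; rewrite -/c' in c1 c2 c3.
have [d1 d2 _ d3] := min_near h4 e0; rewrite -/d' in d1 d2 d3.
move: a' b' c' d' a1 a2 a3 b1 b2 b3 c1 c2 c3 d1 d2 d3 => a' b' c' d' a1 a2 a3 b1 b2 b3 c1 c2 c3 d1 d2 d3.
have zero x1 x2 y1 y2 : a <= x1 -> x1 <= x2 -> x2 <= b -> c <= y1 -> y1 <= y2 -> y2 <= d ->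
    (~ rect x1 x2 y1 y2 p \/ x1 = x2 \/ y1 = y2) -> boundary_int f x1 x2 y1 y2 = 0.
  move=> i1 i2 i3 i4 i5 i6 [np|[<-|<-]]; last 2 first.
  - rewrite /boundary_int; have -> : segint x1 x1 (fun x => Re (f (x +i* y1)%C) - Re (f (x +i* y2)%C)) = 0.
      by rewrite /segint set_itv1 Rintegral_set1.
    rewrite (@eq_segint _ _ _ _ (fun=> 0)); last by move=> ? _; rewrite subrr.
    by rewrite segint_cst// mul0r subrr.
  - rewrite /boundary_int; have -> : segint y1 y1 (fun y => Im (f (x2 +i* y)%C) - Im (f (x1 +i* y)%C)) = 0.
      by rewrite /segint set_itv1 Rintegral_set1.
    rewrite (@eq_segint _ _ _ _ (fun=> 0)); last by move=> ? _; rewrite subrr.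
    by rewrite segint_cst// mul0r subrr.
  - apply: Goursat => // z zr; apply: hf; first exact: rectS zr.
    by apply/eqP => zp; rewrite zp in zr.
have cfS x1 x2 y1 y2 : a <= x1 -> x2 <= b -> c <= y1 -> y2 <= d -> cont_rect x1 x2 y1 y2 f.
  by move=> i1 i2 i3 i4 z /(rectS i1 i2 i3 i4); exact: cf.
rewrite (@boundary_int_splitl _ a'); [|lra..|exact: cfS].
rewrite (@zero a a' c d); [|lra..|]; last first.
  by case: a3 => [->|a3]; [right; left|left=> -[/andP[? ?] _]; lra].
rewrite add0r (@boundary_int_splitl _ b'); [|lra..|exact: cfS].
rewrite (@zero b' b c d); [|lra..|]; last first.
  by case: b3 => [->|b3]; [right; left|left=> -[/andP[? ?] _]; lra].
rewrite addr0 (@boundary_int_splitb _ c'); [|lra..|apply: cfS; lra].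
rewrite (@zero a' b' c c'); [|lra..|]; last first.
  by case: c3 => [->|c3]; [right; right|left=> -[_ /andP[? ?]]; lra].
rewrite add0r (@boundary_int_splitb _ d'); [|lra..|apply: cfS; lra].
rewrite (@zero a' b' d' d); [|lra..|]; last first.
  by case: d3 => [->|d3]; [right; right|left=> -[_ /andP[? ?]]; lra].
by rewrite addr0.
Qed.

(** Continuity at [p] bounds [f] on a small square around [p], and the perimeter of that square
    tends to 0. *)
Lemma Goursat_punctured f a b c d p : a <= b -> c <= d -> cont_rect a b c d f ->
  (forall z, rect a b c d z -> z != p -> derivable f z 1) ->
  boundary_int f a b c d = 0.
Proof.
move=> ab cd cf hf; have [pr|npr] := pselect (rect a b c d p); last first.
  apply: (Goursat ab cd) => z zr; have zp : z != p by apply/eqP => zp; apply: npr; rewrite -zp.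
  exact: hf.
have [r r0 Hr] := continuous_bounded_near (cf p pr).
set K := cmod (f p) + 1 in Hr; have K0 : 0 < K by rewrite ltr_wpDl// cmod_ge0.
apply/eqP; rewrite -normr_le0; apply/ler_addgt0Pr => e e0; rewrite add0r.
(* The square lies within 2t < r of [p], and each of the two integrals is at most 2K times 2t, in
   total 8Kt. *)
pose t := Num.min (r / 3) (e / (8 * K)).
have t0 : 0 < t by rewrite lt_min !divr_gt0// mulr_gt0.
have tr : t <= r / 3 by rewrite ge_min lexx.
have te : 8 * K * t <= e by rewrite mulrC -ler_pdivlMr ?mulr_gt0// ge_min lexx orbT.
rewrite (boundary_int_shrink ab cd pr cf hf t0).
case: (pr) => /andP[h1 h2] /andP[h3 h4].
set a' := Num.max _ _; set b' := Num.min _ _; set c' := Num.max _ _; set d' := Num.min _ _.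
have [a1 a2 a3 _] := max_near h1 t0; rewrite -/a' in a1 a2 a3.
have [b1 b2 b3 _] := min_near h2 t0; rewrite -/b' in b1 b2 b3.
have [c1 c2 c3 _] := max_near h3 t0; rewrite -/c' in c1 c2 c3.
have [d1 d2 d3 _] := min_near h4 t0; rewrite -/d' in d1 d2 d3.
move: a' b' c' d' a1 a2 a3 b1 b2 b3 c1 c2 c3 d1 d2 d3 => a' b' c' d' a1 a2 a3 b1 b2 b3 c1 c2 c3 d1 d2 d3.
have bd x y : a' <= x <= b' -> c' <= y <= d' -> cmod (f (x +i* y)%C) <= K.
  move=> /andP[x1 x2] /andP[y1 y2]; apply: Hr; apply: le_lt_trans (cmod_le _) _.
  have : `|Re ((x +i* y)%C - p : C)| <= t.
    by case: (p) a2 a3 b2 b3 => u v /= *; rewrite ler_norml; apply/andP; split; lra.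
  have : `|Im ((x +i* y)%C - p : C)| <= t.
    by case: (p) c2 c3 d2 d3 => u v /= *; rewrite ler_norml; apply/andP; split; lra.
  lra.
have [|||||k1 k2] := @boundary_int_bounds R f a' b' c' d' (- (2 * K)) (2 * K) (- (2 * K)) (2 * K).
- lra.
- lra.
- by move=> z /(rectS a1 b1 c1 d1); exact: cf.
- move=> x xx; have y1 : cmod (f (x +i* c')%C) <= K by apply: bd => //; lra.
  have y2 : cmod (f (x +i* d')%C) <= K by apply: bd => //; lra.
  have := normRe_le (f (x +i* c')%C); have := normRe_le (f (x +i* d')%C).
  by rewrite !ler_norml => /andP[? ?] /andP[? ?]; apply/andP; split; lra.
- move=> y yy; have y1 : cmod (f (a' +i* y)%C) <= K by apply: bd => //; lra.
  have y2 : cmod (f (b' +i* y)%C) <= K by apply: bd => //; lra.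
  have := normIm_le (f (a' +i* y)%C); have := normIm_le (f (b' +i* y)%C).
  by rewrite !ler_norml => /andP[? ?] /andP[? ?]; apply/andP; split; lra.
have wt : K * (b' - a') <= K * (2 * t) by rewrite ler_pM2l//; lra.
have ht : K * (d' - c') <= K * (2 * t) by rewrite ler_pM2l//; lra.
by rewrite ler_norml; apply/andP; split; lra.
Qed.

(** Two exceptions are needed for the quotients of the maximum principle: the point where the
    function is merely continuous, and the zero of the denominator. A vertical or horizontal cut
    between them isolates each one. *)
Lemma Goursat_punctured2 f a b c d p q : a <= b -> c <= d -> cont_rect a b c d f ->
  (forall z, rect a b c d z -> z != p -> z != q -> derivable f z 1) ->
  boundary_int f a b c d = 0.
Proof.
move=> ab cd cf hf.
have [pr|npr] := pselect (rect a b c d p); last first.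
  apply: (@Goursat_punctured _ _ _ _ _ q ab cd cf) => z zr.
  have zp : z != p by apply/eqP => zp; apply: npr; rewrite -zp.
  exact: hf.
have [qr|nqr] := pselect (rect a b c d q); last first.
  apply: (@Goursat_punctured _ _ _ _ _ p ab cd cf) => z zr zp.
  have zq : z != q by apply/eqP => zq; apply: nqr; rewrite -zq.
  exact: hf.
wlog: p q hf pr qr / Re p < Re q \/ (Re p = Re q /\ Im p <= Im q).
  move=> W; have [pq|qp|pq] := ltgtP (Re p) (Re q).
  - by apply: (W p q) => //; left.
  - by apply: (W q p) => //; [move=> z zr zq zp; exact: hf|left].
  - have [ipq|/ltW iqp] := leP (Im p) (Im q); first by apply: (W p q) => //; right.
    by apply: (W q p) => //; [move=> z zr zq zp; exact: hf|right].
case: (pr) => /andP[h1 h2] /andP[h3 h4]; case: (qr) => /andP[h5 h6] /andP[h7 h8].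
case=> [pq|[pq ipq]].
  rewrite (@boundary_int_splitl _ ((Re p + Re q) / 2)) //; [|lra..].
  rewrite (@Goursat_punctured _ _ _ _ _ p) //; last 3 first.
  - lra.
  - by move=> z zr; apply: cf; apply: rectS zr; lra.
  - move=> z zr zp; apply: hf => //; first by apply: rectS zr; lra.
    by apply: contraPneq zr => -> [/andP[? ?] _]; lra.
  rewrite (@Goursat_punctured _ _ _ _ _ q) ?addr0//; first by lra.
  - by move=> z zr; apply: cf; apply: rectS zr; lra.
  - move=> z zr zq; apply: hf => //; first by apply: rectS zr; lra.
    by apply: contraPneq zr => -> [/andP[? ?] _]; lra.
have [pq0|npq] := eqVneq p q.
  by apply: (@Goursat_punctured _ _ _ _ _ p) => // z zr zp; apply: hf; rewrite -?pq0.
have {ipq}ipq : Im p < Im q.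
  rewrite lt_neqAle ipq andbT; apply: contra_neq npq.
  by case: (p) (q) pq => ? ? [? ?] /= -> ->.
rewrite (@boundary_int_splitb _ ((Im p + Im q) / 2)) //; [|lra..].
rewrite (@Goursat_punctured _ _ _ _ _ p) //; last 3 first.
- lra.
- by move=> z zr; apply: cf; apply: rectS zr; lra.
- move=> z zr zp; apply: hf => //; first by apply: rectS zr; lra.
  by apply: contraPneq zr => -> [_ /andP[? ?]]; lra.
rewrite (@Goursat_punctured _ _ _ _ _ q) ?addr0//; first by lra.
- by move=> z zr; apply: cf; apply: rectS zr; lra.
- move=> z zr zq; apply: hf => //; first by apply: rectS zr; lra.
  by apply: contraPneq zr => -> [_ /andP[? ?]]; lra.
Qed.

End MaximumPrinciple.

(** * Landau's crude form of the modulus estimate *)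

Section MaximumPrinciple.
Variable R : realType.
Local Notation C := (R[i]^o).
Local Notation Re := (@complex.Re R).
Local Notation Im := (@complex.Im R).
Implicit Types (a b c d e m x y r M : R) (z w p : C) (f g : C -> C).

Definition on_boundary a b c d (P : C -> Prop) :=
  (forall x, a <= x <= b -> P (x +i* c)%C /\ P (x +i* d)%C) /\
  (forall y, c <= y <= d -> P (a +i* y)%C /\ P (b +i* y)%C).

Lemma Re_mNi z : Re (- 'i%C * z) = Im z. Proof. by case: z => u v /=; lra. Qed.
Lemma Im_mNi z : Im (- 'i%C * z) = - Re z. Proof. by case: z => u v /=; lra. Qed.

Section Landau.
Variables (a b c d del : R) (z0 p : C).
Hypothesis del0 : 0 < del.
Hypothesis inab : a + del <= Re z0 <= b - del.
Hypothesis incd : c + del <= Im z0 <= d - del.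
Hypothesis z0p : z0 != p.
Let DD := (b - a) ^+ 2 + (d - c) ^+ 2.

Lemma boundary_dist z : rect a b c d z ->
  [\/ Re z <= a, Re z >= b, Im z <= c | Im z >= d] ->
  del <= cmod (z - z0) /\ cmod (z - z0) ^+ 2 <= DD.
Proof.
have d0 := del0; move: inab incd => /andP[h1 h2] /andP[h3 h4].
move=> [/andP[k1 k2] /andP[k3 k4]] side; split.
  have rz := normRe_le (z - z0); have iz := normIm_le (z - z0).
  have eR : Re (z - z0) = Re z - Re z0 by case: (z) (z0) => ? ? [].
  have eI : Im (z - z0) = Im z - Im z0 by case: (z) (z0) => ? ? [].
  rewrite eR eI !ler_norml in rz iz.
  by move: rz iz => /andP[? ?] /andP[? ?]; case: side => ?; lra.
clear side; rewrite cmod_sqr /DD lerD//.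
  have -> : Re (z - z0) = Re z - Re z0 by case: (z) (z0) => ? ? [].
  rewrite -real_normK ?num_real// ler_sqr ?nnegrE//; last by lra.
  by rewrite ler_norml; apply/andP; split; lra.
have -> : Im (z - z0) = Im z - Im z0 by case: (z) (z0) => ? ? [].
rewrite -real_normK ?num_real// ler_sqr ?nnegrE//; last by lra.
by rewrite ler_norml; apply/andP; split; lra.
Qed.

(* [1 - phi] vanishes at [z0], so [(1 - phi) / (z - z0)] has no net boundary integral,
   whereas [1 / (z - z0)] alone has one bounded below. *)
Lemma landau_estimate (phi : C -> C) (q : R) : (forall z, rect a b c d z -> {for z, continuous phi}) ->
  (forall z, rect a b c d z -> z != p -> derivable phi z 1) -> phi z0 = 1 ->
  on_boundary a b c d (fun z => cmod (phi z) <= q) ->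
  del / DD <= 2 * q / del.
Proof.
move=> cphi dphi phi1 [Hh Hv].
have d0 := del0; have /andP[h1 h2] := inab; have /andP[h3 h4] := incd.
have z0r : rect a b c d z0 by split; apply/andP; split; lra.
have [l Hl] := (derivable_cmodP _ _).1 (dphi z0 z0r z0p).
(* The boundary integral of 1 / (z - z0) is purely imaginary; the factor -i makes it visible to
   [boundary_int], which records real parts. *)
pose k z : C := if z == z0 then - 'i%C * l else - 'i%C * ((phi z - 1) / (z - z0)).
have dk z : rect a b c d z -> z != p -> z != z0 -> derivable k z 1.
  move=> zr zp zz0.
  have r0 : 0 < cmod (z - z0) by rewrite cmod_gt0 subr_eq0.
  have nz : z - z0 != 0 by rewrite subr_eq0.
  have E w : cmod (w - z) < cmod (z - z0) -> - 'i%C * ((phi w - 1) / (w - z0)) = k w.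
    by rewrite /k; case: eqP => // ->; rewrite cmodB ltxx.
  have d1 := derivable_sub_fun (dphi z zr zp) (@derivable_cst_fun R 1 z).
  have d2 := (@derivable_inv_fun R (fun w => w - z0) z nz (derivable_sub_fun (@derivable_id_fun R z) (@derivable_cst_fun R z0 z))).
  have d3 := derivable_mul_fun (@derivable_cst_fun R (- 'i%C) z) (derivable_mul_fun d1 d2).
  exact: (@cmod_near_derivable R _ k z _ r0 E d3).
have ck : cont_rect a b c d k.
  move=> z zr; have [->|zz0] := eqVneq z z0.
    apply/continuous_cmodP => e e0; have e20 : 0 < e / 2 by lra.
    have [r r0 Hr] := Hl _ e20; exists r => // w wr; rewrite /k eqxx.
    case: eqP => [_|/eqP wz0]; first by rewrite subrr cmod0.
    rewrite -mulrBr cmodM cmodN cmod_i mul1r.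
    have wz1 : w - z0 != 0 by rewrite subr_eq0.
    have -> : (phi w - 1) / (w - z0) - l = (phi w - phi z0 - l * (w - z0)) / (w - z0).
      by rewrite phi1; field.
    rewrite cmodM cmodV ltr_pdivrMr ?cmod_gt0//; apply: le_lt_trans (Hr w wr) _.
    by rewrite ltr_pM2r ?cmod_gt0//; lra.
  have [zp|zp] := eqVneq z p; last exact: (derivable_continuous (dk z zr zp zz0)).
  have r0 : 0 < cmod (z - z0) by rewrite cmod_gt0 subr_eq0.
  have nz : z - z0 != 0 by rewrite subr_eq0.
  have E w : cmod (w - z) < cmod (z - z0) -> - 'i%C * ((phi w - 1) / (w - z0)) = k w.
    by rewrite /k; case: eqP => // ->; rewrite cmodB ltxx.
  have c1 := continuous_sub_fun (cphi z zr) (@continuous_cst_fun R 1 z).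
  have c2 := (@continuous_inv_fun R (fun w => w - z0) z nz (continuous_sub_fun (@continuous_id_fun R z) (@continuous_cst_fun R z0 z))).
  have c3 := continuous_mul_fun (@continuous_cst_fun R (- 'i%C) z) (continuous_mul_fun c1 c2).
  exact: (@cmod_near_continuous R _ k z _ r0 E c3).
have bk : boundary_int k a b c d = 0.
  by apply: (@Goursat_punctured2 _ _ _ _ _ _ p z0) => //; lra.
have DD0 : 0 < DD by rewrite ltr_pwDl ?sqr_ge0// exprn_gt0//; lra.
(* On the boundary [k + P] is - i phi / (z - z0), of modulus at most [q / del]; there [k] is [- P]
   up to that error, and [P] has the sign dictated by the side. *)
pose P z : C := - 'i%C * (z - z0)^-1; pose n2 z := cmod (z - z0) ^+ 2.
have ReP z : Re (P z) = - (Im z - Im z0) / n2 z.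
  rewrite /P Re_mNi /n2 cmod_sqr; case: (z) (z0) => u v [u0 v0] /=; by rewrite ?mulNr.
have ImP z : Im (P z) = - (Re z - Re z0) / n2 z.
  rewrite /P Im_mNi /n2 cmod_sqr; case: (z) (z0) => u v [u0 v0] /=; by rewrite mulNr.
have est z : rect a b c d z -> [\/ Re z <= a, Re z >= b, Im z <= c | Im z >= d] ->
    cmod (phi z) <= q -> [/\ `|Re (k z) + Re (P z)| <= q / del, `|Im (k z) + Im (P z)| <= q / del,
    0 < n2 z & n2 z <= DD].
  move=> zr side pq; have [dl dD] := boundary_dist zr side.
  have z1 : z != z0 by rewrite -subr_eq0 -cmod_gt0; lra.
  have z2 : z - z0 != 0 by rewrite subr_eq0.
  have E : cmod (k z + P z) <= q / del.
    rewrite /k (negPf z1) /P -mulrDr -[X in _ + X]mul1r -mulrDl subrK.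
    rewrite cmodM cmodN cmod_i mul1r.
    rewrite cmodM cmodV; apply: ler_pM => //; rewrite ?cmod_ge0 ?invr_ge0 ?cmod_ge0//.
    by rewrite lef_pV2// posrE; lra.
  split => //; last by rewrite exprn_gt0//; lra.
  - by apply: le_trans E; apply: le_trans (normRe_le _); case: (k z) (P z) => ? ? [].
  - by apply: le_trans E; apply: le_trans (normIm_le _); case: (k z) (P z) => ? ? [].
have ineq x y : 0 < y -> y <= DD -> del <= x -> del / DD <= x / y.
  move=> y0 yD dx; apply: ler_pM => //; rewrite ?invr_ge0 ?(ltW DD0) ?(ltW d0)//.
  by rewrite lef_pV2.
set ka := del / DD; set qq := 2 * q / del.
have arith u v A B : `|u + A| <= q / del -> `|v + - B| <= q / del -> ka <= A -> ka <= B ->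
    ka - qq <= v - u /\ u - v <= qq - ka.
  have ka0 : 0 <= ka by rewrite divr_ge0// ltW.
  have -> : qq = 2 * (q / del) by rewrite /qq mulrA.
  rewrite !ler_norml => /andP[? ?] /andP[? ?] ? ?; split; lra.
have [d1 d2] : del <= Re z0 - a /\ del <= b - Re z0 by split; lra.
have [d3 d4] : del <= Im z0 - c /\ del <= d - Im z0 by split; lra.
have ab : a <= b by lra. have cd : c <= d by lra.
have I1 : segint a b (fun x => Re (k (x +i* c)%C) - Re (k (x +i* d)%C)) <= (qq - ka) * (b - a).
  apply: segint_le_cst => //; first exact: cont_horizB.
  move=> x xx; have [pc pd] := Hh x xx.
  have [||e1 _ n1 n1'] := est (x +i* c)%C _ _ pc.
    by split => //=; rewrite lexx cd.
    by apply: Or43 => /=.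
  have [||e2 _ n3 n3'] := est (x +i* d)%C _ _ pd.
    by split => //=; rewrite lexx cd.
    by apply: Or44 => /=.
  rewrite ReP/= opprB in e1; rewrite ReP/= mulNr in e2.
  exact: (arith _ _ _ _ e1 e2 (ineq (Im z0 - c) _ n1 n1' d3) (ineq (d - Im z0) _ n3 n3' d4)).2.
have I2 : (ka - qq) * (d - c) <= segint c d (fun y => Im (k (b +i* y)%C) - Im (k (a +i* y)%C)).
  apply: segint_ge_cst => //; first exact: cont_vertB.
  move=> y yy; have [pa pb] := Hv y yy.
  have [||_ e1 n1 n1'] := est (a +i* y)%C _ _ pa.
    by split => //=; rewrite lexx ab.
    by apply: Or41 => /=.
  have [||_ e2 n3 n3'] := est (b +i* y)%C _ _ pb.
    by split => //=; rewrite lexx ab.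
    by apply: Or42 => /=.
  rewrite ImP/= opprB in e1; rewrite ImP/= mulNr in e2.
  exact: (arith _ _ _ _ e1 e2 (ineq (Re z0 - a) _ n1 n1' d1) (ineq (b - Re z0) _ n3 n3' d2)).1.
(* If [qq < ka], the horizontal integral is negative and the vertical one positive, so their
   difference cannot vanish. *)
rewrite leNgt; apply/negP => lt; move: bk; rewrite /boundary_int.
have : (qq - ka) * (b - a) < 0 by rewrite nmulr_rlt0; lra.
have : (qq - ka) * (d - c) < 0 by rewrite nmulr_rlt0; lra.
lra.
Qed.

End Landau.
End MaximumPrinciple.

(** * The maximum principle for the modulus and for the imaginary part *)

Section MaximumPrinciple.
Variable R : realType.
Local Notation C := (R[i]^o).
Local Notation Re := (@complex.Re R).
Local Notation Im := (@complex.Im R).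
Implicit Types (a b c d e m x y r M : R) (z w p : C) (f g : C -> C).

(* Landau's trick: the crude estimate applied to the powers of [f / f z0]. *)
Lemma maximum_rect_off f a b c d p z0 M : cont_rect a b c d f ->
  (forall z, rect a b c d z -> z != p -> derivable f z 1) ->
  a < Re z0 < b -> c < Im z0 < d -> z0 != p -> 0 <= M ->
  on_boundary a b c d (fun z => cmod (f z) <= M) -> cmod (f z0) <= M.
Proof.
move=> cf df /andP[h1 h2] /andP[h3 h4] z0p M0 [Hh Hv].
pose del := Num.min (Num.min (Re z0 - a) (b - Re z0)) (Num.min (Im z0 - c) (d - Im z0)).
have del0 : 0 < del by rewrite !lt_min !subr_gt0 h1 h2 h3 h4.
have [d1 d2 d3 d4] : [/\ del <= Re z0 - a, del <= b - Re z0, del <= Im z0 - c & del <= d - Im z0].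
  by split; rewrite /del !ge_min lexx ?orbT.
have i1 : a + del <= Re z0 <= b - del by apply/andP; split; lra.
have i2 : c + del <= Im z0 <= d - del by apply/andP; split; lra.
rewrite leNgt; apply/negP => lt; have fz0 : f z0 != 0.
  by rewrite -cmod_gt0 (le_lt_trans M0).
have c0 : 0 < cmod (f z0) by rewrite cmod_gt0.
set q := M / cmod (f z0).
have q0 : 0 <= q by rewrite divr_ge0// ltW.
have q1 : q < 1 by rewrite ltr_pdivrMr// mul1r.
have DD0 : 0 < (b - a) ^+ 2 + (d - c) ^+ 2.
  by rewrite ltr_pwDl ?sqr_ge0// exprn_gt0//; lra.
set K := del / ((b - a) ^+ 2 + (d - c) ^+ 2).
have K0 : 0 < K by rewrite divr_gt0.
have main n : K <= 2 * q ^+ n / del.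
  apply: (@landau_estimate R a b c d del z0 p del0 i1 i2 z0p (fun z => (f z / f z0) ^+ n)).
  - move=> z zr.
    exact: (continuous_exp_fun (continuous_mul_fun (cf z zr) (@continuous_cst_fun R (f z0)^-1 z))).
  - move=> z zr zp.
    exact: (derivable_exp_fun (derivable_mul_fun (df z zr zp) (@derivable_cst_fun R (f z0)^-1 z))).
  - by rewrite divff// expr1n.
  - have H z : cmod (f z) <= M -> cmod ((f z / f z0) ^+ n) <= q ^+ n.
      move=> fM; rewrite cmodX cmodM cmodV; apply: lerXn2r; rewrite ?nnegrE//.
        by rewrite divr_ge0// ?cmod_ge0// ltW.
      by rewrite ler_pM2r// invr_gt0.
    by split=> [x|y] xx; [have [k1 k2] := Hh x xx|have [k1 k2] := Hv y xx]; split; apply: H.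
have : (fun n => q ^+ n) @ \oo --> (0 : R) by apply: cvg_expr; rewrite ger0_norm.
have e0 : 0 < K * del / 2 by rewrite divr_gt0// mulr_gt0.
move=> /cvgrPdist_lt /(_ _ e0)[n _ /(_ n (leqnn n))].
rewrite sub0r normrN ger0_norm ?exprn_ge0// => qn.
by have := main n; rewrite ler_pdivlMr//; lra.
Qed.

(** At the exceptional point the bound follows by continuity from a nearby point on its right. *)
Lemma maximum_rect f a b c d p z0 M : cont_rect a b c d f ->
  (forall z, rect a b c d z -> z != p -> derivable f z 1) ->
  a < Re z0 < b -> c < Im z0 < d -> 0 <= M ->
  on_boundary a b c d (fun z => cmod (f z) <= M) -> cmod (f z0) <= M.
Proof.
move=> cf df h1 h2 M0 bd; have [z0p|z0p] := eqVneq z0 p; last first.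
  exact: (maximum_rect_off cf df h1 h2 z0p M0 bd).
apply/ler_addgt0Pr => e e0.
have z0r : rect a b c d z0.
  by move: h1 h2 => /andP[? ?] /andP[? ?]; split; apply/andP; split; lra.
have [r r0 Hr] := (continuous_cmodP _ _).1 (cf z0 z0r) e e0.
pose t := Num.min (r / 2) ((b - Re z0) / 2).
have bz : 0 < b - Re z0 by move/andP : h1 => []; lra.
have t0 : 0 < t by rewrite lt_min !divr_gt0.
have tr : t <= r / 2 by rewrite ge_min lexx.
have tb : t <= (b - Re z0) / 2 by rewrite ge_min lexx orbT.
pose w : C := z0 + (t%:C)%C.
have Rw : Re w = Re z0 + t by rewrite /w; case: (z0).
have Iw : Im w = Im z0 by rewrite /w; case: (z0) => u v /=; rewrite addr0.
have wz : cmod (w - z0) = t by rewrite /w addrC addKr cmod_real gtr0_norm.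
have fw : cmod (f w) <= M.
  apply: (maximum_rect_off cf df _ _ _ M0 bd).
  - by rewrite Rw; move/andP : h1 => [? ?]; apply/andP; split; lra.
  - by rewrite Iw.
  - by rewrite -z0p -subr_eq0 -cmod_gt0 wz.
have := Hr w; rewrite wz => /(_ ltac:(lra)); rewrite cmodB => h.
by have := cmod_rev (f z0) (f w); lra.
Qed.

Lemma boundary_bounded f a b c d : a <= b -> c <= d -> cont_rect a b c d f ->
  exists2 B, 0 <= B & on_boundary a b c d (fun z => cmod (f z) <= B).
Proof.
move=> ab cd cf; have lip z w : `|cmod z - cmod w| <= cmod (z - w).
  by have := cmod_rev z w; have := cmod_rev w z; rewrite (cmodB w) => ? ?;
    rewrite ler_norml; apply/andP; split; lra.
have bd u v (g : R -> R) : u <= v -> cont_on u v g -> exists B, forall x, u <= x <= v -> g x <= B.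
  move=> uv cg; have [|k kuv Hk] := @EVT_max R g u v uv.
    by apply: continuous_in_subspaceT => x; rewrite inE/= in_itv/=; exact: cg.
  by exists (g k) => x xuv; apply: Hk; rewrite in_itv.
have [B1 H1] := bd a b _ ab (@cont_horiz R (@cmod R) f a b c d c lip ltac:(by rewrite lexx cd) cf).
have [B2 H2] := bd a b _ ab (@cont_horiz R (@cmod R) f a b c d d lip ltac:(by rewrite lexx cd) cf).
have [B3 H3] := bd c d _ cd (@cont_vert R (@cmod R) f a b c d a lip ltac:(by rewrite lexx ab) cf).
have [B4 H4] := bd c d _ cd (@cont_vert R (@cmod R) f a b c d b lip ltac:(by rewrite lexx ab) cf).
have n1 := ler_norm B1; have n2 := ler_norm B2; have n3 := ler_norm B3; have n4 := ler_norm B4.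
have p1 := normr_ge0 B1; have p2 := normr_ge0 B2; have p3 := normr_ge0 B3; have p4 := normr_ge0 B4.
exists (`|B1| + `|B2| + `|B3| + `|B4|); first by lra.
split=> [x xx|y yy].
  by have := H1 x xx; have := H2 x xx; split; lra.
by have := H3 y yy; have := H4 y yy; split; lra.
Qed.

(* The modulus principle for [1 - i t h] as [t] tends to 0. *)
Lemma maximum_rect_Im h a b c d z0 M : holo_rect a b c d h ->
  a < Re z0 < b -> c < Im z0 < d ->
  on_boundary a b c d (fun z => Im (h z) <= M) -> Im (h z0) <= M.
Proof.
move=> hh h1 h2 [Hh Hv]; have ch := holo_cont_rect hh.
have [ab cd] : a <= b /\ c <= d by move: h1 h2 => /andP[? ?] /andP[? ?]; split; lra.
have [B B0 [Bh Bv]] := boundary_bounded ab cd ch.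
apply/ler_addgt0Pr => e e0.
(* The first bound keeps 1 + t Im h nonnegative on the boundary, so that squares compare; the second
   makes the remainder t (M^2 + B^2) / 2 smaller than [e]. *)
pose t := Num.min (1 / (1 + B + `|M|)) (e / (1 + M ^+ 2 + B ^+ 2)).
have k1 : 0 < 1 + B + `|M| by have := normr_ge0 M; lra.
have k2 : 0 < 1 + M ^+ 2 + B ^+ 2 by have := sqr_ge0 M; have := sqr_ge0 B; lra.
have t0 : 0 < t by rewrite lt_min !divr_gt0.
have t1 : t * (1 + B + `|M|) <= 1 by rewrite -ler_pdivlMr// ge_min lexx.
have t2 : t * (1 + M ^+ 2 + B ^+ 2) <= e by rewrite -ler_pdivlMr// ge_min lexx orbT.
have tB0 : 0 <= t * B by rewrite mulr_ge0// ltW.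
have tM0 : 0 <= t * `|M| by rewrite mulr_ge0// ltW.
have tM : `|t * M| <= 1 by rewrite normrM gtr0_norm//; lra.
have tB : t * B <= 1 by lra.
pose f z : C := 1 - 'i%C * (t%:C)%C * h z.
have fE z : cmod (f z) ^+ 2 = (1 + t * Im (h z)) ^+ 2 + (t * Re (h z)) ^+ 2.
  by rewrite cmod_sqr /f; case: (h z) => u v /=; congr (_ ^+ 2 + _); [|rewrite -sqrrN; congr (_ ^+ 2)]; ring.
pose N := Num.sqrt ((1 + t * M) ^+ 2 + (t * B) ^+ 2).
have N2 : N ^+ 2 = (1 + t * M) ^+ 2 + (t * B) ^+ 2 by rewrite sqr_sqrtr// addr_ge0// sqr_ge0.
have N0 : 0 <= N by exact: sqrtr_ge0.
have bdf z : Im (h z) <= M -> cmod (h z) <= B -> cmod (f z) <= N.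
  move=> iM hB; rewrite -ler_sqr ?nnegrE ?cmod_ge0// fE N2.
  have := normIm_le (h z); have := normRe_le (h z); rewrite !ler_norml => /andP[r1 r2] /andP[i1 i2].
  have tI : t * Im (h z) <= t * M by rewrite ler_pM2l.
  have tI' : - (t * B) <= t * Im (h z) by rewrite -mulrN ler_pM2l//; lra.
  apply: lerD; first by rewrite ler_sqr ?nnegrE; lra.
  rewrite -real_normK ?num_real// ler_sqr ?nnegrE//.
  by rewrite normrM gtr0_norm// ler_pM2l// ler_norml; apply/andP; split; lra.
have dhf z : rect a b c d z -> derivable f z 1.
  move=> zr; exact: (derivable_sub_fun (@derivable_cst_fun R 1 z)
    (derivable_mul_fun (@derivable_cst_fun R ('i%C * (t%:C)%C) z) (hh z zr))).
have fz0 : cmod (f z0) <= N.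
  apply: (@maximum_rect f a b c d z0 z0 N _ _ h1 h2 N0).
  - by move=> z zr; exact: (derivable_continuous (dhf z zr)).
  - by move=> z zr _; exact: dhf.
  - by split=> [x|y] xx; [have [? ?] := Hh x xx; have [? ?] := Bh x xx
                        |have [? ?] := Hv y xx; have [? ?] := Bv y xx]; split; exact: bdf.
have : cmod (f z0) ^+ 2 <= N ^+ 2 by rewrite ler_sqr ?nnegrE ?cmod_ge0.
rewrite fE N2 !sqrrD !expr1n !mul1r => hf.
have : 2 * (t * Im (h z0)) <= 2 * (t * M) + (t * M) ^+ 2 + (t * B) ^+ 2.
  have := sqr_ge0 (t * Im (h z0)); have := sqr_ge0 (t * Re (h z0)); lra.
have -> : 2 * (t * M) + (t * M) ^+ 2 + (t * B) ^+ 2 = 2 * t * (M + t * (M ^+ 2 + B ^+ 2) / 2) by field.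
rewrite mulrA ler_pM2l ?mulr_gt0// => hI; apply: le_trans hI _; lra.
Qed.

End MaximumPrinciple.

(** * Open mapping, continuity of the inverse and compactness *)

Section OpenMapping.
Variable R : realType.
Local Notation C := (R[i]^o).
Local Notation Re := (@complex.Re R).
Local Notation Im := (@complex.Im R).
Implicit Types (a b c d e m x y r M : R) (z w p : C) (f g : C -> C) (A B : set C).

Lemma minimum_rect f a b c d z0 m : holo_rect a b c d f ->
  (forall z, rect a b c d z -> f z != 0) ->
  a < Re z0 < b -> c < Im z0 < d -> 0 < m ->
  on_boundary a b c d (fun z => m <= cmod (f z)) -> m <= cmod (f z0).
Proof.
move=> hf f0 h1 h2 m0 [Hh Hv].
have z0r : rect a b c d z0.
  by move: h1 h2 => /andP[? ?] /andP[? ?]; split; apply/andP; split; lra.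
have H z : m <= cmod (f z) -> cmod (f z)^-1 <= m^-1.
  by move=> mf; rewrite cmodV lef_pV2// posrE (lt_le_trans m0).
have : cmod (f z0)^-1 <= m^-1.
  apply: (@maximum_rect R (fun z => (f z)^-1) a b c d z0 z0 m^-1 _ _ h1 h2).
  - move=> z zr; exact: (continuous_inv_fun (f0 z zr) (derivable_continuous (hf z zr))).
  - move=> z zr _; exact: (derivable_inv_fun (f0 z zr) (hf z zr)).
  - by rewrite invr_ge0 ltW.
  - by split=> [x|y] xx; [have [? ?] := Hh x xx|have [? ?] := Hv y xx]; split; apply: H.
by rewrite cmodV lef_pV2// posrE cmod_gt0; exact: f0.
Qed.

Lemma boundary_min f a b c d : a <= b -> c <= d -> cont_rect a b c d f ->
  on_boundary a b c d (fun z => f z != 0) ->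
  exists2 m, 0 < m & on_boundary a b c d (fun z => m <= cmod (f z)).
Proof.
move=> ab cd cf [fh fv]; have lip z w : `|cmod z - cmod w| <= cmod (z - w).
  have := cmod_rev z w; have := cmod_rev w z; rewrite (cmodB w) => h1 h2.
  by rewrite ler_norml; apply/andP; split; lra.
have bd u v (g : R -> R) : u <= v -> cont_on u v g -> (forall x, u <= x <= v -> 0 < g x) ->
    exists2 B, 0 < B & forall x, u <= x <= v -> B <= g x.
  move=> uv cg g0; have [|k kuv Hk] := @EVT_min R g u v uv.
    by apply: continuous_in_subspaceT => x; rewrite inE/= in_itv/=; exact: cg.
  by exists (g k) => [|x xuv]; [apply: g0; rewrite in_itv in kuv|apply: Hk; rewrite in_itv].
have c1 : c <= c <= d by rewrite lexx.
have d1 : c <= d <= d by rewrite lexx cd.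
have a1 : a <= a <= b by rewrite lexx.
have b1 : a <= b <= b by rewrite lexx ab.
have [B1 k1 H1] := bd a b _ ab (cont_horiz lip c1 cf) ltac:(by move=> x /fh[]; rewrite -cmod_gt0).
have [B2 k2 H2] := bd a b _ ab (cont_horiz lip d1 cf) ltac:(by move=> x /fh[]; rewrite -!cmod_gt0).
have [B3 k3 H3] := bd c d _ cd (cont_vert lip a1 cf) ltac:(by move=> x /fv[]; rewrite -cmod_gt0).
have [B4 k4 H4] := bd c d _ cd (cont_vert lip b1 cf) ltac:(by move=> x /fv[]; rewrite -!cmod_gt0).
exists (Num.min (Num.min B1 B2) (Num.min B3 B4)); first by rewrite !lt_min k1 k2 k3 k4.
split=> [x xx|y yy]; rewrite !ge_min.
  by rewrite H1// H2// orbT.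
by rewrite H3// H4// !orbT.
Qed.

Lemma square_ball z0 t z : rect (Re z0 - t) (Re z0 + t) (Im z0 - t) (Im z0 + t) z ->
  cmod (z - z0) <= 2 * t.
Proof.
case: z0 z => x0 y0 [x y] [/= /andP[? ?] /andP[? ?]]; apply: le_trans (cmod_le _) _ => /=.
have : `|x - x0| <= t by rewrite ler_norml; apply/andP; split; lra.
have : `|y - y0| <= t by rewrite ler_norml; apply/andP; split; lra.
lra.
Qed.

Lemma square_boundary z0 t (P : C -> Prop) : 0 < t -> (forall z, t <= cmod (z - z0) ->
    rect (Re z0 - t) (Re z0 + t) (Im z0 - t) (Im z0 + t) z -> P z) ->
  on_boundary (Re z0 - t) (Re z0 + t) (Im z0 - t) (Im z0 + t) P.
Proof.
case: z0 => x0 y0 /= t0 H; split=> [x|y] /andP[h1 h2]; split; apply: H;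
  try (by split; apply/andP; split => /=; lra).
- by apply: le_trans _ (normIm_le _); rewrite /= ler_normr; apply/orP; right; lra.
- by apply: le_trans _ (normIm_le _); rewrite /= ler_normr; apply/orP; left; lra.
- by apply: le_trans _ (normRe_le _); rewrite /= ler_normr; apply/orP; right; lra.
- by apply: le_trans _ (normRe_le _); rewrite /= ler_normr; apply/orP; left; lra.
Qed.

Definition open_cmod A := forall z, A z -> exists2 r, 0 < r & forall w, cmod (w - z) < r -> A w.

(** By injectivity |g - g(z0)| has a positive minimum m on the boundary of a small square around z0.
    If w is within m/2 of g(z0) and is not attained there, then |g - w| has no zero, is at least m/2
    on the boundary and smaller at z0, against the minimum principle. *)
Lemma open_mapping A g z0 e : open_cmod A -> (forall z, A z -> derivable g z 1) ->
  (forall z w, A z -> A w -> g z = g w -> z = w) -> A z0 -> 0 < e ->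
  exists2 d, 0 < d & forall w, cmod (w - g z0) < d ->
    exists z, [/\ A z, cmod (z - z0) < e & g z = w].
Proof.
move=> oA dg ig Az0 e0; have [r r0 Hr] := oA z0 Az0.
pose t := Num.min r e / 3; have t0 : 0 < t by rewrite divr_gt0// lt_min r0.
have m3 : Num.min r e = 3 * t by rewrite /t; field.
have tr : 2 * t < r.
  have : Num.min r e <= r by rewrite ge_min lexx.
  by rewrite m3; lra.
have te : 2 * t < e.
  have : Num.min r e <= e by rewrite ge_min lexx orbT.
  by rewrite m3; lra.
set a := Re z0 - t; set b := Re z0 + t; set c := Im z0 - t; set d := Im z0 + t.
have SA z : rect a b c d z -> A z.
  by move=> /square_ball h; apply: Hr; exact: le_lt_trans tr.
have dgw w z : A z -> derivable (fun z => g z - w) z 1.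
  move=> Az; exact: (derivable_sub_fun (dg z Az) (@derivable_cst_fun R w z)).
have ab : a <= b by rewrite /a /b; lra.
have cd : c <= d by rewrite /c /d; lra.
have [m m0 Hm] : exists2 m, 0 < m & on_boundary a b c d (fun z => m <= cmod (g z - g z0)).
  apply: (@boundary_min (fun z => g z - g z0) a b c d ab cd).
    move=> z zr; exact: (derivable_continuous (dgw (g z0) z (SA z zr))).
  apply: square_boundary => // z tz zr; rewrite subr_eq0; apply/eqP => gz.
  by move: tz; rewrite (ig z z0 (SA z zr) Az0 gz) subrr cmod0; lra.
exists (m / 2); first by lra.
move=> w hw; apply: contrapT => nz.
have gzw z : rect a b c d z -> g z - w != 0.
  move=> zr; rewrite subr_eq0; apply/eqP => gz; apply: nz; exists z; split => //.
    exact: SA.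
  by apply: le_lt_trans te; exact: square_ball.
have : m / 2 <= cmod (g z0 - w).
  apply: (@minimum_rect (fun z => g z - w) a b c d z0 (m / 2)) => //.
  - by move=> z zr; exact: (dgw w z (SA z zr)).
  - by rewrite /a /b; apply/andP; split; lra.
  - by rewrite /c /d; apply/andP; split; lra.
  - lra.
  - have H z : m <= cmod (g z - g z0) -> m / 2 <= cmod (g z - w).
      move=> hz; have := cmodD (g z - w) (w - g z0); rewrite addrA subrK; lra.
    by case: Hm => Hh Hv; split=> [x|y] xx;
      [have [? ?] := Hh x xx|have [? ?] := Hv y xx]; split; apply: H.
by rewrite cmodB; lra.
Qed.

Lemma inverse_continuous A B g z0 e : open_cmod A -> conformal_map A B g -> A z0 -> 0 < e ->
  exists2 d, 0 < d & forall z, A z -> cmod (g z - g z0) < d -> cmod (z - z0) < e.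
Proof.
move=> oA [[gAB gi gs] dg] Az0 e0.
have gi' z w : A z -> A w -> g z = g w -> z = w.
  by move=> Az Aw; apply: gi; rewrite inE.
have [d d0 Hd] := open_mapping oA dg gi' Az0 e0; exists d => // z Az /Hd[w [Aw wz gw]].
by rewrite -(gi' _ _ Aw Az gw).
Qed.

(** Compactness of a rectangle, by bisection: constants valid near each point are replaced by one
    constant. *)
Lemma rect_uniform (Q : C -> R -> Prop) a b c d : a <= b -> c <= d ->
  (forall w r r', 0 < r' <= r -> Q w r -> Q w r') ->
  (forall w, rect a b c d w -> exists2 e, 0 < e & exists2 r, 0 < r &
     forall w', rect a b c d w' -> cmod (w' - w) < e -> Q w' r) ->
  exists2 r, 0 < r & forall w, rect a b c d w -> Q w r.
Proof.
move=> ab cd Qm loc; set wd := b - a; set h := d - c.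
have wd0 : 0 <= wd by rewrite subr_ge0.
have h0 : 0 <= h by rewrite subr_ge0.
pose P a' c' s := exists2 r, 0 < r & forall w, rect a b c d w ->
  rect a' (a' + wd * s) c' (c' + h * s) w -> Q w r.
have : P a c 1.
  apply: (@rectangle_bisection R P a c wd h wd0 h0).
    move=> a' c' s s0 [r1 p1 P1] [r2 p2 P2] [r3 p3 P3] [r4 p4 P4].
    exists (Num.min (Num.min r1 r2) (Num.min r3 r4)); first by rewrite !lt_min p1 p2 p3 p4.
    have ew : wd * s = wd * (s / 2) + wd * (s / 2) by field.
    have eh : h * s = h * (s / 2) + h * (s / 2) by field.
    move=> w wr [/andP[x1 x2] /andP[y1 y2]]; rewrite ew addrA in x2; rewrite eh addrA in y2.
    move: x2 y2 P1 P2 P3 P4; set u := wd * (s / 2); set v := h * (s / 2).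
    move=> x2 y2 P1 P2 P3 P4.
    have mn (k : R) : 0 < Num.min (Num.min r1 r2) (Num.min r3 r4) <= k -> Q w k ->
        Q w (Num.min (Num.min r1 r2) (Num.min r3 r4)) by exact: Qm.
    have m0 : 0 < Num.min (Num.min r1 r2) (Num.min r3 r4) by rewrite !lt_min p1 p2 p3 p4.
    have [xl|/ltW xr] := leP (Re w) (a' + u); have [yl|/ltW yr] := leP (Im w) (c' + v).
    - by apply: (mn r1); [rewrite m0 !ge_min lexx|apply: P1 => //; split; rewrite ?x1 ?y1 ?xl].
    - by apply: (mn r3); [rewrite m0 !ge_min lexx !orbT|apply: P3 => //; split; rewrite ?x1 ?yr ?xl].
    - by apply: (mn r2); [rewrite m0 !ge_min lexx !orbT|apply: P2 => //; split; rewrite ?xr ?y1 ?yl].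
    - by apply: (mn r4); [rewrite m0 !ge_min lexx !orbT|apply: P4 => //; split; rewrite ?xr ?yr].
  move=> x y xab ycd; have zr : rect a b c d (x +i* y)%C.
    by split => /=; [move: xab|move: ycd]; rewrite /wd /h !subrKC.
  have [e e0 [r r0 Hr]] := loc _ zr.
  exists (e / (wd + h + 1)); first by rewrite divr_gt0//; lra.
  move=> a' c' s /andP[s0 se] xa yc; exists r => // w wr wr'; apply: Hr => //.
  have k1 : `|Re w - x| <= wd * s.
    case: wr' => /andP[? ?] _; move/andP: xa => [? ?].
    by rewrite ler_norml; apply/andP; split; lra.
  have k2 : `|Im w - y| <= h * s.
    case: wr' => _ /andP[? ?]; move/andP: yc => [? ?].
    by rewrite ler_norml; apply/andP; split; lra.
  have : cmod (w - (x +i* y)%C) <= `|Re w - x| + `|Im w - y|.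
    by apply: le_trans (cmod_le _) _; case: (w).
  have k3 : s * (wd + h + 1) < e by rewrite -ltr_pdivlMr//; lra.
  lra.
move=> [r r0 Hr]; exists r => // w wr; apply: Hr => //.
by rewrite !mulr1 /wd /h !subrKC.
Qed.

End OpenMapping.

(** * Time derivatives *)

Section RealCalculus.
Variable R : realType.
Implicit Types (a b c d e r s t u v x K T : R) (f g F : R -> R).

Lemma is_derive_eps F t l : (forall e, 0 < e -> exists2 d, 0 < d &
    forall h, `|h| < d -> `|F (t + h) - F t - l * h| <= e * `|h|) -> is_derive t 1 F l.
Proof.
move=> H; suff cv : h^-1 *: ((F \o shift t) (h *: 1) - F t) @[h --> 0^'] --> l.
  by apply: DeriveDef; [apply/cvg_ex; exists l|exact: cvg_lim].
apply/cvgrPdist_le => e e0; have [d d0 Hd] := H e e0.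
near=> h; have h0 : h != 0 by near: h; exact: nbhs_dnbhs_neq.
have hd : `|h| < d by near: h; exact: dnbhs0_lt.
have -> : h *: (1 : R) = h by rewrite /GRing.scale/= mulr1.
rewrite /= (addrC h) distrC; have := Hd h hd.
have -> : F (t + h) - F t - l * h = (h^-1 *: (F (t + h) - F t) - l) * h.
  by rewrite mulrBl /GRing.scale/= mulrAC mulVf// mul1r.
by rewrite normrM ler_pM2r// normr_gt0.
Unshelve. all: by end_near. Qed.

Lemma is_derive_mul F g x df dg : is_derive x 1 F df -> is_derive x 1 g dg ->
  is_derive x 1 (fun t => F t * g t) (df * g x + F x * dg).
Proof.
move=> dF dG; have := is_deriveM dF dG; rewrite /GRing.scale/=.
by rewrite addrC [g x * df]mulrC.
Qed.

Lemma is_derive_add F g x df dg : is_derive x 1 F df -> is_derive x 1 g dg ->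
  is_derive x 1 (fun t => F t + g t) (df + dg).
Proof. by move=> dF dG; exact: is_deriveD. Qed.

Lemma is_derive_sub F g x df dg : is_derive x 1 F df -> is_derive x 1 g dg ->
  is_derive x 1 (fun t => F t - g t) (df - dg).
Proof. by move=> dF dG; exact: is_deriveB. Qed.

Lemma is_derive_inv F x df : F x != 0 -> is_derive x 1 F df ->
  is_derive x 1 (fun t => (F t)^-1) (- (df / F x ^+ 2)).
Proof.
move=> Fx dF; have := @is_deriveV R F x df 1 Fx dF.
by rewrite /GRing.scale/= mulNr mulrC.
Qed.

Lemma is_derive_chain F g x df dg : is_derive x 1 g dg -> is_derive (g x) 1 F df ->
  is_derive x 1 (fun t => F (g t)) (df * dg).
Proof. by move=> dG dF; have := @is_derive1_comp _ F g x _ _ dF dG; rewrite mulrC. Qed.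

Lemma is_derive_eqv F x df dg : is_derive x 1 F df -> df = dg -> is_derive x 1 F dg.
Proof. by move=> ? <-. Qed.

Lemma derive_lipschitz F df a b K : {within `[a, b], continuous F} ->
  (forall x, a < x < b -> is_derive x 1 F (df x)) -> (forall x, a < x < b -> `|df x| <= K) ->
  forall u v, a <= u <= b -> a <= v <= b -> `|F v - F u| <= K * `|v - u|.
Proof.
move=> cF dF bF.
have W u v : a <= u -> u < v -> v <= b -> `|F v - F u| <= K * `|v - u|.
  move=> au uv vb; have [x|c|] := @MVT _ F df u v uv.
  - by rewrite in_itv/= => /andP[? ?]; apply: dF; apply/andP; split; lra.
  - have sub : `[u, v]%classic `<=` `[a, b]%classic.
      by move=> x /=; rewrite !in_itv/= => /andP[? ?]; apply/andP; split; lra.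
    exact: (continuous_subspaceW sub cF).
  move=> c; rewrite in_itv/= => /andP[? ?] ->; rewrite normrM ler_wpM2r//.
  by apply: bF; apply/andP; split; lra.
move=> u v /andP[au ub] /andP[av vb]; have [uv|vu|->] := ltgtP u v.
- exact: W.
- by rewrite distrC (distrC v); exact: W.
- by rewrite !subrr normr0 mulr0.
Qed.

Lemma ge0_derive_le F df a b : a <= b -> {within `[a, b], continuous F} ->
  (forall x, a < x < b -> is_derive x 1 F (df x)) -> (forall x, a < x < b -> 0 <= df x) ->
  F a <= F b.
Proof.
move=> ab cF dF F0; apply: (@ger0_derive1_ndecr _ F a b) => // x;
  rewrite in_itv/= => xab; have h := dF x xab; first exact: ex_derive.
by rewrite derive1E derive_val; exact: F0.
Qed.

Lemma within_mul F g a b : {within `[a, b], continuous F} -> {within `[a, b], continuous g} ->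
  {within `[a, b], continuous (fun x => F x * g x)}.
Proof. by move=> cF cg x; apply: continuousM; [exact: cF|exact: cg]. Qed.

Lemma within_sub F g a b : {within `[a, b], continuous F} -> {within `[a, b], continuous g} ->
  {within `[a, b], continuous (fun x => F x - g x)}.
Proof. by move=> cF cg x; apply: continuousB; [exact: cF|exact: cg]. Qed.

Lemma within_add F g a b : {within `[a, b], continuous F} -> {within `[a, b], continuous g} ->
  {within `[a, b], continuous (fun x => F x + g x)}.
Proof. by move=> cF cg x; apply: continuousD; [exact: cF|exact: cg]. Qed.

(** The product F(x) exp(C x) is nondecreasing. *)
Lemma exp_gronwall F df C s : 0 <= s -> {within `[0, s], continuous F} ->
  (forall x, 0 < x < s -> is_derive x 1 F (df x)) ->
  (forall x, 0 < x < s -> - (C * F x) <= df x) ->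
  F 0 * expR (- (C * s)) <= F s.
Proof.
move=> s0 cF dF H.
have dE x : is_derive x 1 (fun x => expR (C * x)) (expR (C * x) * C).
  have dl : is_derive x 1 (fun x : R => C * x) C.
    apply: is_derive_eqv (is_derive_mul (is_derive_cst C x 1) (is_derive_id x 1)) _.
    by rewrite mul0r add0r mulr1.
  exact: (is_derive_chain dl (is_derive_expR (C * x))).
have cE : {within `[0, s], continuous (fun x => expR (C * x))}.
  by apply: derivable_within_continuous => x _; have [] := dE x.
have le : F 0 * expR (C * 0) <= F s * expR (C * s).
  apply: (@ge0_derive_le (fun x => F x * expR (C * x))
    (fun x => df x * expR (C * x) + F x * (expR (C * x) * C)) 0 s s0).
  - exact: (within_mul cF cE).
  - by move=> x xs; exact: (is_derive_mul (dF x xs) (dE x)).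
  - move=> x xs; have := H x xs; have := expR_gt0 (C * x); set E := expR _ => E0 h.
    have : 0 <= E * (df x + C * F x) by rewrite mulr_ge0//; lra.
    lra.
rewrite mulr0 expR0 mulr1 in le.
by rewrite expRN ler_pdivrMr// expR_gt0.
Qed.

(** Each F(t) - K (T - t) lies below each F(u) + K (T - u), so the supremum of the former serves as
    the limit at T. *)
Lemma lipschitz_limit F K T : 0 < T -> 0 <= K ->
  (forall u v, 0 <= u < T -> 0 <= v < T -> `|F v - F u| <= K * `|v - u|) ->
  exists l, forall t, 0 <= t < T -> `|F t - l| <= K * (T - t).
Proof.
move=> T0 K0 HF; pose S := [set F t - K * (T - t) | t in [set t | 0 <= t < T]].
have ub u t : 0 <= u < T -> 0 <= t < T -> F u - K * (T - u) <= F t + K * (T - t).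
  move=> ut tt; have := HF t u tt ut; rewrite ler_norml => /andP[_ h].
  have [tu|ut'] := leP t u.
    rewrite ger0_norm ?subr_ge0// in h.
    have : 0 <= K * (T - u) by rewrite mulr_ge0// subr_ge0 ltW//; case/andP: ut.
    lra.
  rewrite ltr0_norm ?subr_lt0// in h.
  have : 0 <= K * (T - t) by rewrite mulr_ge0// subr_ge0 ltW//; case/andP: tt.
  lra.
exists (sup S) => t tt.
have h1 : sup S <= F t + K * (T - t).
  apply: ge_sup; first by exists (F t - K * (T - t)), t.
  by move=> _ [u uu <-]; exact: ub.
have h2 : F t - K * (T - t) <= sup S.
  apply: ub_le_sup; last by exists t.
  by exists (F t + K * (T - t)) => _ [u uu <-]; exact: ub.
by rewrite ler_norml; apply/andP; split; move: h1 h2; set l := sup S; lra.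
Qed.

End RealCalculus.

(** * Trajectories in the plane and their coordinates *)

Section TimeDerivative.
Variable R : realType.
Local Notation C := (R[i]^o).
Local Notation Re := (@complex.Re R).
Local Notation Im := (@complex.Im R).
Implicit Types (a b c d e h s t u v x K T : R) (f g : R -> C).

Lemma time_derive_eps f t (v : C) : is_time_derive f t v -> forall e, 0 < e ->
  exists2 d, 0 < d & forall h, `|h| < d -> 0 <= t + h ->
    cmod (f (t + h) - f t - v * (h%:C)%C) <= e * `|h|.
Proof.
move=> Hf e e0.
have : nbhs v [set w : C | cmod (w - v) < e] by apply/nbhs_cmodP; exists e.
move=> /Hf; rewrite /= /within/= => -[d /= d0 Hd]; exists d => // h hd th.
have [->|h0] := eqVneq h 0.
  by rewrite addr0 subrr mulr0 subr0 cmod0 normr0 mulr0.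
have := Hd h; rewrite /= sub0r normrN => /(_ hd h0 th) hh.
have hC : (h%:C)%C != 0 :> C by rewrite -cmod_gt0 cmod_real normr_gt0.
have -> : f (t + h) - f t - v * (h%:C)%C = ((h%:C)%C^-1 * (f (t + h) - f t) - v) * (h%:C)%C.
  by field.
by rewrite cmodM cmod_real ler_wpM2r// ltW.
Qed.

(** The common properties of [Re] and [Im], so that each statement about coordinates is proved
    once. *)
Definition real_part_like (L : C -> R) :=
  (forall z w, L (z - w) = L z - L w) /\ (forall z r, L (z * (r%:C)%C) = L z * r) /\
  (forall z, `|L z| <= cmod z).

Lemma Re_real_part : real_part_like Re.
Proof. by split=> [[? ?] [? ?]//|]; split; [case=> ? ? r /=; ring|exact: normRe_le]. Qed.

Lemma Im_real_part : real_part_like Im.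
Proof. by split=> [[? ?] [? ?]//|]; split; [case=> ? ? r /=; ring|exact: normIm_le]. Qed.

Lemma time_derive_is_derive L f t (v : C) : real_part_like L -> 0 < t -> is_time_derive f t v ->
  is_derive t 1 (fun s => L (f s)) (L v).
Proof.
move=> [LB [LM Ln]] t0 /time_derive_eps H; apply: is_derive_eps => e e0.
have [d d0 Hd] := H e e0; exists (Num.min d t); first by rewrite lt_min d0.
move=> h; rewrite lt_min => /andP[hd ht]; rewrite -LB -LM -LB.
apply: le_trans (Ln _) (Hd h hd _).
by move: ht; rewrite ltr_norml => /andP[]; lra.
Qed.

Lemma time_derive_near f t (v : C) : is_time_derive f t v -> forall e, 0 < e ->
  exists2 d, 0 < d & forall s, `|s - t| < d -> 0 <= s -> cmod (f s - f t) < e.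
Proof.
move=> /time_derive_eps/(_ 1 ltr01)[d d0 Hd] e e0.
have v0 := cmod_ge0 v; have k0 : 0 < 2 + cmod v by lra.
exists (Num.min d (e / (2 + cmod v))); first by rewrite lt_min d0 divr_gt0.
move=> s; rewrite lt_min => /andP[sd se] s0; have := Hd (s - t) sd.
rewrite subrKC => /(_ s0); set D := cmod (_ - _ - _) => hD.
have := cmodD (f s - f t - v * ((s - t)%:C)%C) (v * ((s - t)%:C)%C).
rewrite subrK cmodM cmod_real -/D => h.
have : `|s - t| * (2 + cmod v) < e by rewrite -ltr_pdivlMr.
have := normr_ge0 (s - t); lra.
Qed.

Lemma time_derive_within L f (v : R -> C) s : real_part_like L ->
  (forall t, 0 <= t <= s -> is_time_derive f t (v t)) ->
  {within `[0, s], continuous (fun t => L (f t))}.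
Proof.
move=> [LB [LM Ln]] H; apply/subspace_continuousP => x; rewrite /= in_itv/= => xs.
apply/cvgrPdist_lt => e e0; have [d d0 Hd] := time_derive_near (H x xs) e0.
rewrite near_withinE; near=> y; rewrite /= in_itv/= => /andP[y0 ys].
rewrite -LB; apply: le_lt_trans (Ln _) _; rewrite cmodB; apply: Hd => //.
Unshelve. all: by end_near. Qed.

(* Two trajectories of a Lipschitz field do not merge. *)
Lemma trajectories_apart f g (v w : R -> C) K s : 0 <= s ->
  (forall t, 0 <= t <= s -> is_time_derive f t (v t)) ->
  (forall t, 0 <= t <= s -> is_time_derive g t (w t)) ->
  (forall t, 0 <= t <= s -> cmod (v t - w t) <= K * cmod (f t - g t)) ->
  cmod (f 0 - g 0) ^+ 2 * expR (- (2 * K * s)) <= cmod (f s - g s) ^+ 2.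
Proof.
move=> s0 Hf Hg HK.
pose A t := Re (f t) - Re (g t); pose B t := Im (f t) - Im (g t).
have E t : cmod (f t - g t) ^+ 2 = A t * A t + B t * B t.
  by rewrite cmod_sqr !expr2 /A /B; case: (f t) (g t) => ? ? [].
have cA : {within `[0, s], continuous A}.
  exact: (within_sub (time_derive_within Re_real_part Hf) (time_derive_within Re_real_part Hg)).
have cB : {within `[0, s], continuous B}.
  exact: (within_sub (time_derive_within Im_real_part Hf) (time_derive_within Im_real_part Hg)).
have dA x : 0 < x < s -> is_derive x 1 A (Re (v x) - Re (w x)).
  move=> /andP[x0 xs]; have xx : 0 <= x <= s by rewrite !ltW.
  exact: (is_derive_sub (time_derive_is_derive Re_real_part x0 (Hf x xx))
    (time_derive_is_derive Re_real_part x0 (Hg x xx))).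
have dB x : 0 < x < s -> is_derive x 1 B (Im (v x) - Im (w x)).
  move=> /andP[x0 xs]; have xx : 0 <= x <= s by rewrite !ltW.
  exact: (is_derive_sub (time_derive_is_derive Im_real_part x0 (Hf x xx))
    (time_derive_is_derive Im_real_part x0 (Hg x xx))).
rewrite !E; apply: (@exp_gronwall R (fun t => A t * A t + B t * B t)
  (fun x => ((Re (v x) - Re (w x)) * A x + A x * (Re (v x) - Re (w x))) +
            ((Im (v x) - Im (w x)) * B x + B x * (Im (v x) - Im (w x)))) (2 * K) s s0).
- exact: (within_add (within_mul cA cA) (within_mul cB cB)).
- by move=> x xs; exact: (is_derive_add (is_derive_mul (dA x xs) (dA x xs)) (is_derive_mul (dB x xs) (dB x xs))).
- move=> x /andP[x0 xs]; have xx : 0 <= x <= s by rewrite !ltW.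
  set a := Re (v x) - _; set b := Im (v x) - _.
  have hab : cmod (v x - w x) ^+ 2 = a * a + b * b.
    by rewrite cmod_sqr !expr2 /a /b; case: (v x) (w x) => ? ? [].
  have cs : `|a * A x + b * B x| <= cmod (v x - w x) * cmod (f x - g x).
    rewrite -(@ler_pXn2r _ 2) ?nnegrE ?mulr_ge0 ?cmod_ge0// real_normK ?num_real//.
    rewrite exprMn hab E -subr_ge0.
    have -> : (a * a + b * b) * (A x * A x + B x * B x) - (a * A x + b * B x) ^+ 2 =
      (a * B x - b * A x) ^+ 2 by ring.
    exact: sqr_ge0.
  have : cmod (v x - w x) * cmod (f x - g x) <= K * (A x * A x + B x * B x).
    by rewrite -E expr2 mulrA ler_wpM2r ?cmod_ge0//; exact: HK.
  move: cs; rewrite ler_norml => /andP[? ?]; lra.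
Qed.

End TimeDerivative.

(** * Conformal automorphisms of the disk and the half-plane *)

Section Automorphisms.
Variable R : realType.
Local Notation C := (R[i]^o).
Local Notation Re := (@complex.Re R).
Local Notation Im := (@complex.Im R).
Local Notation H := (@upper_half_plane R).
Local Notation D := (@odisk R 1).
Implicit Types (a b c d e m x y r s L M : R) (z w p : C) (f g : C -> C).

Lemma open_H : open_cmod H.
Proof.
move=> z Hz; exists (Im z) => // w wz; rewrite /upper_half_plane/=.
have := ImlipB w z; rewrite ler_norml => /andP[? ?]; lra.
Qed.

Lemma open_D : open_cmod D.
Proof.
move=> z; rewrite /odisk/= => Dz; exists (1 - cmod z); first by lra.
by move=> w wz; rewrite /odisk/=; have := cmod_rev w z; lra.
Qed.

Lemma cmod_sub_i z : cmod (z - 'i%C) ^+ 2 = cmod (z + 'i%C) ^+ 2 - 4 * Im z.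
Proof. rewrite !cmod_sqr; case: z => u v /=; ring. Qed.

Lemma H_plus_i z : 0 < Im z -> Im z + 1 <= cmod (z + 'i%C).
Proof. by move=> z0; apply: le_trans (Im_le_cmod _); case: z z0 => u v /=; lra. Qed.

Lemma rect_H L e (z : C) : 0 < e -> rect (- L) L e L z -> H z.
Proof. by move=> e0 [_ /andP[? _]]; rewrite /upper_half_plane/=; lra. Qed.

(* A function on the disk is read in the half-plane through the Cayley transform. *)
Lemma maximum_disk f : (forall z, D z -> {for z, continuous f}) ->
  (forall z, D z -> z != 0 -> derivable f z 1) ->
  (forall e, 0 < e -> exists2 r, 0 < r & forall z, D z -> 1 - r < cmod z -> cmod (f z) <= 1 + e) ->
  forall z, D z -> cmod (f z) <= 1.
Proof.
move=> cf df bf z0 Dz0; apply/ler_addgt0Pr => e e0.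
have [r' r'0 Hr'] := bf e e0.
pose r := Num.min r' 1; have r0 : 0 < r by rewrite lt_min r'0 ltr01.
have r1 : r <= 1 by rewrite ge_min lexx orbT.
have Hr z : D z -> 1 - r < cmod z -> cmod (f z) <= 1 + e.
  have : r <= r' by rewrite ge_min lexx.
  by move=> rr Dz h; apply: Hr' => //; lra.
have z01 : 1 - z0 != 0.
  rewrite subr_eq0; apply/eqP => z1; move: Dz0.
  by rewrite /odisk/= -z1 cmod1 ltxx.
(* The Cayley transform sends the half-plane to the disk and i to 0, and [w0] is the point it sends
   to [z0]. *)
pose cay z : C := (z - 'i%C) / (z + 'i%C).
pose w0 : C := 'i%C * (1 + z0) / (1 - z0).
have i2 : ('i%C : C) * 'i%C = -1 by rewrite -expr2 sqr_i.
have i0 : ('i%C : C) != 0 by rewrite -cmod_gt0 cmod_i ltr01.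
have t0 : (2 : C) != 0 by rewrite pnatr_eq0.
have wpiE : w0 + 'i%C = 2 * 'i%C / (1 - z0) by rewrite /w0; field.
have wmiE : w0 - 'i%C = z0 * (2 * 'i%C / (1 - z0)) by rewrite /w0; field.
have wpi : w0 + 'i%C != 0 by rewrite wpiE mulf_neq0 ?invr_eq0// mulf_neq0.
have cw0 : cay w0 = z0 by rewrite /cay wmiE -wpiE mulfK.
have Hw0 : 0 < Im w0.
  have p0 : 0 < cmod (w0 + 'i%C) by rewrite cmod_gt0.
  have : cmod (w0 - 'i%C) ^+ 2 < cmod (w0 + 'i%C) ^+ 2.
    rewrite ltr_pXn2r ?nnegrE ?cmod_ge0// wmiE -wpiE cmodM.
    by rewrite -[ltRHS]mul1r ltr_pM2r.
  by rewrite cmod_sub_i; lra.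
have cayH z : 0 < Im z -> [/\ z + 'i%C != 0, D (cay z) & 1 - cmod (cay z) ^+ 2 = 4 * Im z / cmod (z + 'i%C) ^+ 2].
  move=> z_0; have p := H_plus_i z_0; have p0 : 0 < cmod (z + 'i%C) by lra.
  have E : 1 - cmod (cay z) ^+ 2 = 4 * Im z / cmod (z + 'i%C) ^+ 2.
    by rewrite /cay cmodM cmodV exprMn cmod_sub_i exprVn; field; rewrite lt0r_neq0.
  split => //; first by rewrite -cmod_gt0.
  rewrite /odisk/= -(@ltr_pXn2r _ 2) ?nnegrE ?cmod_ge0// expr1n -subr_gt0 E.
  by rewrite divr_gt0 ?exprn_gt0// mulr_gt0.
have edge z : 0 < Im z -> 4 * Im z < r * cmod (z + 'i%C) ^+ 2 -> cmod (f (cay z)) <= 1 + e.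
  move=> zp h; have [zi Dz E] := cayH z zp; apply: Hr => //.
  have p0 : 0 < cmod (z + 'i%C) ^+ 2 by rewrite exprn_gt0// cmod_gt0.
  have : 1 - cmod (cay z) ^+ 2 < r by rewrite E ltr_pdivrMr.
  move=> h1; rewrite ltNge; apply/negP => h2.
  have : cmod (cay z) * cmod (cay z) <= 1 * (1 - r).
    by apply: ler_pM; rewrite ?cmod_ge0//; lra.
  rewrite -expr2; lra.
(* Since 1 - |cay z|^2 = 4 Im z / |z + i|^2, the image is near the circle if z is low or far away:
   the bottom of the rectangle has height [de] and its other sides are at distance at least [L] from
   -i. *)
pose L := 4 / r + cmod w0 + 1; pose de := Num.min (r / 8) (Im w0 / 2).
have r4 : 0 < 4 / r by rewrite divr_gt0.
have de0 : 0 < de by rewrite lt_min !divr_gt0.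
have de1 : de <= r / 8 by rewrite ge_min lexx.
have de2 : de <= Im w0 / 2 by rewrite ge_min lexx orbT.
have [nR nI] := (normRe_le w0, normIm_le w0).
have far z : 0 < Im z -> L <= cmod (z + 'i%C) -> cmod (f (cay z)) <= 1 + e.
  move=> z_0 h; apply: edge => //; have p := H_plus_i z_0.
  have p0 : 0 < cmod (z + 'i%C) by lra.
  rewrite expr2 mulrA; apply: (@le_lt_trans _ _ (4 * cmod (z + 'i%C))); first lra.
  rewrite ltr_pM2r// mulrC -ltr_pdivrMr//; apply: lt_le_trans h.
  by rewrite /L; have := cmod_ge0 w0; lra.
rewrite -cw0; apply: (@maximum_rect R (fun z => f (cay z)) (- L) L de L 'i%C w0 (1 + e)).
- move=> z /(rect_H de0) Hz; have [zi Dz _] := cayH z Hz.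
  have c1 := continuous_sub_fun (@continuous_id_fun R z) (@continuous_cst_fun R 'i%C z).
  have c2 := continuous_add_fun (@continuous_id_fun R z) (@continuous_cst_fun R 'i%C z).
  have c3 := @continuous_inv_fun R (fun z => z + 'i%C) z zi c2.
  exact: (@continuous_comp_fun R cay f z (continuous_mul_fun c1 c3) (cf _ Dz)).
- move=> z /(rect_H de0) Hz zni; have [zi Dz _] := cayH z Hz.
  have c1 := derivable_sub_fun (@derivable_id_fun R z) (@derivable_cst_fun R 'i%C z).
  have c2 := derivable_add_fun (@derivable_id_fun R z) (@derivable_cst_fun R 'i%C z).
  have c3 := @derivable_inv_fun R (fun z => z + 'i%C) z zi c2.
  have cz : cay z != 0 by rewrite mulf_neq0 ?invr_eq0// subr_eq0.
  exact: (@derivable_comp_fun R cay f z (derivable_mul_fun c1 c3) (df _ Dz cz)).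
- by move: nR; rewrite ler_norml /L => /andP[? ?]; apply/andP; split; lra.
- by move: nI; rewrite ler_norml /L => /andP[? ?]; apply/andP; split; lra.
- lra.
have Rpi x y : Re ((x +i* y)%C + 'i%C : C) = x by rewrite /= addr0.
have Lx x y : L <= `|x| -> L <= cmod ((x +i* y)%C + 'i%C : C).
  by move=> h; apply: le_trans h _; rewrite -{1}(Rpi x y) normRe_le.
have L0 : 0 < L by rewrite /L; have := cmod_ge0 w0; lra.
split=> [x|y] hxy; split.
- apply: edge => /=; first exact: de0.
  have := @H_plus_i (x +i* de)%C de0; rewrite /= => h.
  have : 1 <= cmod ((x +i* de)%C + 'i%C : C) ^+ 2 by rewrite expr_ge1 ?cmod_ge0//; lra.
  by move=> h1; have := ler_wpM2l (ltW r0) h1; lra.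
- apply: far => /=; first exact: L0.
  by have := @H_plus_i (x +i* L)%C L0; rewrite /=; lra.
- apply: far => /=; first by lra.
  by apply: Lx; rewrite normrN ler_norm.
- apply: far => /=; first by lra.
  by apply: Lx; rewrite ler_norm.
Qed.

(** The inverse is continuous, so by compactness the preimage of the closed disk of radius 1 - e
    stays at a positive distance from the circle. Around points of modulus at least 1 the claim is
    vacuous. *)
Lemma conformal_disk_proper g e : conformal_map D D g -> 0 < e ->
  exists2 r, 0 < r & forall z, D z -> 1 - r < cmod z -> 1 - e < cmod (g z).
Proof.
move=> cg e0; pose Q (w : C) (r : R) := cmod w <= 1 - e -> forall z, D z -> g z = w -> cmod z <= 1 - r.
have [||||r r0 Hr] := @rect_uniform R Q (-1) 1 (-1) 1.
- lra.
- lra.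
- by move=> w r r' /andP[_ rr] h we z Dz gz; have := h we z Dz gz; lra.
- move=> w _; have [w1|w1] := ltP (cmod w) 1.
    have [[_ _ gs] _] := cg; have [z0 Dz0 gz0] := gs w w1.
    have Dz1 : cmod z0 < 1 by [].
    have r0 : 0 < (1 - cmod z0) / 2 by lra.
    have [d d0 Hd] := inverse_continuous open_D cg Dz0 r0.
    exists d => //; exists ((1 - cmod z0) / 2) => // w' _ ww _ z Dz gz.
    have := Hd z Dz; rewrite gz gz0 => /(_ ww) h; have := cmod_rev z z0; lra.
  exists e => //; exists 1 => // w' _ ww w'e.
  by have := cmod_rev w w'; rewrite cmodB; lra.
exists r => // z Dz rz; rewrite ltNge; apply/negP => ge.
have gD : cmod (g z) < 1 by have [[gf _ _] _] := cg; exact: (gf z Dz).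
have gr : rect (-1) 1 (-1) 1 (g z).
  have := normRe_le (g z); have := normIm_le (g z).
  rewrite !ler_norml => /andP[? ?] /andP[? ?].
  by split; apply/andP; split; lra.
by have := Hr (g z) gr ge z Dz erefl; lra.
Qed.

(* Schwarz lemma applied to [g z / z] and to [z / g z]. *)
Theorem conformal_disk_modulus g z : conformal_map D D g -> g 0 = 0 -> 0 < derive1 g 0 ->
  D z -> cmod (g z) = cmod z.
Proof.
move=> cg g0 g'0 Dz; have [[gf gi gs] dg] := cg.
have D0 : D 0 by rewrite /odisk/= cmod0 ltr01.
(* [phi] is g(w) / w with the singularity at 0 removed; the positive derivative makes its value
   there nonzero. *)
have [phi [cphi phi0 phiE]] := derivable_slope (dg 0 D0).
have {}phiE w : g w = phi w * w by have := phiE w; rewrite g0 !subr0.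
have phi00 : phi 0 != 0 by rewrite phi0 -derive1E lt0r_neq0.
have gn0 w : D w -> w != 0 -> g w != 0.
  by move=> Dw; apply: contra_neq => gw; apply: (gi w 0); rewrite ?inE// g0.
have phin w : D w -> phi w != 0.
  move=> Dw; have [->//|w0] := eqVneq w 0; have := gn0 w Dw w0.
  by rewrite phiE mulf_eq0 (negPf w0) orbF.
have dphi w : D w -> w != 0 -> derivable phi w 1.
  move=> Dw w0; have r0 : 0 < cmod w by rewrite cmod_gt0.
  have E v : cmod (v - w) < cmod w -> g v * v^-1 = phi v.
    move=> vw; rewrite phiE mulfK//; apply: contraTneq vw => ->.
    by rewrite sub0r cmodN ltxx.
  exact: (cmod_near_derivable r0 E (derivable_mul_fun (dg w Dw) (@derivable_inv_fun R (fun v => v) w w0 (@derivable_id_fun R w)))).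
have cphi' w : D w -> {for w, continuous phi}.
  by move=> Dw; have [->|w0] := eqVneq w 0; [exact: cphi|exact: (derivable_continuous (dphi w Dw w0))].
have up : cmod (phi z) <= 1.
  apply: (maximum_disk cphi' dphi _ Dz) => e e0.
  (* This makes |w| > 1 / (1 + e), whence |phi(w)| = |g(w)| / |w| < 1 + e. *)
  exists (e / (1 + e)); first by rewrite divr_gt0//; lra.
  move=> w Dw wr; have e1 : 0 < 1 + e by lra.
  have eE : 1 - e / (1 + e) = (1 + e)^-1 by field; rewrite lt0r_neq0.
  have r1 : (1 + e)^-1 < cmod w by rewrite -eE.
  have w0 : 0 < cmod w by apply: lt_trans r1; rewrite invr_gt0.
  have : cmod (phi w) * cmod w < 1 by rewrite -cmodM -phiE; exact: gf.
  rewrite -ltr_pdivlMr// div1r => h; apply/ltW; apply: lt_le_trans h _.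
  by rewrite -[leRHS]invrK lef_pV2 ?posrE ?invr_gt0// ltW.
have lo : cmod (phi z)^-1 <= 1.
  apply: (@maximum_disk (fun w => (phi w)^-1) _ _ _ z Dz).
  - move=> w Dw; exact: (continuous_inv_fun (phin w Dw) (cphi' w Dw)).
  - move=> w Dw w0; exact: (derivable_inv_fun (phin w Dw) (dphi w Dw w0)).
  move=> e e0; have e1 : 0 < 1 + e by lra.
  have [|r r0 Hr] := @conformal_disk_proper g (e / (1 + e)) cg; first by rewrite divr_gt0.
  exists (Num.min r (2^-1)); first by rewrite lt_min r0/=; lra.
  move=> w Dw wr; have wr1 : 1 - r < cmod w.
    by apply: le_lt_trans wr; rewrite lerD2l lerN2 ge_min lexx.
  have w0 : 0 < cmod w.
    have : Num.min r (2^-1) <= 2^-1 by rewrite ge_min lexx orbT.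
    by lra.
  have r1 : (1 + e)^-1 < cmod (g w).
    have eE : 1 - e / (1 + e) = (1 + e)^-1 by field; rewrite lt0r_neq0.
    by rewrite -eE; exact: Hr.
  have p0 : 0 < cmod (phi w) by rewrite cmod_gt0; exact: phin.
  have : (1 + e)^-1 < cmod (phi w).
    apply: lt_le_trans r1 _; rewrite phiE cmodM ler_piMr ?cmod_ge0//.
    exact: ltW Dw.
  move=> h; rewrite cmodV -[leRHS]invrK lef_pV2 ?posrE ?invr_gt0//.
  exact: ltW.
have p0 : 0 < cmod (phi z) by rewrite cmod_gt0; exact: phin.
have phi1 : cmod (phi z) = 1.
  apply/eqP; rewrite eq_le up/=; move: lo; rewrite cmodV.
  by rewrite -{1}invr1 lef_pV2 ?posrE// invr1.
by rewrite phiE cmodM phi1 mul1r.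
Qed.

End Automorphisms.

(** * Automorphisms of the half-plane asymptotic to the identity *)

Section HalfPlane.
Variable R : realType.
Local Notation C := (R[i]^o).
Local Notation Re := (@complex.Re R).
Local Notation Im := (@complex.Im R).
Local Notation H := (@upper_half_plane R).
Local Notation D := (@odisk R 1).
Implicit Types (a b c d e m x y r s L M : R) (z w p : C) (f g : C -> C).


Lemma cmod_lip z w : `|cmod z - cmod w| <= cmod (z - w).
Proof.
have := cmod_rev z w; have := cmod_rev w z; rewrite (cmodB w) => ? ?.
by rewrite ler_norml; apply/andP; split; lra.
Qed.

Section Identity.
Variable g : C -> C.
Hypothesis cg : conformal_map H H g.
Hypothesis g_oo : forall e, 0 < e -> exists2 K, 0 <= K &
  forall z, H z -> K < cmod z -> cmod (g z - z) < e.

Let dg z : H z -> derivable g z 1. Proof. by case: cg => _; apply. Qed.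
Let gH z : H z -> H (g z). Proof. by case: cg => -[gf _ _] _ Hz; exact: (gf z Hz). Qed.
Let gs w : H w -> exists2 z, H z & g z = w. Proof. by case: cg => -[_ _ gs] _ /gs. Qed.
Let gi z w : H z -> H w -> g z = g w -> z = w.
Proof. by case: cg => -[_ gi _] _ Hz Hw; apply: gi; rewrite inE. Qed.

Lemma boundary_far L e (P : C -> Prop) : 0 < e -> e <= L ->
  (forall z, rect (- L) L e L z -> L <= cmod z -> P z) ->
  (forall x, - L <= x <= L -> P (x +i* e)%C) -> on_boundary (- L) L e L P.
Proof.
move=> e0 eL far bot; split=> [x xL|y yL]; split.
- exact: bot.
- apply: far; first by split=> //=; apply/andP; split; lra.
  by apply: le_trans _ (normIm_le _); rewrite /= ler_normr; apply/orP; left; lra.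
- apply: far; first by split=> //=; apply/andP; split; lra.
  by apply: le_trans _ (normRe_le _); rewrite /= ler_normr; apply/orP; right; lra.
- apply: far; first by split=> //=; apply/andP; split; lra.
  by apply: le_trans _ (normRe_le _); rewrite /= ler_normr; apply/orP; left; lra.
Qed.

(** The maximum principle for Im (z - g(z)): it is small far away, and on a low horizontal line it
    is at most the height because g takes values in the half-plane. *)
Lemma Im_le_image z0 : H z0 -> Im z0 <= Im (g z0).
Proof.
move=> Hz0; have z00 : 0 < Im z0 by []. apply/ler_addgt0Pr => e e0.
have [K K0 HK] := g_oo e0.
pose L := K + cmod z0 + 1 + e; pose d := Num.min e (Im z0 / 2).
have d0 : 0 < d by rewrite lt_min e0 divr_gt0.
have de : d <= e by rewrite ge_min lexx.
have dz : d <= Im z0 / 2 by rewrite ge_min lexx orbT.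
have c0 := cmod_ge0 z0.
have hr : holo_rect (- L) L d L (fun z => z - g z).
  move=> z /(rect_H d0) Hz.
  exact: (derivable_sub_fun (@derivable_id_fun R z) (dg Hz)).
have := @maximum_rect_Im R _ (- L) L d L z0 e hr.
have := normRe_le z0; rewrite ler_norml => /andP[r1 r2]; have i1 := Im_le_cmod z0.
have -> : - L < Re z0 < L by rewrite /L; apply/andP; split; lra.
have -> : d < Im z0 < L by rewrite /L; apply/andP; split; lra.
move=> /(_ isT isT) h; suff : Im (z0 - g z0) <= e.
  by case: (z0) (g z0) => [? ?] [? ?] /=; lra.
apply: h; apply: boundary_far => //; first by rewrite /L; lra.
  move=> z /(rect_H d0) Hz Lz; apply: le_trans (Im_le_cmod _) _; rewrite cmodB ltW// HK//.
  by rewrite /L in Lz; lra.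
move=> x _; have Hx : H (x +i* d)%C by [].
have : 0 < Im (g (x +i* d)%C) := gH Hx.
by case: (g _) => [? ?] /=; lra.
Qed.

(** This bounds g on bounded sets, which asymptotics alone do not give. If g(z0) is large but |z0|
    <= K, the preimages of the points s g(z0), s >= 1, form a path from z0. Their moduli never lie
    in (K, K + 1], because g is close to the identity there, yet they end beyond K: a
    contradiction. *)
Lemma image_far : exists2 K, 0 <= K & forall z, H z -> K + 2 < cmod (g z) -> cmod (g z) < cmod z + 1.
Proof.
have [K K0 HK] := g_oo ltr01; exists K => // z0 Hz0 far.
suff Kz : K < cmod z0 by have := HK _ Hz0 Kz; have := cmod_rev (g z0) z0; lra.
pose w := g z0; have w0 : 0 < Im w := gH Hz0.
pose p s : C := w * (s%:C)%C.
have Imp s : Im (p s) = Im w * s by rewrite /p; case: (w) => ? ? /=; ring.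
have pn s : 0 <= s -> cmod (p s) = cmod w * s by move=> s0; rewrite cmodM cmod_real ger0_norm.
have pH s : 0 < s -> H (p s) by move=> s0; rewrite /upper_half_plane/= Imp mulr_gt0.
have /choice[zeta Hz] : forall s, exists z, 0 < s -> H z /\ g z = p s.
  move=> s; have [s0|s0] := ltP 0 s; last by exists 0.
  by have [z Hz gz] := gs (pH s s0); exists z.
have z1 : zeta 1 = z0.
  have [h1 h2] := Hz 1 ltr01; apply: gi => //; rewrite h2 /p /w.
  by case: (g z0) => ? ? ; congr Complex; ring.
have wK : K + 2 < cmod w by [].
have gap s : 1 <= s -> K < cmod (zeta s) -> K + 1 < cmod (zeta s).
  move=> s1 Ks; have [|h1 h2] := Hz s; first by lra.
  have := HK _ h1 Ks; rewrite h2; have := cmod_rev (p s) (zeta s).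
  have -> : cmod (p s) = cmod w * s by apply: pn; lra.
  have : cmod w * 1 <= cmod w * s by rewrite ler_wpM2l// cmod_ge0.
  lra.
(* At this parameter the point has height more than K + 6, so the square of half-side 2 around it
   lies in the half-plane and outside the disk of radius K. *)
pose S := 1 + (K + 6) / Im w.
have S0 : 0 <= (K + 6) / Im w by rewrite divr_ge0 ?ltW//; lra.
have S1 : 1 <= S by rewrite /S; lra.
have SI : Im (p S) = Im w + K + 6 by rewrite Imp /S mulrDr mulr1 mulrCA divff ?gt_eqF// mulr1 addrA.
have Sfar : K < cmod (zeta S).
  have pS := Im_le_cmod (p S).
  have sq z : rect (Re (p S) - 2) (Re (p S) + 2) (Im (p S) - 2) (Im (p S) + 2) z -> H z /\ K < cmod z.
    move=> zr; have := square_ball zr; have := cmod_rev (p S) z; rewrite (cmodB z).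
    by case: zr => _ /andP[i1 _]; rewrite /upper_half_plane/= => ? ?; split; lra.
  have [[z [zr gz]]|no] := pselect (exists z, rect (Re (p S) - 2) (Re (p S) + 2) (Im (p S) - 2) (Im (p S) + 2) z /\ g z = p S).
    have [h1 h2] := sq z zr; suff -> : zeta S = z by [].
    by have [|k1 k2] := Hz S; [lra|apply: gi => //; rewrite k2].
  have cr : rect (Re (p S) - 2) (Re (p S) + 2) (Im (p S) - 2) (Im (p S) + 2) (p S).
    by split; apply/andP; split; lra.
  (* Without a preimage in the square, g - p(S) has no zero there; its modulus is at least 1 on the
     boundary and below 1 at the centre, against the minimum principle. *)
  have [cH cK] := sq _ cr; have := HK _ cH cK.
  suff : 1 <= cmod (g (p S) - p S) by lra.
  apply: (@minimum_rect R (fun z => g z - p S) (Re (p S) - 2) (Re (p S) + 2) (Im (p S) - 2) (Im (p S) + 2)).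
  - move=> z /sq[zH _]; exact: (derivable_sub_fun (dg zH) (@derivable_cst_fun R (p S) z)).
  - by move=> z zr; apply/eqP => /subr0_eq gz; apply: no; exists z.
  - by apply/andP; split; lra.
  - by apply/andP; split; lra.
  - lra.
  - apply: square_boundary => [|z z2 /sq[zH zK]]; first by lra.
    have := HK _ zH zK; have := cmod_rev (z - p S) (z - g z).
    have -> : z - p S - (z - g z) = g z - p S by ring.
    by rewrite (cmodB z (g z)); lra.
rewrite ltNge; apply/negP => z0K.
have cphi : {within `[1, S], continuous (fun s => cmod (zeta s))}.
  apply/subspace_continuousP => x; rewrite /= in_itv/= => /andP[x1 xS].
  apply/cvgrPdist_lt => e e0; have [|h1 h2] := Hz x; first by lra.
  have [d d0 Hd] := inverse_continuous (@open_H R) cg h1 e0.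
  have cw0 := cmod_ge0 w; have cw1 : 0 < cmod w + 1 by lra.
  have dw : 0 < d / (cmod w + 1) by rewrite divr_gt0.
  rewrite near_withinE; near=> y; rewrite /= in_itv/= => /andP[y1 _].
  have [|k1 k2] := Hz y; first by lra.
  have yx : `|x - y| < d / (cmod w + 1) by near: y; exact: (nbhsx_ballx x _ dw).
  have : cmod (zeta y - zeta x) < e.
    apply: Hd => //; rewrite k2 h2 /p -mulrBr -rmorphB cmodM cmod_real ?(distrC y x).
    have n0 := normr_ge0 (x - y).
    move: yx; rewrite ltr_pdivlMr//; apply: le_lt_trans; rewrite [leLHS]mulrC.
    by apply: ler_wpM2l; [exact: n0|rewrite lerDl].
  by apply: le_lt_trans; rewrite cmodB; exact: cmod_lip.
have [|c] := IVT S1 cphi (v := K + 2^-1).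
  have := gap S S1 Sfar => ?; rewrite z1; apply/andP; split.
    by rewrite ge_min; apply/orP; left; lra.
  by rewrite le_max; apply/orP; right; lra.
rewrite in_itv/= => /andP[c1 _] cE; have := gap c c1; rewrite cE => h.
have : K + 1 < K + 2^-1 by apply: h; lra.
lra.
Unshelve. all: by end_near. Qed.

(** The same principle for Im (g(z) - z). On the bottom side g(z) must have height at most e: by
    [image_far] it stays in a bounded region, and the preimages of the part of that region above
    height e are uniformly away from the real axis. *)
Lemma image_le_Im z0 : H z0 -> Im (g z0) <= Im z0.
Proof.
move=> Hz0; have z00 : 0 < Im z0 by []. apply/ler_addgt0Pr => e e0.
have [K K0 HK] := g_oo e0; have [K' K'0 HK'] := image_far.
have c0 := cmod_ge0 z0.
pose L := K + cmod z0 + 1 + e; pose L' := K' + 2 * L + 3.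
have [||||d d0 Hd] := @rect_uniform R (fun w r => forall z, H z -> g z = w -> r <= Im z) (- L') L' e L'.
- by rewrite /L' /L; lra.
- by rewrite /L' /L; lra.
- by move=> w r r' /andP[_ rr] h z Hz gz; exact: le_trans rr (h z Hz gz).
- move=> w /(rect_H e0) Hw; have [z1 Hz1 gz1] := gs Hw; have z10 : 0 < Im z1 by [].
  have h0 : 0 < Im z1 / 2 by lra.
  have [d d0 Hd] := inverse_continuous (@open_H R) cg Hz1 h0.
  exists d => //; exists (Im z1 / 2) => // w' _ ww z Hz gz.
  have := Hd z Hz; rewrite gz gz1 => /(_ ww) h.
  by have := ImlipB z z1; rewrite ler_norml => /andP[? ?]; lra.
pose d' := Num.min (Num.min (d / 2) e) (Im z0 / 2).
have d'0 : 0 < d' by rewrite !lt_min e0 !divr_gt0.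
have d'd : d' <= d / 2 by rewrite !ge_min lexx.
have d'e : d' <= e by rewrite !ge_min lexx orbT.
have d'z : d' <= Im z0 / 2 by rewrite !ge_min lexx !orbT.
have hr : holo_rect (- L) L d' L (fun z => g z - z).
  move=> z /(rect_H d'0) Hz.
  exact: (derivable_sub_fun (dg Hz) (@derivable_id_fun R z)).
have := @maximum_rect_Im R _ (- L) L d' L z0 e hr.
have := normRe_le z0; rewrite ler_norml => /andP[r1 r2]; have i1 := Im_le_cmod z0.
have -> : - L < Re z0 < L by rewrite /L; apply/andP; split; lra.
have -> : d' < Im z0 < L by rewrite /L; apply/andP; split; lra.
move=> /(_ isT isT) h; suff : Im (g z0 - z0) <= e.
  by case: (z0) (g z0) => [? ?] [? ?] /=; lra.
apply: h; apply: boundary_far => //; first by rewrite /L; lra.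
  move=> z /(rect_H d'0) Hz Lz; apply: le_trans (Im_le_cmod _) _; rewrite ltW// HK//.
  by rewrite /L in Lz; lra.
move=> x xL; pose z := (x +i* d')%C : C; have Hz : H z by [].
suff : Im (g z) <= e by rewrite -/z; case: (g z) => [? ?] /=; lra.
rewrite leNgt; apply/negP => ge.
have cz : cmod z <= 2 * L.
  apply: le_trans (cmod_le _) _; rewrite /z/= (gtr0_norm d'0).
  have : `|x| <= L by rewrite ler_norml.
  by rewrite /L; lra.
have gzL : cmod (g z) <= L'.
  have [k|k] := leP (cmod (g z)) (K' + 2); first by rewrite /L' /L; lra.
  by have := HK' z Hz k; rewrite /L'; lra.
have : d <= Im z.
  apply: (Hd (g z)) => //; split.
    by have := normRe_le (g z); rewrite ler_norml => /andP[? ?]; apply/andP; split; lra.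
  by have i2 := Im_le_cmod (g z); apply/andP; split; lra.
by rewrite /z/=; lra.
Qed.

(** Once g preserves heights, g' = 1 by the Cauchy-Riemann equations, so Re g is constant along
    vertical lines, and the constant is read off at infinity. *)
Lemma conformal_half_plane_id z0 : H z0 -> g z0 = z0.
Proof.
have Ik z : H z -> Im (g z) = Im z.
  by move=> Hz; apply/eqP; rewrite eq_le image_le_Im// Im_le_image.
move=> Hz0; have z00 : 0 < Im z0 by [].
pose k y := Re (g (Re z0 +i* y)%C).
have dk y : 0 < y -> is_derive y 1 k 0.
  move=> y0; have Hz : H (Re z0 +i* y)%C by [].
  have := dg Hz; set z := (Re z0 +i* y)%C => /derivable_cmodP[l Hl].
  (* Im ((l - 1) (w - z)) is o(|w - z|); a horizontal and a vertical displacement give the two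
     coordinates of l - 1. *)
  have l1 e : 0 < e -> cmod (l - 1) <= 2 * e.
    move=> e0; have [d d0 Hd] := Hl e e0.
    pose t := Num.min d y / 2; have t0 : 0 < t by rewrite divr_gt0// lt_min d0.
    have [td ty] : t < d /\ t < y by rewrite /t; case: (leP d y) => ? ; split; lra.
    have I0 (w : C) : 0 < Im w -> cmod (w - z) = t -> `|Im ((l - 1) * (w - z))| <= e * t.
      move=> w0 wt; have := Hd w; rewrite wt => /(_ td); apply: le_trans.
      apply: le_trans _ (normIm_le _); rewrite -normrN le_eqVlt; apply/orP; left; apply/eqP; congr `|_|.
      have Hw : H w by []. have := Ik w Hw; have := Ik z Hz.
      by case: (z) (w) (l) (g z) (g w) => [? ?] [? ?] [? ?] [? ?] [? ?] /= -> ->; ring.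
    have h1 : `|Im l| * t <= e * t.
      rewrite -{1}(gtr0_norm t0) -normrM.
      have := I0 ((Re z0 + t) +i* y)%C y0; rewrite /z cmod_horiz addrAC subrr add0r (gtr0_norm t0).
      move=> /(_ erefl); congr (_ <= _); congr `|_|; case: (l) => ? ? /=; ring.
    have h2 : `|Re l - 1| * t <= e * t.
      rewrite -{1}(gtr0_norm t0) -normrM.
      have yt : 0 < y + t by lra.
      have := I0 (Re z0 +i* (y + t))%C yt; rewrite /z cmod_vert addrAC subrr add0r (gtr0_norm t0).
      move=> /(_ erefl); congr (_ <= _); congr `|_|; case: (l) => ? ? /=; ring.
    apply: le_trans (cmod_le _) _; move: h1 h2; rewrite !ler_pM2r//.
    by case: (l) => ? ? /=; rewrite oppr0 addr0; lra.
  have l0 : l = 1.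
    apply/eqP; rewrite -subr_eq0 -cmod_eq0 eq_le cmod_ge0 andbT; apply/ler_addgt0Pr => e e0.
    by rewrite add0r; apply: le_trans (l1 (e / 2) _) _; lra.
  apply: is_derive_eps => e e0; have [d d0 Hd] := Hl e e0; exists d => // h hd.
  have := Hd (Re z0 +i* (y + h))%C; rewrite /z cmod_vert addrAC subrr add0r => /(_ hd).
  apply: le_trans; apply: le_trans _ (normRe_le _); rewrite l0 mul1r /k.
  rewrite le_eqVlt; apply/orP; left; apply/eqP; congr `|_|.
  by case: (g _) (g _) => ? ? [? ?] /=; ring.
suff Rk : Re (g z0) = Re z0 by move: Rk (Ik z0 Hz0); case: (z0) (g z0) => [? ?] [? ?] /= -> ->.
apply/eqP; rewrite -subr_eq0 -normr_eq0 eq_le normr_ge0 andbT; apply/ler_addgt0Pr => e e0.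
rewrite add0r; have [K K0 HK] := g_oo e0; pose Y := Im z0 + K + 1.
have YY : Im z0 <= Y by rewrite /Y; lra.
have ck : {within `[Im z0, Y], continuous k}.
  apply: derivable_within_continuous => x; rewrite in_itv/= => /andP[x0 _].
  have x1 : 0 < x by lra.
  by have h := dk x x1; exact: ex_derive.
have cst : k Y = k (Im z0).
  have := @derive_lipschitz R k (fun=> 0) (Im z0) Y 0 ck.
  have d1 x : Im z0 < x < Y -> is_derive x 1 k 0 by move=> /andP[x0 _]; apply: dk; lra.
  have d2 x : Im z0 < x < Y -> `|0 : R| <= 0 by rewrite normr0.
  move=> /(_ d1 d2 (Im z0) Y); rewrite !lexx YY /= => /(_ isT isT).
  by rewrite mul0r normr_le0 => /eqP/subr0_eq.
have -> : Re (g z0) = k Y by rewrite cst /k; case: (z0).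
have HY : H (Re z0 +i* Y)%C by rewrite /upper_half_plane/=; lra.
have : K < cmod (Re z0 +i* Y : C)%C.
  by apply: lt_le_trans (Im_le_cmod _); rewrite /= /Y; lra.
move=> /(HK _ HY) h; apply: le_trans (ltW h); apply: le_trans _ (normRe_le _).
by rewrite /k; case: (g _) => ? ?.
Qed.

End Identity.
End HalfPlane.

(** * Loewner flow *)

Section Flow.
Variable R : realType.
Implicit Types (W f g N : R -> R).

Lemma abs_continuous_sub W a b c d : a <= c -> d <= b ->
  abs_continuous_on a b W -> abs_continuous_on c d W.
Proof.
move=> ac db H e /H[r r0 Hr]; exists r => // k u v uv; apply: Hr => i.
by have [? [? ?]] := uv i; split; [|split]; lra.
Qed.

Lemma adapted_sub W f a b c d : a <= c -> d <= b -> adapted W a b f -> adapted W c d f.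
Proof.
move=> ac db [K K0 HK]; exists K => // u v /andP[? ?] /andP[? ?].
by apply: HK; apply/andP; split; lra.
Qed.

Lemma within_sub_itv W a b c d : a <= c -> d <= b ->
  {within `[a, b], continuous W} -> {within `[c, d], continuous W}.
Proof.
move=> ac db; apply: continuous_subspaceW => x; rewrite /= !in_itv/= => /andP[? ?].
by apply/andP; split; lra.
Qed.

Lemma continuous_pos_min f s : 0 <= s -> {within `[0, s], continuous f} ->
  (forall t, 0 <= t <= s -> 0 < f t) -> exists2 m, 0 < m & forall t, 0 <= t <= s -> m <= f t.
Proof.
move=> s0 cf f0; have [z zs Hz] := EVT_min s0 cf.
exists (f z); first by apply: f0; move: zs; rewrite in_itv.
by move=> t ts; apply: Hz; rewrite in_itv.
Qed.

Lemma derivable_is_derive1 W x : derivable W x 1 -> is_derive x 1 W (derive1 W x).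
Proof. by move=> dW; rewrite derive1E; exact/derivableP. Qed.

Section Driven.
Variables (W : R -> R) (E T : R).
Hypothesis E0 : 0 <= E.
Hypothesis T0 : 0 < T.
Hypothesis cW : forall s, 0 <= s < T -> {within `[0, s], continuous W}.
Hypothesis acW : forall s, 0 <= s < T -> abs_continuous_on 0 s W.
Hypothesis eW : energy_le W E.

Definition slope_ge f (x b : R) := exists2 df : R, is_derive x 1 f df & b <= df.

Lemma flow_gronwall c f s t : 0 <= c -> 0 <= s -> s <= t -> t < T -> adapted W 0 t f ->
  (forall x, s <= x <= t -> 0 < f x) ->
  (forall x, s < x < t -> derivable W x 1 -> slope_ge f x (- (c * (derive1 W x) ^+ 2 * f x))) ->
  f s * expR (- (c * E)) <= f t.
Proof.
move=> c0 s0 st tT af f0 Hf; have t0T : 0 <= t < T by apply/andP; split; lra.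
apply: (@AC_gronwall R W f c s t E) => //.
- exact: (abs_continuous_sub s0 (lexx t) (acW t0T)).
- exact: (within_sub_itv s0 (lexx t) (cW t0T)).
- exact: (adapted_sub s0 (lexx t) af).
Qed.

(* As long as the ratio [f1] stays above [1 + e], the squared distance [f2] to the *)
(* singularity satisfies a Gronwall inequality and cannot reach 0 in finite time.  *)
Lemma ratio_bound f1 f2 g N C : 0 < C ->
  (forall t, 0 <= t < T -> adapted W 0 t f1) -> (forall t, 0 <= t < T -> adapted W 0 t f2) ->
  (forall t, 0 <= t < T -> {within `[0, t], continuous N}) ->
  (forall t, 0 <= t < T -> [/\ 0 < f1 t, 0 < g t, 0 < N t & f2 t <= C * N t]) ->
  (forall x, 0 < x < T -> derivable W x 1 ->
     slope_ge f1 x (- (8^-1 * (derive1 W x) ^+ 2 * f1 x))) ->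
  (forall x, 0 < x < T -> derivable W x 1 ->
     slope_ge f2 x (- (4^-1 * (derive1 W x) ^+ 2 * g x))) ->
  (forall x e, 0 <= x < T -> 0 < e -> 1 + e <= f1 x -> g x * e <= f2 x * (1 + e)) ->
  (forall d, 0 < d -> exists2 t, 0 <= t < T & N t < d) ->
  forall s, 0 <= s < T -> f1 s <= expR (8^-1 * E).
Proof.
move=> C0 af1 af2 cN pos d1 d2 fg sw s s0T; rewrite leNgt; apply/negP => big.
have /andP[s0 sT] := s0T.
(* Gronwall's inequality for [f1] loses at most the factor exp(E/8), so from time [s] on [f1] stays
   above 1 + e. *)
pose e := f1 s * expR (- (8^-1 * E)) - 1.
have e0 : 0 < e by rewrite /e expRN subr_gt0 ltr_pdivlMr ?expR_gt0// mul1r.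
have f1e t : s <= t < T -> 1 + e <= f1 t.
  move=> /andP[st tT]; rewrite /e subrKC; apply: flow_gronwall => //.
  - by apply: af1; apply/andP; split; lra.
  - by move=> x /andP[? ?]; case: (pos x) => //; apply/andP; split; lra.
  - by move=> x /andP[? ?]; apply: d1; apply/andP; split; lra.
have e1 : 0 < 1 + e by lra.
have f20 t : s <= t < T -> 0 < f2 t.
  move=> /andP[st tT]; have t0T : 0 <= t < T by apply/andP; split; lra.
  have st' : s <= t < T by rewrite st.
  have := fg t e t0T e0 (f1e t st'); have [_ g0 _ _] := pos t t0T.
  have := mulr_gt0 g0 e0 => h1 h2; have := lt_le_trans h1 h2.
  by rewrite pmulr_lgt0.
(* While [f1 >= 1 + e], [fg] bounds [g] by (1 + e) / e times [f2]; together with the factor 1/4 this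
   is the Gronwall rate of [f2]. *)
pose c := (1 + e) / (4 * e); have c0 : 0 <= c by rewrite divr_ge0//; lra.
pose a := f2 s * expR (- (c * E)) / C.
have a0 : 0 < a by rewrite divr_gt0// mulr_gt0 ?expR_gt0// f20// lexx.
have Na t : s <= t < T -> a <= N t.
  move=> /andP[st tT]; have t0T : 0 <= t < T by apply/andP; split; lra.
  have [_ _ _ h] := pos t t0T; rewrite /a ler_pdivrMr// [leRHS]mulrC; apply: le_trans h.
  apply: flow_gronwall => //; first exact: af2.
    by move=> x /andP[? ?]; apply: f20; apply/andP; split; lra.
  move=> x /andP[sx xt] dW; have x0T : 0 < x < T by apply/andP; split; lra.
  have [df d' h'] := d2 x x0T dW; exists df => //; apply: le_trans h'; rewrite lerN2.
  have sxT : s <= x < T by apply/andP; split; lra.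
  have x0T' : 0 <= x < T by apply/andP; split; lra.
  have := fg x e x0T' e0 (f1e x sxT) => k.
  have -> : c * (derive1 W x) ^+ 2 * f2 x = 4^-1 * (derive1 W x) ^+ 2 * (f2 x * (1 + e) / e).
    by rewrite /c; field; rewrite gt_eqF.
  by apply: ler_wpM2l; [rewrite mulr_ge0 ?sqr_ge0//; lra|rewrite ler_pdivlMr].
have [|m m0 Hm] := continuous_pos_min s0 (cN s s0T).
  by move=> t /andP[? ?]; case: (pos t) => //; apply/andP; split; lra.
have [|t /andP[t0 tT]] := sw (Num.min a m); first by rewrite lt_min a0.
rewrite lt_min => /andP[ta tm]; have [st|ts] := leP s t.
  have stT : s <= t < T by rewrite st.
  by have := Na t stT; lra.
have t0s : 0 <= t <= s by rewrite t0 ltW.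
by have := Hm t t0s; lra.
Qed.

(** * Estimates for the chordal flow *)

Section Chordal.
Variables p q : R -> R.
Let X t := p t - W t.
Let N t := X t ^+ 2 + q t ^+ 2.
Hypothesis q0 : forall t, 0 <= t < T -> 0 < q t.
Hypothesis cp : forall t, 0 <= t < T -> {within `[0, t], continuous p}.
Hypothesis cq : forall t, 0 <= t < T -> {within `[0, t], continuous q}.
Hypothesis dp : forall t, 0 < t < T -> is_derive t 1 p (2 * X t / N t).
Hypothesis dq : forall t, 0 < t < T -> is_derive t 1 q (- (2 * q t / N t)).
Hypothesis swallow : forall d, 0 < d -> exists2 t, 0 <= t < T & N t < d.

Let N0 t : 0 <= t < T -> 0 < N t.
Proof. by move=> /q0 qt; rewrite /N ltr_wpDl ?sqr_ge0// exprn_gt0. Qed.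

(** On a compact time interval before T the height is bounded below, so the velocity is bounded and
    the orbit is Lipschitz in time. *)
Let adapted_pq t : 0 <= t < T -> adapted W 0 t p /\ adapted W 0 t q.
Proof.
move=> tT; have /andP[t0 tT'] := tT.
have [|m m0 Hm] := continuous_pos_min t0 (cq tT).
  by move=> x /andP[? ?]; apply: q0; apply/andP; split; lra.
have m2 : 0 < m ^+ 2 by rewrite exprn_gt0.
have K0 : 0 <= 1 + (m ^+ 2)^-1 by rewrite addr_ge0// invr_ge0 ltW.
have bd (y n : R) : y ^+ 2 <= n -> m ^+ 2 <= n -> `|2 * y / n| <= 1 + (m ^+ 2)^-1.
  move=> yn mn; have n0 : 0 < n by exact: lt_le_trans mn.
  rewrite normrM normfV (gtr0_norm n0) ler_pdivrMr//.
  have k1 : 1 <= (m ^+ 2)^-1 * n by rewrite ler_pdivlMl// mulr1.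
  rewrite mulrDl mul1r ler_norml.
  have s1 := sqr_ge0 (y - 1); have s2 := sqr_ge0 (y + 1).
  by apply/andP; split; nra.
have Nm x : 0 < x < t -> 0 < x < T /\ m ^+ 2 <= N x.
  move=> /andP[x0 xt]; split; first by apply/andP; split; lra.
  have x0t : 0 <= x <= t by apply/andP; split; lra.
  have := Hm x x0t => mq; have : m ^+ 2 <= q x ^+ 2 by rewrite ler_pXn2r// nnegrE; lra.
  by rewrite /N; have := sqr_ge0 (X x); lra.
split; apply: (@adapted_lipschitz _ _ _ _ _ _ K0).
  apply: derive_lipschitz (cp tT) _ _ => x /Nm[xT mN]; first exact: dp.
  by apply: bd => //; rewrite /N; have := sqr_ge0 (q x); lra.
apply: derive_lipschitz (cq tT) _ _ => x /Nm[xT mN]; first exact: dq.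
by rewrite normrN; apply: bd => //; rewrite /N; have := sqr_ge0 (X x); lra.
Qed.

Let adapted_X2 t : 0 <= t < T -> adapted W 0 t (fun x => X x ^+ 2).
Proof.
move=> tT; have [ap aq] := adapted_pq tT.
have aX := adaptedB ap (adapted_driving W 0 t); exact: (adaptedM (cW tT) aX aX).
Qed.

Let adapted_q2 t : 0 <= t < T -> adapted W 0 t (fun x => q x ^+ 2).
Proof. by move=> tT; have [ap aq] := adapted_pq tT; exact: (adaptedM (cW tT) aq aq). Qed.

Let adapted_N t : 0 <= t < T -> adapted W 0 t N.
Proof. by move=> tT; exact: (adaptedD (adapted_X2 tT) (adapted_q2 tT)). Qed.

Let dX2 t : 0 < t < T -> derivable W t 1 ->
  is_derive t 1 (fun x => X x ^+ 2) (4 * X t ^+ 2 / N t - 2 * X t * derive1 W t).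
Proof.
move=> tT /derivable_is_derive1 dW; have dX := is_derive_sub (dp tT) dW.
by apply: is_derive_eqv (is_derive_mul dX dX) _; rewrite -/(X t); ring.
Qed.

Let dq2 t : 0 < t < T -> is_derive t 1 (fun x => q x ^+ 2) (- (4 * q t ^+ 2 / N t)).
Proof. by move=> tT; apply: is_derive_eqv (is_derive_mul (dq tT) (dq tT)) _; ring. Qed.

Let dN t (tT : 0 < t < T) (dW : derivable W t 1) := is_derive_add (dX2 tT dW) (dq2 tT).

Let ge0T t : 0 < t < T -> 0 <= t < T. Proof. by move=> /andP[? ?]; apply/andP; split; lra. Qed.

(** [ratio_bound] applies because the defects of the two differential inequalities are (8X - W'N)^2
    / (8 N q^2) for N / q^2 and (4X - W'N)^2 / (4N) for X^2. *)
Lemma chordal_ratio s : 0 <= s < T -> N s / q s ^+ 2 <= expR (8^-1 * E).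
Proof.
apply: (@ratio_bound (fun s => N s / q s ^+ 2) (fun t => X t ^+ 2) N N 1) => //.
- move=> t tT; have /andP[t0 _] := tT.
  have q2 x : 0 <= x <= t -> 0 < q x ^+ 2.
    by move=> /andP[? ?]; rewrite exprn_gt0// q0//; apply/andP; split; lra.
  have [m m0 Hm] := continuous_pos_min t0 (adapted_cont (cW tT) (adapted_q2 tT)) q2.
  exact: (adaptedM (cW tT) (adapted_N tT) (adaptedV m0 Hm (adapted_q2 tT))).
- by move=> t tT; exact: (adapted_cont (cW tT) (adapted_N tT)).
- move=> t tT; have n0 := N0 tT; split=> //; first by rewrite divr_gt0// exprn_gt0// q0.
  by rewrite mul1r /N lerDl sqr_ge0.
- move=> t tT dW; have n0 := N0 (ge0T tT); have qt := q0 (ge0T tT).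
  have q2 : 0 < q t ^+ 2 by rewrite exprn_gt0.
  eexists; first exact: (@is_derive_mul R N (fun s => (q s ^+ 2)^-1) t _ _ (dN tT dW)
    (@is_derive_inv R (fun s => q s ^+ 2) t _ (lt0r_neq0 q2) (dq2 tT))).
  rewrite -subr_ge0 [leRHS](_ : _ = (8 * X t - derive1 W t * N t) ^+ 2 / (8 * N t * q t ^+ 2)).
    by rewrite divr_ge0 ?sqr_ge0// !mulr_ge0// ltW.
  have E1 : q t ^+ 2 = N t - X t ^+ 2 by rewrite /N; ring.
  have h : N t - X t ^+ 2 != 0 by rewrite -E1 lt0r_neq0.
  by rewrite E1; field; rewrite h lt0r_neq0.
- move=> t tT dW; have n0 := N0 (ge0T tT).
  eexists; first exact: (dX2 tT dW).
  rewrite -subr_ge0 [leRHS](_ : _ = (4 * X t - derive1 W t * N t) ^+ 2 / (4 * N t)).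
    by rewrite divr_ge0 ?sqr_ge0// mulr_ge0// ltW.
  by field; rewrite lt0r_neq0.
- move=> x e xT e0; have q2 : 0 < q x ^+ 2 by rewrite exprn_gt0// q0.
  by rewrite ler_pdivlMr// /N; nra.
Qed.

(** By [chordal_ratio], q^2 decreases at rate 4 q^2 / N, which is at least 4 exp(-E/8), and it stays
    nonnegative up to time T. *)
Lemma chordal_time_le : T <= expR (8^-1 * E) * q 0 ^+ 2 / 4.
Proof.
set k := expR _; have k0 : 0 < k by exact: expR_gt0.
apply/ler_addgt0Pr => e e0; have [eT|Te] := ltP e T; last first.
  have h : 0 <= k * q 0 ^+ 2 := mulr_ge0 (ltW k0) (sqr_ge0 _).
  lra.
pose t := T - e; have tT : 0 <= t < T by rewrite /t; apply/andP; split; lra.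
have /andP[t0 _] := tT.
pose F x := - (4 / k) * x - q x ^+ 2.
have cF : {within `[0, t], continuous F}.
  have [ap aq] := adapted_pq tT; apply: (adapted_cont (cW tT)).
  exact: (adaptedB (adaptedM (cW tT) (adapted_cst W 0 t (- (4 / k))) (adapted_id W 0 t)) (adapted_q2 tT)).
have dF x : 0 < x < t -> is_derive x 1 F (4 * q x ^+ 2 / N x - 4 / k).
  move=> /andP[x0 xt]; have xT : 0 < x < T by apply/andP; split; lra.
  have dl : is_derive x 1 (fun x : R => - (4 / k) * x) (- (4 / k)).
    apply: is_derive_eqv (is_derive_mul (is_derive_cst _ x 1) (is_derive_id x 1)) _.
    by rewrite mul0r mulr1 add0r.
  by apply: is_derive_eqv (is_derive_sub dl (dq2 xT)) _; rewrite opprK addrC.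
have : F 0 <= F t.
  apply: (@ge0_derive_le R F _ 0 t t0 cF dF) => x /andP[x0 xt].
  have xT : 0 <= x < T by apply/andP; split; lra.
  have q2 : 0 < q x ^+ 2 by rewrite exprn_gt0// q0.
  have := chordal_ratio xT; have n0 := N0 xT; rewrite -/k ler_pdivrMr// => h.
  rewrite subr_ge0 ler_pdivlMr// mulrAC ler_pdivrMr//; lra.
rewrite /F mulr0 sub0r mulNr => h; have := sqr_ge0 (q t) => h'.
have : 4 / k * t <= q 0 ^+ 2 by lra.
rewrite mulrAC ler_pdivrMr// /t => ?; lra.
Qed.

(** Gronwall's inequality for N + 8t, up to a time at which N is nearly 0. The term 8t compensates
    the decrease of N: with 8 = 8 (X^2 + q^2) / N, a square can be completed. *)
Lemma chordal_start_le : N 0 <= 8 * T * expR (4^-1 * E).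
Proof.
set k := expR _; have k0 : 0 < k by exact: expR_gt0.
apply/ler_addgt0Pr => e e0.
have [t tT Nt] := swallow (divr_gt0 e0 k0); have /andP[t0 tT'] := tT.
have : (N 0 + 8 * 0) * expR (- (4^-1 * E)) <= N t + 8 * t.
  apply: (@flow_gronwall 4^-1 (fun x => N x + 8 * x) 0 t) => //.
  - exact: (adaptedD (adapted_N tT) (adaptedM (cW tT) (adapted_cst W 0 t 8) (adapted_id W 0 t))).
  - move=> x /andP[x0 xt]; have xT : 0 <= x < T by apply/andP; split; lra.
    by have := N0 xT; lra.
  - move=> x /andP[x0 xt] dW; have xT : 0 < x < T by apply/andP; split; lra.
    have n0 := N0 (ge0T xT).
    have dl := is_derive_mul (is_derive_cst (8 : R) x 1) (is_derive_id x 1).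
    eexists; first exact: (is_derive_add (dN xT dW) dl).
    apply: (@le_trans _ _ (- (4^-1 * derive1 W x ^+ 2 * N x))).
      have ? : 0 <= derive1 W x ^+ 2 := sqr_ge0 _.
      have ? : 0 <= derive1 W x ^+ 2 * x by rewrite mulr_ge0// ltW.
      lra.
    rewrite -subr_ge0 [leRHS](_ : _ =
      ((2 * X x - derive1 W x * N x / 2) ^+ 2 + 8 * X x ^+ 2 + 4 * q x ^+ 2) / N x).
      have s1 := sqr_ge0 (2 * X x - derive1 W x * N x / 2).
      have s2 := sqr_ge0 (X x); have s3 := sqr_ge0 (q x).
      by apply: divr_ge0; [lra|exact: ltW].
    have E1 : q x ^+ 2 = N x - X x ^+ 2 by rewrite /N; ring.
    by rewrite E1; field; rewrite lt0r_neq0.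
rewrite mulr0 addr0 expRN ler_pdivrMr// -/k => h.
apply: le_trans h _; have h2 : N t * k < e by rewrite -ltr_pdivlMr.
have h3 : t * k <= T * k by rewrite ler_wpM2r ?ltW.
rewrite mulrDl addrC; apply: lerD; last exact: ltW.
by rewrite -!mulrA; apply: ler_wpM2l.
Qed.

End Chordal.
End Driven.
End Flow.

(** * Estimates for the radial flow *)

Section RadialFlow.
Variable R : realType.
Variables (W : R -> R) (E T : R).
Hypothesis E0 : 0 <= E.
Hypothesis T0 : 0 < T.
Hypothesis cW : forall s, 0 <= s < T -> {within `[0, s], continuous W}.
Hypothesis acW : forall s, 0 <= s < T -> abs_continuous_on 0 s W.
Hypothesis eW : energy_le W E.

Variables p q : R -> R.
(* [rho + i sigma] is the position in the frame rotating with the driving point,   *)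
(* [D] its squared distance to that point.                                         *)
Let rho t := p t * cos (W t) + q t * sin (W t).
Let sigma t := q t * cos (W t) - p t * sin (W t).
Let r2 t := p t ^+ 2 + q t ^+ 2.
Let r t := Num.sqrt (r2 t).
Let D t := 1 - 2 * rho t + r2 t.
Hypothesis r2_0 : forall t, 0 <= t < T -> 0 < r2 t.
Hypothesis r2_1 : forall t, 0 <= t < T -> r2 t < 1.
Hypothesis cp : forall t, 0 <= t < T -> {within `[0, t], continuous p}.
Hypothesis cq : forall t, 0 <= t < T -> {within `[0, t], continuous q}.
Hypothesis dp : forall t, 0 < t < T ->
  is_derive t 1 p ((p t * (1 - r2 t) - 2 * q t * sigma t) / D t).
Hypothesis dq : forall t, 0 < t < T ->
  is_derive t 1 q ((q t * (1 - r2 t) + 2 * p t * sigma t) / D t).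
Hypothesis swallow : forall d, 0 < d -> exists2 t, 0 <= t < T & D t < d.

Let ge0T t : 0 < t < T -> 0 <= t < T. Proof. by move=> /andP[? ?]; apply/andP; split; lra. Qed.

Let T00 : (0 : R) <= 0 < T.
Proof. by rewrite lexx T0. Qed.

Let rs t : rho t ^+ 2 + sigma t ^+ 2 = r2 t.
Proof.
have := cos2Dsin2 (W t); rewrite /rho /sigma /r2 => h.
transitivity ((p t ^+ 2 + q t ^+ 2) * (cos (W t) ^+ 2 + sin (W t) ^+ 2)); first by ring.
by rewrite h mulr1.
Qed.

Let r_gt0 t : 0 <= t < T -> 0 < r t. Proof. by move=> /r2_0; rewrite sqrtr_gt0. Qed.
Let r_sqr t : 0 <= t < T -> r t ^+ 2 = r2 t.
Proof. by move=> /r2_0/ltW h; rewrite sqr_sqrtr. Qed.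
Let r_lt1 t : 0 <= t < T -> r t < 1.
Proof. by move=> tT; have := r2_1 tT; rewrite -r_sqr// expr_lt1// ltW// r_gt0. Qed.

Let rho_le t : 0 <= t < T -> - r t <= rho t <= r t.
Proof.
move=> tT; rewrite -ler_norml -sqrtr_sqr; apply: ler_wsqrtr.
by rewrite -rs lerDl sqr_ge0.
Qed.

Let D_ge t : 0 <= t < T -> (1 - r t) ^+ 2 <= D t.
Proof.
by move=> tT; rewrite /D -r_sqr//; have /andP[_ h] := rho_le tT; nra.
Qed.

Let D_gt0 t : 0 <= t < T -> 0 < D t.
Proof.
by move=> tT; apply: lt_le_trans (D_ge tT); rewrite exprn_gt0// subr_gt0 r_lt1.
Qed.

(** On a compact time interval r stays away from 1, and D is at least (1 - r)^2, so the velocity is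
    bounded. *)
Let adapted_pq t : 0 <= t < T -> adapted W 0 t p /\ adapted W 0 t q.
Proof.
move=> tT; have /andP[t0 tT'] := tT.
have sub x : 0 <= x <= t -> 0 <= x < T by move=> /andP[? ?]; apply/andP; split; lra.
have c1 : {within `[0, t], continuous (fun x => 1 - r2 x)}.
  have cr2 := within_add (within_mul (cp tT) (cp tT)) (within_mul (cq tT) (cq tT)).
  by move=> x; apply: continuousB; [exact: cvg_cst|exact: cr2].
have [|m m0 Hm] := continuous_pos_min t0 c1; first by move=> x /sub/r2_1; lra.
have Dm x : 0 < x < t -> 0 < x < T /\ m ^+ 2 / 4 <= D x.
  move=> /andP[x0 xt]; have xt' : 0 <= x <= t by apply/andP; split; lra.
  split; first by apply/andP; split; lra.
  have xT := sub x xt'; apply: le_trans (D_ge xT); have := Hm x xt'; rewrite -r_sqr// => h.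
  have r0 := r_gt0 xT; have r1 := r_lt1 xT.
  have h' : m / 2 <= 1 - r x by nra.
  have -> : m ^+ 2 / 4 = (m / 2) ^+ 2 by field.
  by rewrite ler_pXn2r// nnegrE; lra.
have m4 : 0 < m ^+ 2 / 4 by rewrite divr_gt0// exprn_gt0.
pose K := 3 / (m ^+ 2 / 4); have K0 : 0 <= K by rewrite divr_ge0 ?ltW.
have bd x (a b : R) : 0 < x < T -> m ^+ 2 / 4 <= D x -> a ^+ 2 <= r2 x -> b ^+ 2 <= r2 x ->
    `|(a * (1 - r2 x) + 2 * b * sigma x) / D x| <= K.
  move=> xT mD ar br; have xT' := ge0T xT; have D0 := D_gt0 xT'.
  rewrite normrM normfV (gtr0_norm D0) ler_pdivrMr//.
  have KD : 3 <= K * D x by rewrite /K mulrAC ler_pdivlMr// ler_wpM2l.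
  apply: le_trans KD; apply: le_trans (ler_normD _ _) _.
  have rr0 := r2_0 xT'; have rr1 := r2_1 xT'.
  have n1 (y : R) : y ^+ 2 <= r2 x -> `|y| <= 1.
    by move=> yr; rewrite ler_norml; apply/andP; split; nra.
  have sr : sigma x ^+ 2 <= r2 x by rewrite -(rs x) lerDr sqr_ge0.
  rewrite !normrM (ger0_norm (_ : 0 <= 1 - r2 x)); last by lra.
  rewrite normr_nat.
  have a1 : `|a| * (1 - r2 x) <= 1 * 1 by apply: ler_pM => //; [lra|exact: n1|lra].
  have b1 : `|b| * `|sigma x| <= 1 * 1 by apply: ler_pM => //; exact: n1.
  by lra.
split; apply: (@adapted_lipschitz _ _ _ _ _ _ K0).
  apply: derive_lipschitz (cp tT) _ _ => x /Dm[xT mD]; first exact: dp.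
  have := bd x (p x) (- q x) xT mD; rewrite sqrrN mulrN !mulNr; apply.
    by rewrite /r2 lerDl sqr_ge0.
  by rewrite /r2 lerDr sqr_ge0.
apply: derive_lipschitz (cq tT) _ _ => x /Dm[xT mD]; first exact: dq.
by apply: bd => //; rewrite /r2 ?lerDl ?lerDr sqr_ge0.
Qed.

Lemma cos_sin_lipschitz (x y : R) : `|cos y - cos x| <= 1 * `|y - x| /\ `|sin y - sin x| <= 1 * `|y - x|.
Proof.
wlog xy : x y / x <= y.
  move=> H; have [xy|/ltW yx] := leP x y; first exact: H.
  by rewrite (distrC (cos y)) (distrC (sin y)) (distrC y); exact: H.
have L (F dF : R -> R) : (forall z : R, is_derive z 1 F (dF z)) -> (forall z, `|dF z| <= 1) ->
    `|F y - F x| <= 1 * `|y - x|.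
  move=> dd d1; apply: (@derive_lipschitz R F dF x y 1); rewrite ?lexx ?xy//.
  by apply: derivable_within_continuous => z _; have h := dd z; exact: ex_derive.
by split; [apply: (L _ (fun z => - sin z)) => z; rewrite normrN ler_norml sin_geN1 sin_le1
  |apply: (L _ cos) => z; rewrite ler_norml cos_geN1 cos_le1].
Qed.

Let adapted_cs t : adapted W 0 t (fun x => cos (W x)) /\ adapted W 0 t (fun x => sin (W x)).
Proof.
by split; apply: (@adapted_comp R W 0 t 1 W _ ler01 (adapted_driving W 0 t)) => // u v _ _;
  have [h1 h2] := cos_sin_lipschitz (W u) (W v).
Qed.

Let adapted_rho t : 0 <= t < T -> adapted W 0 t rho.
Proof.
move=> tT; have [ap aq] := adapted_pq tT; have [ac as_] := adapted_cs t.
exact: (adaptedD (adaptedM (cW tT) ap ac) (adaptedM (cW tT) aq as_)).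
Qed.

Let adapted_r2 t : 0 <= t < T -> adapted W 0 t r2.
Proof.
move=> tT; have [ap aq] := adapted_pq tT.
exact: (adaptedD (adaptedM (cW tT) ap ap) (adaptedM (cW tT) aq aq)).
Qed.

Let adapted_D t : 0 <= t < T -> adapted W 0 t D.
Proof.
move=> tT; have a2 := adaptedM (cW tT) (adapted_cst W 0 t 2) (adapted_rho tT).
exact: (adaptedD (adaptedB (adapted_cst W 0 t 1) a2) (adapted_r2 tT)).
Qed.

Let adapted_r t : 0 <= t < T -> adapted W 0 t r.
Proof.
move=> tT; have /andP[t0 tT'] := tT.
have sub x : 0 <= x <= t -> 0 <= x < T by move=> /andP[? ?]; apply/andP; split; lra.
have [|m m0 Hm] := continuous_pos_min t0 (adapted_cont (cW tT) (adapted_r2 tT)).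
  by move=> x /sub/r2_0.
pose k := Num.sqrt m; have k0 : 0 < k by rewrite sqrtr_gt0.
have rk x : 0 <= x <= t -> k <= r x by move=> xt; rewrite ler_wsqrtr// Hm.
have ki : 0 <= k^-1 by rewrite invr_ge0 ltW.
apply: (@adapted_comp R W 0 t k^-1 r2 _ ki (adapted_r2 tT)).
move=> u v ut vt; rewrite ler_pdivlMl// -!r_sqr ?sub// subr_sqr normrM mulrC.
apply: ler_wpM2l => //; have := rk u ut; have := rk v vt; have := ler_norm (r v + r u); lra.
Qed.

Let dr t : 0 < t < T -> is_derive t 1 r (r t * (1 - r2 t) / D t).
Proof.
move=> tT; have tT' := ge0T tT; have rt := r_gt0 tT'.
have h := is_derive_add (is_derive_mul (dp tT) (dp tT)) (is_derive_mul (dq tT) (dq tT)).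
have := @is_derive_chain R Num.sqrt r2 t _ _ h (is_derive1_sqrt (r2_0 tT')) => h'.
apply: is_derive_eqv h' _; rewrite -/(r t).
have e : p t * p t + q t * q t = r t ^+ 2 by rewrite r_sqr// /r2; ring.
have D0 := D_gt0 tT'; rewrite -(r_sqr tT').
transitivity ((p t * p t + q t * q t) * (1 - r t ^+ 2) / (r t * D t)).
  by field; rewrite !lt0r_neq0.
by rewrite e; field; rewrite !lt0r_neq0.
Qed.

Let drho t : 0 < t < T -> derivable W t 1 ->
  is_derive t 1 rho ((rho t * (1 - r2 t) - 2 * sigma t ^+ 2) / D t + derive1 W t * sigma t).
Proof.
move=> tT /derivable_is_derive1 dW; have D0 := D_gt0 (ge0T tT).
have dc := is_derive_chain dW (is_derive_cos (W t)).
have ds := is_derive_chain dW (is_derive_sin (W t)).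
have h := is_derive_add (is_derive_mul (dp tT) dc) (is_derive_mul (dq tT) ds).
by apply: is_derive_eqv h _; rewrite /rho /sigma; field; rewrite lt0r_neq0.
Qed.

(** One minus the cosine of the angle, seen from the origin, between the orbit and the driving
    point. *)
Let f2 t := 1 - rho t / r t.

Let D_f2 t : 0 <= t < T -> D t = (1 - r t) ^+ 2 + 2 * r t * f2 t.
Proof. by move=> tT; rewrite /D /f2 -(r_sqr tT); field; rewrite lt0r_neq0// r_gt0. Qed.

Let f2_ge0 t : 0 <= t < T -> 0 <= f2 t.
Proof.
move=> tT; have /andP[_ h] := rho_le tT.
by rewrite /f2 subr_ge0 ler_pdivrMr ?mul1r// r_gt0.
Qed.

Let dD t : 0 < t < T -> derivable W t 1 -> is_derive t 1 D
  (2 * r2 t * (1 - r2 t) / D t - 2 * ((rho t * (1 - r2 t) - 2 * sigma t ^+ 2) / D t + derive1 W t * sigma t)).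
Proof.
move=> tT dW; have tT' := ge0T tT; have D0 := D_gt0 tT'.
have d2 : is_derive t 1 r2 (2 * r2 t * (1 - r2 t) / D t).
  have h := is_derive_add (is_derive_mul (dp tT) (dp tT)) (is_derive_mul (dq tT) (dq tT)).
  apply: is_derive_eqv h _; transitivity (2 * (p t * p t + q t * q t) * (1 - r2 t) / D t).
    by field; rewrite lt0r_neq0.
  by congr (2 * _ * _ / _).
have d2r : is_derive t 1 (fun s => 2 * rho s) (2 * ((rho t * (1 - r2 t) - 2 * sigma t ^+ 2) / D t + derive1 W t * sigma t)).
  apply: is_derive_eqv (is_derive_mul (is_derive_cst (2 : R) t 1) (drho tT dW)) _.
  by rewrite mul0r add0r.
have h := is_derive_add (is_derive_sub (is_derive_cst (1 : R) t 1) d2r) d2.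
by apply: is_derive_eqv h _; rewrite sub0r addrC.
Qed.

(** [ratio_bound] with the identity D = (1 - r)^2 + 2 r f2. The defects are ((8 sigma - W'D)^2 + 16
    (r - rho) D) / (8 D (1 - r)^2), nonnegative because rho <= r, and (4 sigma - W'D)^2 / (8 D r).
    The constant [(2 * r 0)^-1] is admissible because r is nondecreasing. *)
Lemma radial_ratio s : 0 <= s < T -> D s / (1 - r s) ^+ 2 <= expR (8^-1 * E).
Proof.
have rr0 := r_gt0 T00.
apply: (@ratio_bound R W E T E0 cW acW eW (fun s => D s / (1 - r s) ^+ 2) f2 (fun t => D t / (2 * r t)) D (2 * r 0)^-1).
- by rewrite invr_gt0 mulr_gt0.
- move=> t tT; have /andP[t0 tT'] := tT.
  have a1 := adaptedB (adapted_cst W 0 t 1) (adapted_r tT).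
  have a2 := adaptedM (cW tT) a1 a1.
  have q2 x : 0 <= x <= t -> 0 < (1 - r x) * (1 - r x).
    move=> /andP[? ?]; have xT : 0 <= x < T by apply/andP; split; lra.
    by rewrite mulr_gt0// subr_gt0 r_lt1.
  have [m m0 Hm] := continuous_pos_min t0 (adapted_cont (cW tT) a2) q2.
  exact: (adaptedM (cW tT) (adapted_D tT) (adaptedV m0 Hm a2)).
- move=> t tT; have /andP[t0 tT'] := tT.
  have q2 x : 0 <= x <= t -> 0 < r x.
    by move=> /andP[? ?]; apply: r_gt0; apply/andP; split; lra.
  have [m m0 Hm] := continuous_pos_min t0 (adapted_cont (cW tT) (adapted_r tT)) q2.
  exact: (adaptedB (adapted_cst W 0 t 1) (adaptedM (cW tT) (adapted_rho tT) (adaptedV m0 Hm (adapted_r tT)))).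
- by move=> t tT; exact: (adapted_cont (cW tT) (adapted_D tT)).
- move=> t tT; have d0 := D_gt0 tT; have rt := r_gt0 tT; have r1 := r_lt1 tT.
  split=> //; first by rewrite divr_gt0// exprn_gt0// subr_gt0.
    by rewrite divr_gt0// mulr_gt0.
  have /andP[t0 tT'] := tT.
  have rm : r 0 <= r t.
    apply: (@ge0_derive_le R r (fun t => r t * (1 - r2 t) / D t) 0 t t0).
    - exact: (adapted_cont (cW tT) (adapted_r tT)).
    - by move=> x /andP[? ?]; apply: dr; apply/andP; split; lra.
    - move=> x /andP[? ?]; have xT : 0 <= x < T by apply/andP; split; lra.
      have := r2_1 xT => ?; rewrite divr_ge0 ?mulr_ge0// ?ltW ?r_gt0 ?D_gt0//; lra.
  rewrite ler_pdivlMl ?mulr_gt0// (D_f2 tT); have := f2_ge0 tT; have := sqr_ge0 (1 - r t).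
  by move=> ? ?; nra.
- move=> t tT dW; have tT' := ge0T tT; have d0 := D_gt0 tT'; have rt := r_gt0 tT'.
  have r1 := r_lt1 tT'; have u0 : 0 < 1 - r t by lra.
  have u2 : 0 < (1 - r t) ^+ 2 by rewrite exprn_gt0.
  have du : is_derive t 1 (fun s => 1 - r s) (- (r t * (1 - r2 t) / D t)).
    by apply: is_derive_eqv (is_derive_sub (is_derive_cst (1 : R) t 1) (dr tT)) _; rewrite sub0r.
  have du2 : is_derive t 1 (fun s => (1 - r s) ^+ 2) (- (2 * (1 - r t) * (r t * (1 - r2 t) / D t))).
    by apply: is_derive_eqv (is_derive_mul du du) _; ring.
  eexists; first exact: (@is_derive_mul R D (fun s => ((1 - r s) ^+ 2)^-1) t _ _ (dD tT dW)
    (@is_derive_inv R (fun s => (1 - r s) ^+ 2) t _ (lt0r_neq0 u2) du2)).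
  have e2 := r_sqr tT'; have hD : D t = 1 - 2 * rho t + r t ^+ 2 by rewrite e2.
  have es2 : sigma t ^+ 2 = r t ^+ 2 - rho t ^+ 2 by rewrite e2 -(rs t); ring.
  set w := derive1 W t; cbv beta; rewrite -e2.
  rewrite -subr_ge0 [leRHS](_ : _ =
    ((8 * sigma t - w * D t) ^+ 2 + 16 * ((r t - rho t) * D t)) / (8 * D t * (1 - r t) ^+ 2)).
    have /andP[_ k] := rho_le tT'.
    have h : 0 <= (r t - rho t) * D t by rewrite mulr_ge0 ?subr_ge0// ltW.
    have s1 := sqr_ge0 (8 * sigma t - w * D t).
    apply: divr_ge0; first by lra.
    by apply: mulr_ge0; [apply: mulr_ge0 => //; exact: ltW|exact: ltW].
  (* This isolates the part of the numerator free of W' and uses sigma^2 = r^2 - rho^2 together with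
     the formula for D. *)
  have key : 2 * (r t ^+ 2 - rho t) * (1 - r t ^+ 2) + 4 * sigma t ^+ 2 + 2 * r t * (1 + r t) * D t
      = 8 * sigma t ^+ 2 + 2 * (r t - rho t) * D t by rewrite es2 hD; ring.
  transitivity ((2 * (r t ^+ 2 - rho t) * (1 - r t ^+ 2) + 4 * sigma t ^+ 2 + 2 * r t * (1 + r t) * D t
      - 2 * w * sigma t * D t + w ^+ 2 * D t ^+ 2 / 8) / (D t * (1 - r t) ^+ 2)).
    by field; rewrite !lt0r_neq0.
  by rewrite key; field; rewrite !lt0r_neq0.
- move=> t tT dW; have tT' := ge0T tT; have d0 := D_gt0 tT'; have rt := r_gt0 tT'.
  eexists.
    exact: (is_derive_sub (is_derive_cst (1 : R) t 1) (@is_derive_mul R rho (fun s => (r s)^-1) t _ _ (drho tT dW)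
      (@is_derive_inv R r t _ (lt0r_neq0 rt) (dr tT)))).
  set w := derive1 W t.
  rewrite -subr_ge0 [leRHS](_ : _ = (4 * sigma t - w * D t) ^+ 2 / (8 * D t * r t)).
    by rewrite divr_ge0 ?sqr_ge0// !mulr_ge0// ltW.
  by field; rewrite !lt0r_neq0.
- move=> x e xT e0; have d0 := D_gt0 xT; have rt := r_gt0 xT; have r1 := r_lt1 xT.
  have u2 : 0 < (1 - r x) ^+ 2 by rewrite exprn_gt0// subr_gt0.
  rewrite ler_pdivlMr// mulrAC ler_pdivrMr ?mulr_gt0// => h.
  by move: h; rewrite (D_f2 xT); nra.
- exact: swallow.
Qed.

(* The growth rate of [r] is at least [(1 + r) / (1 - r) >= 1] times the inverse ratio. *)
Lemma radial_time_le : T <= expR (8^-1 * E) * - ln (r 0).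
Proof.
set k := expR _; have k0 : 0 < k by exact: expR_gt0.
have ln0 : 0 <= - ln (r 0) by rewrite oppr_ge0 ln_le0// ltW// r_lt1.
apply/ler_addgt0Pr => e e0; have [eT|Te] := ltP e T; last first.
  have h := mulr_ge0 (ltW k0) ln0; lra.
pose t := T - e; have tT : 0 <= t < T by rewrite /t; apply/andP; split; lra.
have /andP[t0 _] := tT; have sub x : 0 < x < t -> 0 < x < T.
  by rewrite /t => /andP[? ?]; apply/andP; split; lra.
have := @exp_gronwall R r (fun t => r t * (1 - r2 t) / D t) (- k^-1) t t0.
have c1 := adapted_cont (cW tT) (adapted_r tT).
have c2 x : 0 < x < t -> is_derive x 1 r (r x * (1 - r2 x) / D x) by move=> /sub; exact: dr.
have c3 x : 0 < x < t -> - (- k^-1 * r x) <= r x * (1 - r2 x) / D x.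
  move=> /sub/ge0T xT; have d0 := D_gt0 xT; have rx := r_gt0 xT; have r1 := r_lt1 xT.
  have u2 : 0 < (1 - r x) ^+ 2 by rewrite exprn_gt0// subr_gt0.
  have := radial_ratio xT; rewrite ler_pdivrMr// -/k => h.
  have h' : k^-1 * D x <= (1 - r x) ^+ 2 by rewrite ler_pdivrMl.
  rewrite mulNr opprK ler_pdivlMr// -mulrA (mulrC (r x)) mulrA (mulrC _ (r x)).
  by apply: ler_wpM2l; rewrite ?(ltW rx)// -(r_sqr xT); nra.
move=> /(_ c1 c2 c3); rewrite mulNr opprK => h.
have h1 : r 0 * expR (k^-1 * t) < 1 by apply: le_lt_trans h (r_lt1 tT).
have := r_gt0 T00 => r00.
have : ln (r 0 * expR (k^-1 * t)) < 0 by apply: ln_lt0; rewrite h1 mulr_gt0 ?expR_gt0.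
rewrite lnM ?posrE ?expR_gt0// expRK => h2.
have : k^-1 * t <= - ln (r 0) by lra.
by rewrite ler_pdivrMl// /t; lra.
Qed.

(** As in Koebe's one-quarter theorem: G = r / (1 + r)^2 grows at a relative rate (1 - r)^2 / D <= 1
    and tends to 1/4 along the times at which D tends to 0, while G(0) <= r(0). *)
Lemma radial_start_ge : expR (- T) / 4 <= r 0.
Proof.
have rr0 := r_gt0 T00; have eT : 0 < expR (- T) by exact: expR_gt0.
rewrite leNgt; apply/negP => small.
pose e := expR (- T) / 4 - r 0.
have e0 : 0 < e by rewrite /e; lra.
have d0 : 0 < e ^+ 2 / 4 by rewrite divr_gt0// exprn_gt0.
have [t tT Dt] := swallow d0.
have /andP[t0 tT'] := tT.
have rt := r_gt0 tT; have r1 := r_lt1 tT.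
have p2 x : 0 <= x < T -> 0 < (1 + r x) * (1 + r x).
  by move=> /r_gt0 ?; rewrite mulr_gt0//; lra.
have aF : adapted W 0 t (fun x => r x * ((1 + r x) * (1 + r x))^-1).
  have a1 := adaptedD (adapted_cst W 0 t 1) (adapted_r tT).
  have a2 := adaptedM (cW tT) a1 a1.
  have q2 x : 0 <= x <= t -> 0 < (1 + r x) * (1 + r x).
    by move=> /andP[? ?]; apply: p2; apply/andP; split; lra.
  have [m m0 Hm] := continuous_pos_min t0 (adapted_cont (cW tT) a2) q2.
  exact: (adaptedM (cW tT) (adapted_r tT) (adaptedV m0 Hm a2)).
pose G x := r x / (1 + r x) ^+ 2.
have cG : {within `[0, t], continuous (fun x => -1 * G x)} :=
  adapted_cont (cW tT) (adaptedM (cW tT) (adapted_cst W 0 t (-1)) aF).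
have dG x : 0 < x < t -> is_derive x 1 (fun x => -1 * G x)
    (- (r x * (1 - r x) ^+ 2 / (D x * (1 + r x) ^+ 2))).
  move=> /andP[x0 xt]; have xT : 0 < x < T by apply/andP; split; lra.
  have xT' := ge0T xT; have r0 := r_gt0 xT'; have D0 := D_gt0 xT'.
  have du : is_derive x 1 (fun s => 1 + r s) (r x * (1 - r2 x) / D x).
    by apply: is_derive_eqv (is_derive_add (is_derive_cst (1 : R) x 1) (dr xT)) _; rewrite add0r.
  have du2 : is_derive x 1 (fun s => (1 + r s) ^+ 2) (2 * (1 + r x) * (r x * (1 - r2 x) / D x)).
    by apply: is_derive_eqv (is_derive_mul du du) _; ring.
  have u2 : 0 < (1 + r x) ^+ 2 by rewrite exprn_gt0//; lra.
  have h := @is_derive_mul R r (fun s => ((1 + r s) ^+ 2)^-1) x _ _ (dr xT)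
    (@is_derive_inv R (fun s => (1 + r s) ^+ 2) x _ (lt0r_neq0 u2) du2).
  have h' := is_derive_mul (is_derive_cst (-1 : R) x 1) h.
  apply: is_derive_eqv h' _; rewrite mul0r add0r /cst -(r_sqr xT'); cbv beta.
  have u1 : 1 + r x != 0 by rewrite lt0r_neq0//; lra.
  by field; rewrite u1 lt0r_neq0.
have := @exp_gronwall R (fun x => -1 * G x) _ (-1) t t0 cG dG.
have c3 x : 0 < x < t -> - (-1 * (-1 * G x)) <= - (r x * (1 - r x) ^+ 2 / (D x * (1 + r x) ^+ 2)).
  move=> /andP[x0 xt]; have xT : 0 <= x < T by apply/andP; split; lra.
  rewrite !mulN1r opprK lerN2 /G invfM mulrA ler_wpM2r//.
    by rewrite invr_ge0 sqr_ge0.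
  rewrite ler_pdivrMr ?D_gt0// ler_wpM2l ?D_ge// ltW// r_gt0//.
move=> /(_ c3); rewrite !mulN1r opprK mulNr lerN2 => Gt.
have G0 : G 0 <= r 0.
  rewrite /G ler_pdivrMr; first by have := sqr_ge0 (r 0); nra.
  by rewrite exprn_gt0//; lra.
have et : expR t <= expR T by rewrite ler_expR ltW.
have key : r t / (1 + r t) ^+ 2 * expR (- T) <= r 0.
  rewrite expRN ler_pdivrMr ?expR_gt0//; apply: le_trans Gt _; apply: ler_pM.
  - by rewrite /G divr_ge0 ?sqr_ge0// ltW.
  - exact: expR_ge0.
  - exact: G0.
  - exact: et.
have dd : (1 - r t) ^+ 2 < e ^+ 2 / 4.
  exact: le_lt_trans (D_ge tT) Dt.
have de : 1 - r t < e / 2.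
  rewrite -(@ltr_pXn2r _ 2) ?nnegrE//; [|lra|lra].
  by rewrite (_ : (e / 2) ^+ 2 = e ^+ 2 / 4)//; field.
have q4 : r t / 4 <= r t / (1 + r t) ^+ 2.
  by rewrite ler_pM2l// lef_pV2 ?posrE ?exprn_gt0//; [nra|lra].
have eT1 : expR (- T) < 1 by rewrite expR_lt1 oppr_lt0.
have h1 : r t / 4 * expR (- T) <= r 0 by apply: le_trans key; rewrite ler_wpM2r// ltW.
have h2 : (1 - r t) * expR (- T) <= 1 - r t by rewrite ler_piMr ?ltW// subr_gt0.
by rewrite /e in de; lra.
Qed.

End RadialFlow.

(** * Points of the curve reach the driving singularity: the half-plane *)

Section Swallowing.
Variable R : realType.
Local Notation C := (R[i]^o).
Local Notation Re := (@complex.Re R).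
Local Notation Im := (@complex.Im R).
Local Notation H := (@upper_half_plane R).
Local Notation D := (@odisk R 1).
Implicit Types (f h v w g : R -> C) (z l : C) (s t T K e d E M : R) (W : R -> R).

Lemma trajectory_limit f v K T : 0 < T -> 0 <= K ->
  (forall t, 0 <= t < T -> is_time_derive f t (v t)) ->
  (forall t, 0 <= t < T -> cmod (v t) <= K) ->
  exists l, forall t, 0 <= t < T -> cmod (f t - l) <= 2 * K * (T - t).
Proof.
move=> T0 K0 Hf vK.
have comp (L : C -> R) : real_part_like L -> exists l : R, forall t, 0 <= t < T -> `|L (f t) - l| <= K * (T - t).
  move=> HL; apply: lipschitz_limit => //.
  suff main u s : 0 <= u -> u <= s -> s < T -> `|L (f s) - L (f u)| <= K * `|s - u|.
    move=> u s /andP[u0 uT] /andP[s0 sT]; have [us|su] := leP u s; first exact: main.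
    by rewrite distrC (distrC s); apply: main => //; exact: ltW.
  move=> u0 us sT.
  have sub t : 0 <= t <= s -> 0 <= t < T by move=> /andP[? ?]; apply/andP; split; lra.
  have cL := time_derive_within HL (fun t ts => Hf t (sub t ts)).
  have dL t : 0 < t < s -> is_derive t 1 (fun s => L (f s)) (L (v t)).
    move=> /andP[t0 ts]; apply: time_derive_is_derive => //.
    by apply: Hf; apply/andP; split; lra.
  apply: (derive_lipschitz cL dL); rewrite ?u0 ?us ?(le_trans u0 us) ?lexx//.
  move=> t /andP[t0 ts]; have [_ [_ Ln]] := HL; apply: le_trans (Ln _) (vK _ _).
  by apply/andP; split; lra.
have [a Ha] := comp Re (@Re_real_part R); have [b Hb] := comp Im (@Im_real_part R).
exists (a +i* b)%C => t tT; have := Ha t tT; have := Hb t tT.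
have := cmod_le (f t - (a +i* b)%C); case: (f t) => x y /=; lra.
Qed.

(** Were the starting points distinct, [trajectories_apart] would keep the distance at least a up to
    time T, whereas near T both trajectories are within a/4 of [l]. *)
Lemma trajectories_do_not_meet f h v w K T l : 0 < T -> 0 <= K ->
  (forall t, 0 <= t < T -> is_time_derive f t (v t)) ->
  (forall t, 0 <= t <= T -> is_time_derive h t (w t)) ->
  (forall t, 0 <= t < T -> cmod (v t - w t) <= K * cmod (f t - h t)) ->
  (forall e, 0 < e -> exists2 d, 0 < d & forall t, 0 <= t < T -> T - d < t -> cmod (f t - l) < e) ->
  h T = l -> f 0 = h 0.
Proof.
move=> T0 K0 Hf Hh HK fl hl; apply/eqP; rewrite -subr_eq0 -cmod_eq0; apply: contraT => ne.
have c0 : 0 < cmod (f 0 - h 0) by rewrite lt_neqAle eq_sym ne cmod_ge0.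
pose A := cmod (f 0 - h 0) ^+ 2 * expR (- (2 * K * T)).
have A0 : 0 < A by rewrite mulr_gt0 ?expR_gt0// exprn_gt0.
pose a := Num.sqrt A; have a0 : 0 < a by rewrite sqrtr_gt0.
have aA : a ^+ 2 = A by rewrite sqr_sqrtr// ltW.
have a4 : 0 < a / 4 by lra.
have [d d0 Hd] := fl _ a4.
have TT : 0 <= T <= T by rewrite lexx ltW.
have [d' d'0 Hd'] := time_derive_near (Hh T TT) a4.
pose m := Num.min (Num.min d d') T; have m0 : 0 < m by rewrite !lt_min d0 d'0.
have [md [md' mT]] : m <= d /\ m <= d' /\ m <= T.
  by rewrite /m !ge_min !lexx ?orbT; case: (leP d d') => ?; split=> //; rewrite ?orbT.
pose s := T - m / 2; have s0 : 0 <= s by rewrite /s; lra.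
have sT : 0 <= s < T by rewrite s0 /s; lra.
have h1 : cmod (f s - l) < a / 4 by apply: Hd => //; rewrite /s; lra.
have h2 : cmod (h s - l) < a / 4.
  rewrite -hl; apply: Hd' => //; rewrite /s addrAC subrr add0r normrN gtr0_norm; lra.
have sub t : 0 <= t <= s -> 0 <= t < T by move: sT => /andP[? ?] /andP[? ?]; apply/andP; split; lra.
have sub' t : 0 <= t <= s -> 0 <= t <= T by move=> /sub /andP[? ?]; apply/andP; split; lra.
have := @trajectories_apart R f h v w K s s0 (fun t ts => Hf t (sub t ts)) (fun t ts => Hh t (sub' t ts)) (fun t ts => HK t (sub t ts)).
have : A <= cmod (f 0 - h 0) ^+ 2 * expR (- (2 * K * s)).
  rewrite /A ler_wpM2l ?sqr_ge0// ler_expR lerN2 ler_wpM2l ?mulr_ge0//; lra.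
have h3 : cmod (f s - h s) <= a / 2.
  have := cmodBD (f s - l) (h s - l); have -> : f s - l - (h s - l) = f s - h s by ring.
  lra.
have : cmod (f s - h s) ^+ 2 <= (a / 2) ^+ 2 by rewrite ler_pXn2r ?nnegrE ?cmod_ge0//; lra.
have -> : (a / 2) ^+ 2 = A / 4 by rewrite -aA; field.
lra.
Qed.

Lemma chordal_field z (x : R) : (Re z - x) ^+ 2 + Im z ^+ 2 != 0 ->
  Re (2 / (z - (x%:C)%C)) = 2 * (Re z - x) / ((Re z - x) ^+ 2 + Im z ^+ 2) /\
  Im (2 / (z - (x%:C)%C)) = - (2 * Im z / ((Re z - x) ^+ 2 + Im z ^+ 2)).
Proof.
set p := Re z; set q := Im z; set N := _ + _ => nz.
have -> : z - (x%:C)%C = ((p - x) +i* q)%C.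
  by rewrite /p /q; case: (z) => a b; apply/eqP; rewrite eq_complex/= subr0 !eqxx.
have nz' : ((p - x) +i* q)%C != 0.
  by apply: contraNneq nz => -[]; rewrite /N => -> ->; rewrite expr0n addr0.
have two : 2 = (2 +i* 0)%C :> R[i] by rewrite -(rmorph_nat (real_complex R) 2).
suff -> : 2 / ((p - x) +i* q)%C = ((2 * (p - x) / N) +i* (- (2 * q / N)))%C by [].
apply: (canLR (mulfK nz')); rewrite two; apply/eqP; rewrite eq_complex/=.
by apply/andP; split; apply/eqP; rewrite /N; field.
Qed.

(** Keeping k for c^2 + s^2, instead of 1, makes the identities purely polynomial; cosine and sine
    are substituted afterwards. *)
Lemma radial_field z (c s k : R) : c ^+ 2 + s ^+ 2 = k -> (c +i* s)%C != z ->
  let r2 := Re z ^+ 2 + Im z ^+ 2 in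
  let sigma := Im z * c - Re z * s in
  let N := k - 2 * (Re z * c + Im z * s) + r2 in
  N = cmod ((c +i* s)%C - z) ^+ 2 /\
  Re (z * (((c +i* s)%C + z) / ((c +i* s)%C - z))) = (Re z * (k - r2) - 2 * Im z * sigma) / N /\
  Im (z * (((c +i* s)%C + z) / ((c +i* s)%C - z))) = (Im z * (k - r2) + 2 * Re z * sigma) / N.
Proof.
move=> <- ne r2 sigma N; have nz : (c +i* s)%C - z != 0 by rewrite subr_eq0.
have NE : N = cmod ((c +i* s)%C - z) ^+ 2.
  by rewrite cmod_sqr /N /r2; case: (z) => p q /=; ring.
have N0 : N != 0 by rewrite NE expf_neq0// cmod_eq0.
split=> //; suff -> : z * (((c +i* s)%C + z) / ((c +i* s)%C - z)) =
   (((Re z * (c ^+ 2 + s ^+ 2 - r2) - 2 * Im z * sigma) / N) +i*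
    ((Im z * (c ^+ 2 + s ^+ 2 - r2) + 2 * Re z * sigma) / N))%C by [].
rewrite mulrA; apply: (canLR (mulfK nz)).
have e1 (a b x y : R) : a / N * x - b / N * y = (a * x - b * y) / N by ring.
have e2 (a b x y : R) : a / N * x + b / N * y = (a * x + b * y) / N by ring.
clear NE; move: N0 e1 e2; rewrite /N /sigma /r2 {N r2 sigma ne nz}; case: z => p q /=.
set N := _ + _; move=> N0 e1 e2; apply/eqP; rewrite eq_complex/=; apply/andP; split; apply/eqP.
  by rewrite e1; apply: (canRL (mulfK N0)); rewrite /N; ring.
by rewrite e2; apply: (canRL (mulfK N0)); rewrite /N; ring.
Qed.

Lemma within_half_line W s : {within `[0, +oo[, continuous W} -> {within `[0, s], continuous W}.
Proof.
apply: continuous_subspaceW => x; rewrite /= !in_itv/= => /andP[-> _].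
by [].
Qed.

Lemma curve_not_before (gamma : R -> C) T t : set_inj `[0, +oo[ gamma -> t < T -> 0 <= T ->
  ~ (gamma @` `[0, t]) (gamma T).
Proof.
move=> gi tT T0 [s]; rewrite /= in_itv/= => /andP[s0 st] /(gi s T) h.
have : s = T by apply: h; rewrite inE /= in_itv/= ?s0 ?T0.
lra.
Qed.

Section ChordalSwallow.
Variables (gamma : R -> C) (W : R -> R) (G : R -> C -> C) (T : R).
Hypothesis T0 : 0 < T.
Hypothesis gamma_inj : set_inj `[0, +oo[ gamma.
Hypothesis gamma0 : gamma 0 = 0.
Hypothesis gammaH : forall t, 0 < t -> H (gamma t).
Hypothesis cW : {within `[0, +oo[, continuous W}.
Hypothesis W0 : W 0 = 0.
Hypothesis HG : forall t, 0 <= t -> chordal_map gamma t (G t).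
Hypothesis dG : forall t z, 0 <= t -> (H `\` gamma @` `[0, t]) z ->
  is_time_derive (G ^~ z) t (2 / (G t z - ((W t)%:C)%C)).

Let z0 := gamma T.

Let dom t : 0 <= t < T -> (H `\` gamma @` `[0, t]) z0.
Proof.
by move=> /andP[t0 tT]; split; [exact: gammaH|exact: curve_not_before (ltW T0)].
Qed.

Let GH t z : 0 <= t -> (H `\` gamma @` `[0, t]) z -> 0 < Im (G t z).
Proof. by move=> t0 tz; have [[[gf _ _] _] _] := HG t0; exact: (gf z tz). Qed.

Lemma half_plane_start : H `\` gamma @` `[0, 0] = H.
Proof.
apply/seteqP; split=> [z [Hz _]//|z Hz]; split=> // -[s]; rewrite /= in_itv/= -eq_le => /eqP <-.
by rewrite gamma0 => z00; move: Hz; rewrite -z00 /upper_half_plane/= ltxx.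
Qed.

Lemma chordal_start z : H z -> G 0 z = z.
Proof.
have [cG Goo] := HG (lexx 0); move: cG Goo; rewrite half_plane_start => cG Goo.
apply: conformal_half_plane_id => // e e0.
have /Goo[K _ HK] : nbhs (0 : C) [set w | cmod w < e].
  by apply/nbhs_cmodP; exists e => // w; rewrite subr0.
exists (Num.max K 0); first by rewrite le_max lexx orbT.
by move=> w Hw; rewrite gt_max => /andP[Kw _]; exact: (HK w).
Qed.

Let sub_dom z t : 0 <= t <= T -> (H `\` gamma @` `[0, T]) z -> (H `\` gamma @` `[0, t]) z.
Proof.
move=> /andP[t0 tT] [Hz nz]; split=> // -[s]; rewrite /= in_itv/= => /andP[s0 st] sz.
by apply: nz; exists s => //; rewrite /= in_itv/= s0 (le_trans st tT).
Qed.

(** Otherwise the velocity is bounded and g_t(z0) has a limit l, which by Gronwall has positive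
    height. Then l = g_T(z1) with z1 off gamma[0, T], and the orbits of z0 and z1 meet at time T
    under a field that is Lipschitz along them. So z0 = z1, although z0 = gamma(T). *)
Lemma chordal_swallow d : 0 < d -> exists2 t, 0 <= t < T &
  (Re (G t z0) - W t) ^+ 2 + Im (G t z0) ^+ 2 < d.
Proof.
move=> d0; apply: contrapT => no.
have far t : 0 <= t < T -> d <= (Re (G t z0) - W t) ^+ 2 + Im (G t z0) ^+ 2.
  by move=> tT; rewrite leNgt; apply/negP => lt; apply: no; exists t.
pose a := Num.sqrt d; have a0 : 0 < a by rewrite sqrtr_gt0.
have cmE z (x : R) : cmod (z - (x%:C)%C) ^+ 2 = (Re z - x) ^+ 2 + Im z ^+ 2.
  by rewrite cmod_sqr; case: z => p q /=; rewrite subr0.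
have fara t : 0 <= t < T -> a <= cmod (G t z0 - ((W t)%:C)%C).
  move=> tT; rewrite -(@ler_pXn2r _ 2) ?nnegrE ?cmod_ge0 ?(ltW a0)//.
  by rewrite cmE sqr_sqrtr ?far// ltW.
have Hf t : 0 <= t < T -> is_time_derive (G ^~ z0) t (2 / (G t z0 - ((W t)%:C)%C)).
  by move=> tT; apply: dG; [case/andP: tT|exact: dom].
have two : cmod (2 : C) = 2 by rewrite -(rmorph_nat (real_complex R) 2) cmod_real ger0_norm.
have vK t : 0 <= t < T -> cmod (2 / (G t z0 - ((W t)%:C)%C)) <= 2 / a.
  move=> tT; rewrite cmodM cmodV two ler_pM2l// lef_pV2 ?posrE//; first exact: fara.
  exact: lt_le_trans (fara t tT).
have K0 : 0 <= 2 / a by rewrite divr_ge0 ?ltW.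
have [l Hl] := trajectory_limit T0 K0 Hf vK.
(* The height decreases at a relative rate 2 / N <= 2 / d, so it never falls below [eta]. *)
pose eta := Im (G 0 z0) * expR (- (2 / d * T)).
have T00 : (0 : R) <= 0 < T by rewrite lexx T0.
have eta0 : 0 < eta by rewrite mulr_gt0 ?expR_gt0// GH//; exact: dom.
have Imf s : 0 <= s < T -> eta <= Im (G s z0).
  move=> /andP[s0 sT].
  have sub t : 0 <= t <= s -> 0 <= t < T by move=> /andP[? ?]; apply/andP; split; lra.
  have cI := time_derive_within (@Im_real_part R) (fun t ts => Hf t (sub t ts)).
  have := @exp_gronwall R (fun t => Im (G t z0)) (fun t => Im (2 / (G t z0 - ((W t)%:C)%C))) (2 / d) s s0 cI.
  have c1 t : 0 < t < s -> is_derive t 1 (fun t => Im (G t z0)) (Im (2 / (G t z0 - ((W t)%:C)%C))).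
    move=> /andP[t0 ts]; apply: (time_derive_is_derive (@Im_real_part R) t0).
    by apply: Hf; apply/andP; split; lra.
  have c2 t : 0 < t < s -> - (2 / d * Im (G t z0)) <= Im (2 / (G t z0 - ((W t)%:C)%C)).
    move=> /andP[t0 ts]; have tT : 0 <= t < T by apply/andP; split; lra.
    have N0 := lt_le_trans d0 (far t tT).
    have [_ ->] := chordal_field (lt0r_neq0 N0).
    rewrite lerN2 [leRHS]mulrAC; apply: ler_wpM2l.
      by rewrite mulr_ge0// ltW// GH//; [case/andP: tT|exact: dom].
    by rewrite lef_pV2 ?posrE// far.
  move=> /(_ c1 c2); apply: le_trans; rewrite /eta ler_wpM2l//.
    by rewrite ltW// GH//; exact: dom.
  by rewrite ler_expR lerN2 ler_wpM2l ?divr_ge0 ?ltW.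
have Hl0 : H l.
  have [l0|] := ltP 0 (Im l); first by [].
  move=> l0; pose t := Num.max 0 (T - eta / (2 * (2 * (2 / a)))).
  have ka : 0 < 2 * (2 * (2 / a)) by rewrite !mulr_gt0// invr_gt0.
  have ek : 0 < eta / (2 * (2 * (2 / a))) by rewrite divr_gt0.
  have tT : 0 <= t < T by rewrite /t le_max lexx gt_max T0/=; lra.
  have tt : T - eta / (2 * (2 * (2 / a))) <= t by rewrite /t le_max lexx orbT.
  have h1 := Imf t tT; have h2 := Hl t tT; have := ImlipB (G t z0) l.
  rewrite ler_norml => /andP[_ h3].
  have : 2 * (2 / a) * (T - t) <= eta / 2.
    have : T - t <= eta / (2 * (2 * (2 / a))) by lra.
    rewrite ler_pdivlMr// => h; lra.
  lra.
have TT : 0 <= T by exact: ltW.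
have [[[_ _ gs] _] _] := HG TT; have [z1 Az1 gz1] := gs l Hl0.
have Hh t : 0 <= t <= T -> is_time_derive (G ^~ z1) t (2 / (G t z1 - ((W t)%:C)%C)).
  by move=> tT; apply: dG; [case/andP: tT|exact: sub_dom].
have cI := time_derive_within (@Im_real_part R) Hh.
(* The orbit of z1 exists on the closed interval [0, T], so by compactness its height has a positive
   minimum, which keeps it away from the driving point. *)
have [|m m0 Hm] := continuous_pos_min TT cI.
  by move=> t tT; apply: GH; [case/andP: tT|exact: sub_dom].
have farm t : 0 <= t <= T -> m <= cmod (G t z1 - ((W t)%:C)%C).
  move=> tT; apply: le_trans (Hm t tT) _; apply: le_trans _ (Im_le_cmod _).
  by case: (G t z1) => p q /=; rewrite subr0.
have K1 : 0 <= 2 / (a * m) by rewrite divr_ge0 ?mulr_ge0 ?ltW.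
have HK t : 0 <= t < T -> cmod (2 / (G t z0 - ((W t)%:C)%C) - 2 / (G t z1 - ((W t)%:C)%C)) <=
    2 / (a * m) * cmod (G t z0 - G t z1).
  move=> tT; have tT' : 0 <= t <= T by case/andP: tT => -> /ltW.
  have f1 := fara t tT; have f2 := farm t tT'.
  move: f1 f2; set x := G t z0; set y := G t z1; set o := ((W t)%:C)%C => f1 f2.
  have p1 := lt_le_trans a0 f1; have p2 := lt_le_trans m0 f2.
  have n1 : x - o != 0 by rewrite -cmod_gt0. have n2 : y - o != 0 by rewrite -cmod_gt0.
  have -> : 2 / (x - o) - 2 / (y - o) = 2 * (y - x) / ((x - o) * (y - o)) by field; rewrite n1 n2.
  rewrite !cmodM cmodV cmodM two (cmodB y) mulrAC ler_wpM2r ?cmod_ge0// ler_pM2l//.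
  by rewrite lef_pV2 ?posrE ?mulr_gt0//; apply: ler_pM => //; exact: ltW.
have lim e : 0 < e -> exists2 d, 0 < d & forall t, 0 <= t < T -> T - d < t -> cmod (G t z0 - l) < e.
  move=> e0; have k0 : 0 < 2 * (2 / a) by rewrite !mulr_gt0// invr_gt0.
  exists (e / (2 * (2 / a))); first by rewrite divr_gt0.
  move=> t tT td; apply: le_lt_trans (Hl t tT) _.
  by rewrite mulrC -ltr_pdivlMr//; lra.
have := trajectories_do_not_meet T0 K1 Hf Hh HK lim gz1.
have Hz1 : H z1 by case: Az1.
rewrite !chordal_start//; last exact: gammaH.
move=> zz; case: Az1 => _; apply; exists T; last exact: zz.
by rewrite /= in_itv/= TT lexx.
Qed.

Lemma chordal_bounds E : 0 <= E -> (forall s, 0 <= s -> abs_continuous_on 0 s W) -> energy_le W E ->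
  T <= expR (8^-1 * E) * Im z0 ^+ 2 / 4 /\ cmod z0 ^+ 2 <= 8 * T * expR (4^-1 * E).
Proof.
move=> E0 acW eW.
have cW' s : 0 <= s < T -> {within `[0, s], continuous W} by move=> _; exact: within_half_line.
have acW' s : 0 <= s < T -> abs_continuous_on 0 s W by move=> /andP[s0 _]; exact: acW.
have Hf t : 0 <= t < T -> is_time_derive (G ^~ z0) t (2 / (G t z0 - ((W t)%:C)%C)).
  by move=> tT; apply: dG; [case/andP: tT|exact: dom].
have q0 t : 0 <= t < T -> 0 < Im (G t z0) by move=> tT; apply: GH; [case/andP: tT|exact: dom].
have sub s t : 0 <= s < T -> 0 <= t <= s -> 0 <= t < T.
  by move=> /andP[? ?] /andP[? ?]; apply/andP; split; lra.
have cp s : 0 <= s < T -> {within `[0, s], continuous (fun t => Re (G t z0))}.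
  by move=> sT; exact: (time_derive_within (@Re_real_part R) (fun t ts => Hf t (sub s t sT ts))).
have cq s : 0 <= s < T -> {within `[0, s], continuous (fun t => Im (G t z0))}.
  by move=> sT; exact: (time_derive_within (@Im_real_part R) (fun t ts => Hf t (sub s t sT ts))).
have pos t : 0 <= t < T -> (Re (G t z0) - W t) ^+ 2 + Im (G t z0) ^+ 2 != 0.
  by move=> tT; rewrite lt0r_neq0// ltr_wpDl ?sqr_ge0// exprn_gt0// q0.
have dp t : 0 < t < T -> is_derive t 1 (fun t => Re (G t z0))
    (2 * (Re (G t z0) - W t) / ((Re (G t z0) - W t) ^+ 2 + Im (G t z0) ^+ 2)).
  move=> /andP[t0 tT]; have tT' : 0 <= t < T by rewrite ltW.
  have [<- _] := chordal_field (pos t tT').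
  exact: (time_derive_is_derive (@Re_real_part R) t0 (Hf t tT')).
have dq t : 0 < t < T -> is_derive t 1 (fun t => Im (G t z0))
    (- (2 * Im (G t z0) / ((Re (G t z0) - W t) ^+ 2 + Im (G t z0) ^+ 2))).
  move=> /andP[t0 tT]; have tT' : 0 <= t < T by rewrite ltW.
  have [_ <-] := chordal_field (pos t tT').
  exact: (time_derive_is_derive (@Im_real_part R) t0 (Hf t tT')).
have st : G 0 z0 = z0 by apply: chordal_start; exact: gammaH.
split.
  have := chordal_time_le E0 cW' acW' eW q0 cp cq dp dq chordal_swallow.
  by rewrite /= st.
have := chordal_start_le E0 cW' acW' eW q0 cp cq dp dq chordal_swallow.
by rewrite /= st W0 subr0 cmod_sqr.
Qed.

End ChordalSwallow.

End Swallowing.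

(** * Points of the curve reach the driving singularity: the disk *)

Section DiskSwallowing.
Variable R : realType.
Local Notation C := (R[i]^o).
Local Notation Re := (@complex.Re R).
Local Notation Im := (@complex.Im R).
Local Notation H := (@upper_half_plane R).
Local Notation D := (@odisk R 1).
Implicit Types (f h v w g : R -> C) (z l : C) (s t T K e d E M : R) (W : R -> R).

Section RadialSwallow.
Variables (gamma : R -> C) (W : R -> R) (G : R -> C -> C) (T : R).
Hypothesis T0 : 0 < T.
Hypothesis gamma_inj : set_inj `[0, +oo[ gamma.
Hypothesis gamma0 : gamma 0 = 1.
Hypothesis gammaD : forall t, 0 < t -> D (gamma t).
Hypothesis cW : {within `[0, +oo[, continuous W}.
Hypothesis HG : forall t, 0 <= t -> radial_map gamma t (G t).
Hypothesis dG : forall t z, 0 <= t -> (D `\` gamma @` `[0, t]) z ->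
  is_time_derive (G ^~ z) t (G t z * ((cis (W t) + G t z) / (cis (W t) - G t z))).

Let z0 := gamma T.

Let dom t : 0 <= t < T -> (D `\` gamma @` `[0, t]) z0.
Proof.
by move=> /andP[t0 tT]; split; [exact: gammaD|exact: curve_not_before (ltW T0)].
Qed.

Let GD t z : 0 <= t -> (D `\` gamma @` `[0, t]) z -> cmod (G t z) < 1.
Proof. by move=> t0 tz; have [[[gf _ _] _] _ _ _] := HG t0; exact: (gf z tz). Qed.

Lemma disk_start : D `\` gamma @` `[0, 0] = D.
Proof.
apply/seteqP; split=> [z [Dz _]//|z Dz]; split=> // -[s]; rewrite /= in_itv/= -eq_le => /eqP <-.
by rewrite gamma0 => z00; move: Dz; rewrite -z00 /odisk/= cmod1 ltxx.
Qed.

Lemma radial_start z : D z -> cmod (G 0 z) = cmod z.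
Proof.
by have [cG _ G0 dG0] := HG (lexx 0); move: cG; rewrite disk_start => cG; exact: conformal_disk_modulus.
Qed.

Let sub_dom z t : 0 <= t <= T -> (D `\` gamma @` `[0, T]) z -> (D `\` gamma @` `[0, t]) z.
Proof.
move=> /andP[t0 tT] [Hz nz]; split=> // -[s]; rewrite /= in_itv/= => /andP[s0 st] sz.
by apply: nz; exists s => //; rewrite /= in_itv/= s0 (le_trans st tT).
Qed.

Let Gneq0 t : 0 <= t < T -> G t z0 != 0.
Proof.
move=> tT; have /andP[t0 _] := tT; have [[[_ gi _] _] A0 G0 _] := HG t0.
apply/eqP => gz; have z00 : z0 = 0 by apply: gi; rewrite ?inE ?gz ?G0//; exact: dom.
have [_ [_ nz] _ _] := HG (ltW T0); apply: nz; exists T; last exact: z00.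
by rewrite /= in_itv/= lexx ltW.
Qed.

Lemma cmod_cis (x : R) : cmod (cis x) = 1.
Proof. by rewrite /cmod/= cos2Dsin2 sqrtr1. Qed.

Let cis_neq t z : cmod z < 1 -> cis t != z.
Proof. by move=> z1; apply: contraTneq z1 => <-; rewrite cmod_cis ltxx. Qed.

Let vel t z := z * ((cis (W t) + z) / (cis (W t) - z)).
Let Delta t z := 1 - 2 * (Re z * cos (W t) + Im z * sin (W t)) + (Re z ^+ 2 + Im z ^+ 2).

Let field_eq t z : cmod z < 1 -> Delta t z = cmod (cis (W t) - z) ^+ 2 /\
  Re (vel t z) = (Re z * (1 - (Re z ^+ 2 + Im z ^+ 2)) - 2 * Im z * (Im z * cos (W t) - Re z * sin (W t))) / Delta t z /\
  Im (vel t z) = (Im z * (1 - (Re z ^+ 2 + Im z ^+ 2)) + 2 * Re z * (Im z * cos (W t) - Re z * sin (W t))) / Delta t z.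
Proof. by move=> z1; exact: (radial_field (cos2Dsin2 (W t)) (cis_neq (W t) z1)). Qed.

Let Delta_gt0 t z : cmod z < 1 -> 0 < Delta t z.
Proof.
move=> z1; have [-> _] := field_eq t z1.
by rewrite exprn_gt0// cmod_gt0 subr_eq0 cis_neq.
Qed.

(** The argument of [chordal_swallow], with 1 - |g_t(z0)|^2 in the role of the height. At the end
    the injectivity of g_0 suffices to identify z0 and z1. *)
Lemma radial_swallow d : 0 < d -> exists2 t, 0 <= t < T & Delta t (G t z0) < d.
Proof.
move=> d0; apply: contrapT => no.
have far t : 0 <= t < T -> d <= Delta t (G t z0).
  by move=> tT; rewrite leNgt; apply/negP => lt; apply: no; exists t.
pose a := Num.sqrt d; have a0 : 0 < a by rewrite sqrtr_gt0.
have G1 t : 0 <= t < T -> cmod (G t z0) < 1 by move=> tT; apply: GD; [case/andP: tT|exact: dom].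
have fara t : 0 <= t < T -> a <= cmod (cis (W t) - G t z0).
  move=> tT; rewrite -(@ler_pXn2r _ 2) ?nnegrE ?cmod_ge0 ?(ltW a0)//.
  by have [<- _] := field_eq t (G1 t tT); rewrite sqr_sqrtr ?far// ltW.
have Hf t : 0 <= t < T -> is_time_derive (G ^~ z0) t (vel t (G t z0)).
  by move=> tT; apply: dG; [case/andP: tT|exact: dom].
have vK t : 0 <= t < T -> cmod (vel t (G t z0)) <= 2 / a.
  move=> tT; have g1 := G1 t tT; rewrite /vel mulrA cmodM cmodV; apply: ler_pM.
  - exact: cmod_ge0.
  - by rewrite invr_ge0 cmod_ge0.
  - rewrite cmodM; have := cmodD (cis (W t)) (G t z0); rewrite cmod_cis => h.
    apply: (@le_trans _ _ (1 * 2)); last by rewrite mul1r.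
    by apply: ler_pM; rewrite ?cmod_ge0//; lra.
  - by rewrite lef_pV2 ?posrE// ?fara//; exact: lt_le_trans (fara t tT).
have K0 : 0 <= 2 / a by rewrite divr_ge0 ?ltW.
have [l Hl] := trajectory_limit T0 K0 Hf vK.
pose u t := 1 - (Re (G t z0) * Re (G t z0) + Im (G t z0) * Im (G t z0)).
have uE t : u t = 1 - cmod (G t z0) ^+ 2 by rewrite cmod_sqr /u; ring.
have u0 t : 0 <= t < T -> 0 < u t.
  by move=> tT; rewrite uE subr_gt0 expr_lt1 ?G1// cmod_ge0.
pose eta := u 0 * expR (- (2 / d * T)).
have T00 : (0 : R) <= 0 < T by rewrite lexx T0.
have eta0 : 0 < eta by rewrite mulr_gt0 ?expR_gt0// u0.
have uf s : 0 <= s < T -> eta <= u s.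
  move=> /andP[s0 sT].
  have sub t : 0 <= t <= s -> 0 <= t < T by move=> /andP[? ?]; apply/andP; split; lra.
  have cR := time_derive_within (@Re_real_part R) (fun t ts => Hf t (sub t ts)).
  have cI := time_derive_within (@Im_real_part R) (fun t ts => Hf t (sub t ts)).
  have cu : {within `[0, s], continuous u}.
    have cr2 := within_add (within_mul cR cR) (within_mul cI cI).
    have c0 : {within `[0, s], continuous (fun=> 1 : R)} by move=> x; exact: cvg_cst.
    exact: (within_sub c0 cr2).
  have c1 t : 0 < t < s -> is_derive t 1 u (- (2 * (1 - u t) * u t / Delta t (G t z0))).
    move=> /andP[t0 ts]; have tT : 0 <= t < T by apply/andP; split; lra.
    have dR := time_derive_is_derive (@Re_real_part R) t0 (Hf t tT).
    have dI := time_derive_is_derive (@Im_real_part R) t0 (Hf t tT).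
    have h := is_derive_sub (is_derive_cst (1 : R) t 1) (is_derive_add (is_derive_mul dR dR) (is_derive_mul dI dI)).
    apply: is_derive_eqv h _; have D0 := Delta_gt0 t (G1 t tT).
    have [_ [-> ->]] := field_eq t (G1 t tT); rewrite sub0r /u.
    move: D0; set De := Delta _ _ => D0; move: D0.
    by case: (G t z0) De => p q De /= D0; field; rewrite lt0r_neq0.
  have c2 t : 0 < t < s -> - (2 / d * u t) <= - (2 * (1 - u t) * u t / Delta t (G t z0)).
    move=> /andP[t0 ts]; have tT : 0 <= t < T by apply/andP; split; lra.
    have D0 := Delta_gt0 t (G1 t tT); have ut := u0 t tT.
    have u1 : 1 - u t <= 1 by lra.
    have k : 1 <= d^-1 * Delta t (G t z0) by rewrite ler_pdivlMl// mulr1 far.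
    have k2 := ler_wpM2l (ltW ut) k; have k3 := ler_wpM2l (ltW ut) u1.
    rewrite lerN2 ler_pdivrMr//.
    have -> : 2 * (1 - u t) * u t = 2 * (u t * (1 - u t)) by ring.
    have -> : 2 / d * u t * Delta t (G t z0) = 2 * (u t * (d^-1 * Delta t (G t z0))) by ring.
    by apply: ler_wpM2l => //; exact: le_trans k3 k2.
  have := exp_gronwall s0 cu c1 c2; apply: le_trans; rewrite /eta ler_wpM2l//.
    by rewrite ltW// u0.
  by rewrite ler_expR lerN2 ler_wpM2l ?divr_ge0 ?ltW.
have Dl : D l.
  have [l0|] := ltP (cmod l) 1; first by [].
  move=> l0; pose t := Num.max 0 (T - eta / (4 * (2 * (2 / a)))).
  have ka : 0 < 4 * (2 * (2 / a)) by rewrite !mulr_gt0// invr_gt0.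
  have ek : 0 < eta / (4 * (2 * (2 / a))) by rewrite divr_gt0.
  have tT : 0 <= t < T by rewrite /t le_max lexx gt_max T0/=; lra.
  have tt : T - eta / (4 * (2 * (2 / a))) <= t by rewrite /t le_max lexx orbT.
  have h1 := uf t tT; have h2 := Hl t tT; have h3 := cmod_rev l (G t z0).
  have h4 : 2 * (2 / a) * (T - t) <= eta / 4.
    have : T - t <= eta / (4 * (2 * (2 / a))) by lra.
    rewrite ler_pdivlMr// => h; lra.
  rewrite cmodB in h3; rewrite uE in h1; have g1 := G1 t tT; have g0 := cmod_ge0 (G t z0).
  have h5 : 1 - cmod (G t z0) <= eta / 4 by lra.
  have h6 : 1 - cmod (G t z0) ^+ 2 <= 2 * (1 - cmod (G t z0)) by nra.
  lra.
have TT : 0 <= T by exact: ltW.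
have [[[_ _ gs] _] _ _ _] := HG TT; have [z1 Az1 gz1] := gs l Dl.
have Hh t : 0 <= t <= T -> is_time_derive (G ^~ z1) t (vel t (G t z1)).
  by move=> tT; apply: dG; [case/andP: tT|exact: sub_dom].
have H1 t : 0 <= t <= T -> cmod (G t z1) < 1.
  by move=> tT; apply: GD; [case/andP: tT|exact: sub_dom].
have [m m0 Hm] : exists2 m, 0 < m & forall t, 0 <= t <= T -> m <= 1 - (Re (G t z1) * Re (G t z1) + Im (G t z1) * Im (G t z1)).
  have cR := time_derive_within (@Re_real_part R) Hh.
  have cI := time_derive_within (@Im_real_part R) Hh.
  have cr2 := within_add (within_mul cR cR) (within_mul cI cI).
  have c0 : {within `[0, T], continuous (fun=> 1 : R)} by move=> x; exact: cvg_cst.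
  apply: (continuous_pos_min TT (within_sub c0 cr2)).
  move=> t tT; have := H1 t tT; rewrite -!expr2 -cmod_sqr subr_gt0 => h.
  by rewrite expr_lt1 ?cmod_ge0.
have m2 : 0 < m / 2 by lra.
have farm t : 0 <= t <= T -> m / 2 <= cmod (cis (W t) - G t z1).
  move=> tT; have := Hm t tT; rewrite -!expr2 -cmod_sqr => h.
  have := cmod_rev (cis (W t)) (G t z1); rewrite cmod_cis.
  have := H1 t tT; have := cmod_ge0 (G t z1); move: h; set c := cmod (G t z1) => h c0 c1 k.
  have : 1 - c ^+ 2 <= 2 * (1 - c) by nra.
  lra.
have K1 : 0 <= 4 / (a * (m / 2)) by rewrite divr_ge0 ?mulr_ge0 ?ltW.
have HK t : 0 <= t < T -> cmod (vel t (G t z0) - vel t (G t z1)) <=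
    4 / (a * (m / 2)) * cmod (G t z0 - G t z1).
  move=> tT; have tT' : 0 <= t <= T by case/andP: tT => -> /ltW.
  have f1 := fara t tT; have f2 := farm t tT'; have x1 := G1 t tT; have y1 := H1 t tT'.
  have o1 := cmod_cis (W t); rewrite /vel.
  move: f1 f2 x1 y1 o1; set x := G t z0; set y := G t z1; set o := cis (W t) => f1 f2 x1 y1 o1.
  have p1 := lt_le_trans a0 f1; have p2 := lt_le_trans m2 f2.
  have n1 : o - x != 0 by rewrite -cmod_gt0. have n2 : o - y != 0 by rewrite -cmod_gt0.
  have -> : x * ((o + x) / (o - x)) - y * ((o + y) / (o - y)) =
     (o * o + o * (x + y) - x * y) / ((o - x) * (o - y)) * (x - y) by field; rewrite n1 n2.
  rewrite cmodM; apply: ler_wpM2r; first exact: cmod_ge0.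
  rewrite cmodM cmodV cmodM; apply: ler_pM.
  - exact: cmod_ge0.
  - by rewrite invr_ge0 mulr_ge0 ?cmod_ge0.
  - have i1 := cmodBD (o * o + o * (x + y)) (x * y); have i2 := cmodD (o * o) (o * (x + y)).
    have i3 := cmodD x y; move: i1 i2; rewrite !cmodM o1 !mul1r => i1 i2.
    have : cmod x * cmod y <= 1 * 1 by apply: ler_pM; rewrite ?cmod_ge0// ltW.
    lra.
  - by rewrite lef_pV2 ?posrE ?mulr_gt0//; apply: ler_pM => //; exact: ltW.
have lim e : 0 < e -> exists2 d, 0 < d & forall t, 0 <= t < T -> T - d < t -> cmod (G t z0 - l) < e.
  move=> e0; have k0 : 0 < 2 * (2 / a) by rewrite !mulr_gt0// invr_gt0.
  exists (e / (2 * (2 / a))); first by rewrite divr_gt0.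
  move=> t tT td; apply: le_lt_trans (Hl t tT) _.
  by rewrite mulrC -ltr_pdivlMr//; lra.
have zz := trajectories_do_not_meet T0 K1 Hf Hh HK lim gz1.
have [[[_ gi _] _] _ _ _] := HG (lexx 0).
have T1 : (0 : R) <= 0 <= T by rewrite lexx TT.
have : z0 = z1 by apply: gi; rewrite ?inE; [exact: dom|exact: sub_dom|exact: zz].
move=> z01; case: Az1 => _; apply; exists T; last exact: z01.
by rewrite /= in_itv/= TT lexx.
Qed.

Lemma radial_bounds E : 0 <= E -> (forall s, 0 <= s -> abs_continuous_on 0 s W) -> energy_le W E ->
  [/\ 0 < cmod z0, T <= expR (8^-1 * E) * - ln (cmod z0) & expR (- T) / 4 <= cmod z0].
Proof.
move=> E0 acW eW.
have cW' s : 0 <= s < T -> {within `[0, s], continuous W} by move=> _; exact: within_half_line.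
have acW' s : 0 <= s < T -> abs_continuous_on 0 s W by move=> /andP[s0 _]; exact: acW.
have Hf t : 0 <= t < T -> is_time_derive (G ^~ z0) t (vel t (G t z0)).
  by move=> tT; apply: dG; [case/andP: tT|exact: dom].
have G1 t : 0 <= t < T -> cmod (G t z0) < 1 by move=> tT; apply: GD; [case/andP: tT|exact: dom].
have r0 t : 0 <= t < T -> 0 < Re (G t z0) ^+ 2 + Im (G t z0) ^+ 2.
  by move=> tT; rewrite -cmod_sqr exprn_gt0// cmod_gt0 Gneq0.
have r1 t : 0 <= t < T -> Re (G t z0) ^+ 2 + Im (G t z0) ^+ 2 < 1.
  by move=> tT; rewrite -cmod_sqr expr_lt1 ?cmod_ge0// G1.
have sub s t : 0 <= s < T -> 0 <= t <= s -> 0 <= t < T.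
  by move=> /andP[? ?] /andP[? ?]; apply/andP; split; lra.
have cp s : 0 <= s < T -> {within `[0, s], continuous (fun t => Re (G t z0))}.
  by move=> sT; exact: (time_derive_within (@Re_real_part R) (fun t ts => Hf t (sub s t sT ts))).
have cq s : 0 <= s < T -> {within `[0, s], continuous (fun t => Im (G t z0))}.
  by move=> sT; exact: (time_derive_within (@Im_real_part R) (fun t ts => Hf t (sub s t sT ts))).
pose p t := Re (G t z0); pose q t := Im (G t z0).
have dp t : 0 < t < T -> is_derive t 1 p
    ((p t * (1 - (p t ^+ 2 + q t ^+ 2)) - 2 * q t * (q t * cos (W t) - p t * sin (W t))) / Delta t (G t z0)).
  move=> /andP[t0 tT]; have tT' : 0 <= t < T by rewrite ltW.
  have [_ [<- _]] := field_eq t (G1 t tT').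
  exact: (time_derive_is_derive (@Re_real_part R) t0 (Hf t tT')).
have dq t : 0 < t < T -> is_derive t 1 q
    ((q t * (1 - (p t ^+ 2 + q t ^+ 2)) + 2 * p t * (q t * cos (W t) - p t * sin (W t))) / Delta t (G t z0)).
  move=> /andP[t0 tT]; have tT' : 0 <= t < T by rewrite ltW.
  have [_ [_ <-]] := field_eq t (G1 t tT').
  exact: (time_derive_is_derive (@Im_real_part R) t0 (Hf t tT')).
have T00 : (0 : R) <= 0 < T by rewrite lexx T0.
have st : Num.sqrt (p 0 ^+ 2 + q 0 ^+ 2) = cmod z0.
  by rewrite -(radial_start (gammaD T0)).
rewrite -st; split.
- by rewrite sqrtr_gt0 r0.
- exact: (@radial_time_le R W E T E0 T0 cW' acW' eW p q r0 r1 cp cq dp dq radial_swallow).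
- exact: (@radial_start_ge R W T T0 cW' p q r0 r1 cp cq dp dq radial_swallow).
Qed.

End RadialSwallow.

End DiskSwallowing.

(** * From the estimates to the escape events *)

Section Escape.
Variable R : realType.
Local Notation C := (R[i]^o).
Local Notation Re := (@complex.Re R).
Local Notation Im := (@complex.Im R).
Local Notation H := (@upper_half_plane R).
Local Notation D := (@odisk R 1).
Implicit Types (f h v w g : R -> C) (z l : C) (s t T K e d E M : R) (W : R -> R).

(** The energy carries a factor 1/2, so an energy below [M] bounds the integral of W'^2 by
    [2 * M]. *)
Lemma energy_lower_bound (driving : set (R -> R)) M :
  (forall W, driving W -> (forall T, 0 <= T -> abs_continuous_on 0 T W) ->
     energy_le W (2 * M) -> False) ->
  (M%:E <= energy_of driving)%E.
Proof.
move=> no; apply: le_ereal_inf_tmp => _ [W dW <-]; rewrite /dirichlet_energy.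
case: asboolP => [acW|_]; last exact: leey.
rewrite leNgt; apply/negP => lt; apply: (no W dW acW).
rewrite /energy_le; move: lt; set I := (\int[_]_(_ in _) _)%E; case: I => [r| |].
- by rewrite -EFinM !lte_fin lee_fin => h; lra.
- by rewrite gt0_muley ?lte_fin ?invr_gt0.
- by move=> _; exact: leNye.
Qed.

(** The infimum need not be attained, hence the added 1; the maximum with 0 spares a proof that [s]
    is nonnegative. *)
Lemma hitting_time_before (P : set R) s : (hitting_time P <= s%:E)%E ->
  exists2 t, 0 <= t < Num.max s 0 + 1 & P t.
Proof.
move=> hs; have : (hitting_time P < (Num.max s 0 + 1)%:E)%E.
  apply: le_lt_trans hs _; rewrite lte_fin.
  by have : s <= Num.max s 0; [rewrite le_max lexx|lra].
move=> /ereal_inf_lt[_ [t [+ Pt] <-]]; rewrite /= in_itv/= andbT lte_fin => t0 ts.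
by exists t => //; rewrite t0.
Qed.

End Escape.

Theorem corollary4p9 (R : realType) :
  (forall (M : R) (n : nat), 0 <= M -> (0 < n)%N ->
     exists N : nat, (n < N)%N /\
       (M%:E <= ereal_inf (@radial_energy R @` @radial_escape R n N))%E) /\
  (forall (M : R) (n : nat), 0 <= M -> (0 < n)%N ->
     exists N : nat, (n < N)%N /\
       (M%:E <= ereal_inf (@chordal_energy R @` @chordal_escape R n N))%E).
Proof.
split=> M n M0 n0.
(* By [radial_time_le], [B] bounds every time at which the curve is outside the disk of radius
   exp(-n). *)
- pose B := expR (8^-1 * (2 * M)) * n%:R : R; have B0 : 0 <= B by rewrite mulr_ge0// expR_ge0.
  have B4 : 0 <= B + 4 by lra.
  have hN := archi_boundP B4; set b := Num.bound _ in hN.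
  (* N exceeds B + 4: before time B + 1 the modulus is at least exp(-B-1) / 4, and 4 <= exp(3). *)
  exists (n + b).+1; split; first by rewrite ltnS leq_addr.
  apply: le_ereal_inf_tmp => _ [gamma [[[cg ig g0 gD _] _] esc] <-].
  apply: energy_lower_bound => W [cW W0 [G HG dG]] acW eW.
  have E0 : 0 <= 2 * M by lra.
  have [s [hs far]] : exists s, (radial_rho gamma (n + b).+1 <= s%:E)%E /\ expR (- n%:R) < cmod (gamma s).
    apply: contrapT => no; apply: esc => _ [s ss <-]; rewrite /cdisk/= leNgt.
    by apply/negP => lt; apply: no; exists s.
  have [t /andP[t0 ts] small] := hitting_time_before hs; rewrite /= in small.
  have sB : Num.max s 0 <= B.
    have [s0|s0] := leP s 0; first exact: B0.
    have [z0 h _] := radial_bounds s0 ig g0 gD cW HG dG E0 acW eW.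
    apply: le_trans h _; rewrite /B ler_wpM2l ?expR_ge0// lerNl -[leLHS]expRK.
    by rewrite ler_ln ?posrE ?expR_gt0// ltW.
  have t1 : 0 < t.
    rewrite lt_neqAle t0 andbT; apply/eqP => t00; move: small.
    rewrite -t00 g0 cmod1 => h; have : expR (- (n + b).+1%:R) <= 1 :> R by rewrite expR_le1 oppr_le0.
    lra.
  have [_ _ h] := radial_bounds t1 ig g0 gD cW HG dG E0 acW eW.
  have e3 : 1 + 3 <= expR 3 :> R by apply: expR_ge1Dx.
  have : expR (- t) <= 4 * expR (- (n + b).+1%:R) by lra.
  have : 4 * expR (- (n + b).+1%:R) < expR (- t).
    apply: (@le_lt_trans _ _ (expR (3 - (n + b).+1%:R))).
      by rewrite expRD ler_wpM2r ?expR_ge0//; lra.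
    rewrite ltr_expR; have : b%:R <= (n + b).+1%:R :> R by rewrite ler_nat leqW// leq_addl.
    by lra.
  lra.
(* By [chordal_time_le], [T1] bounds every time at which the curve is in the disk of radius n, since
   Im z <= |z|. *)
- pose T1 := expR (8^-1 * (2 * M)) * n%:R ^+ 2 / 4 : R.
  have T10 : 0 <= T1 by rewrite divr_ge0// mulr_ge0 ?expR_ge0// sqr_ge0.
  (* By [chordal_start_le], [B] bounds |gamma(t)|^2 for t < T1 + 1; since N <= N^2, it suffices that
     N exceed [B] itself. *)
  pose B := 8 * (T1 + 1) * expR (4^-1 * (2 * M)).
  have B0 : 0 <= B by rewrite mulr_ge0 ?expR_ge0//; lra.
  have hN := archi_boundP B0; set b := Num.bound _ in hN.
  exists (n + b).+1; split; first by rewrite ltnS leq_addr.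
  apply: le_ereal_inf_tmp => _ [gamma [[[cg ig g0 gH _] _] [_ [[s hs <-] near0]]] <-].
  apply: energy_lower_bound => W [cW W0 [G HG dG]] acW eW.
  have E0 : 0 <= 2 * M by lra.
  rewrite /odisk/= in near0.
  have [t /andP[t0 ts] big] := hitting_time_before hs; rewrite /= in big.
  have sB : Num.max s 0 <= T1.
    have [s0|s0] := leP s 0; first exact: T10.
    have [h _] := chordal_bounds s0 ig g0 gH cW W0 HG dG E0 acW eW.
    apply: le_trans h _; rewrite /T1 ler_wpM2r// ler_wpM2l ?expR_ge0//.
    have Is : 0 < complex.Im (gamma s) := gH s s0.
    rewrite ler_pXn2r ?nnegrE ?(ltW Is)//.
    by apply: le_trans (ltW near0); exact: Im_le_cmod.
  have t1 : 0 < t.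
    rewrite lt_neqAle t0 andbT; apply/eqP => t00; move: big.
    by rewrite -t00 g0 cmod0 ltNge ler0n.
  have [_ h] := chordal_bounds t1 ig g0 gH cW W0 HG dG E0 acW eW.
  have k1 : 8 * t * expR (4^-1 * (2 * M)) <= B by rewrite /B ler_wpM2r ?expR_ge0//; lra.
  have k2 : b%:R <= (n + b).+1%:R :> R by rewrite ler_nat leqW// leq_addl.
  have k3 : 1 <= (n + b).+1%:R :> R by rewrite ler1n.
  have k4 : (n + b).+1%:R ^+ 2 <= cmod (gamma t) ^+ 2.
    by rewrite ler_pXn2r ?nnegrE ?cmod_ge0// ltW.
  have k5 : (n + b).+1%:R <= (n + b).+1%:R ^+ 2 :> R by rewrite expr2 ler_peMl// (le_trans _ k3).
  lra.
Qed.
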